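(* Let $p, q \geq 0$ be integers, let $R > r > 0$ be real numbers, and let $s, c, t \in \mathbb{R}^3$. Suppose $|s| \leq r$, $|c| \geq R$, and $|t - c| \leq |c| - R$ (i.e. $t$ lies in the closed ball of radius $|c|-R$ centered at $c$). Let $\phi_s(x) = 1/|x-s|$, and let $\mathcal{M}_{0}^{p}[\phi_s]$ be the $p$-th order multipole expansion of $\phi_s$ centered at the origin, $\mathcal{L}_{c}^{q}[\phi_s]$ the $q$-th order local expansion of $\phi_s$ centered at $c$, and $\mathcal{L}_{c}^{q}[\mathcal{M}_{0}^{p}[\phi_s]]$ the $q$-th order local expansion centered at $c$ of the function $\mathcal{M}_{0}^{p}[\phi_s]$. Then $$\left| \mathcal{L}_{c}^{q}[\phi_s](t) - \mathcal{L}_{c}^{q}[\mathcal{M}_{0}^{p}[\phi_s]](t) \right| \leq \frac{1}{R-r}\left(\frac{r}{R}\right)^{p+1}.$$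
   Context: $|\cdot|$ is the Euclidean norm on $\mathbb{R}^3$ (and the modulus on $\mathbb{C}$); for $x \neq 0$, $\hat{x} = x/|x|$; $\mathbb{S}^2$ is the unit sphere in $\mathbb{R}^3$ with surface measure $dS$; $B(c,\rho)$ and $\bar B(c,\rho)$ are the open and closed Euclidean balls. Spherical harmonics: for integers $n \geq 0$, $-n \leq m \leq n$, and $\xi = (\sin\theta\cos\varphi, \sin\theta\sin\varphi, \cos\theta)\in\mathbb{S}^2$, $$Y_n^m(\xi) = \sqrt{\frac{2n+1}{4\pi}\frac{(n-m)!}{(n+m)!}}\, e^{im\varphi} P_n^m(\cos\theta),$$ where $P_n^m$ is the associated Legendre function of degree $n$ and order $m$ (with the usual convention for negative order $P_n^{-m} = (-1)^m \frac{(n-m)!}{(n+m)!}P_n^m$). They form an orthonormal basis of $L^2(\mathbb{S}^2)$ (complex inner product $\int_{\mathbb{S}^2} f\overline{g}\,dS$). Solid harmonics: $R_n^m(x) = |x|^n Y_n^m(\hat x)$ (with $R_n^m(0)=0$ for $n>0$ and $R_0^0 \equiv 1/\sqrt{4\pi}$), and $I_n^m(x) = |x|^{-(n+1)}Y_n^m(\hat x)$ for $x\neq 0$. Local expansion: let $\rho>0$, $c\in\mathbb{R}^3$, and let $f$ be harmonic in $B(c,\rho)$ and continuous on $\bar B(c,\rho)$. Its local coefficients are $L_n^m = \rho^{-n}\int_{\mathbb{S}^2} f(c+\rho\xi)\overline{Y_n^m(\xi)}\,dS(\xi)$, and its $p$-th order local expansion centered at $c$ is $$\mathcal{L}_c^p[f](x)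 = \sum_{n=0}^p\sum_{m=-n}^n L_n^m R_n^m(x-c).$$ Multipole expansion: let $\rho>0$, $c\in\mathbb{R}^3$, and let $f$ be harmonic in the exterior of $B(c,\rho)$, continuous on $\mathbb{R}^3\setminus B(c,\rho)$, with $|f(x)|\to 0$ as $|x|\to\infty$. Its multipole coefficients are $M_n^m = \rho^{n+1}\int_{\mathbb{S}^2} f(c+\rho\xi)\overline{Y_n^m(\xi)}\,dS(\xi)$, and its $p$-th order multipole expansion centered at $c$ is $$\mathcal{M}_c^p[f](x) = \sum_{n=0}^p\sum_{m=-n}^n M_n^m I_n^m(x-c).$$ In both cases the coefficients do not depend on the admissible choice of $\rho$; the expansions are understood using any $\rho>0$ for which the hypotheses hold, and the resulting formulas define functions on all of $\mathbb{R}^3$ (local) or $\mathbb{R}^3\setminus\{c\}$ (multipole). *)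

(* Defs.v *)
From Stdlib Require Import Reals ZArith Lra.
From Coquelicot Require Import Coquelicot.
Open Scope R_scope.

(** Points of Euclidean 3-space.  Coquelicot's product structures provide the
    vector operations [plus], [minus], [scal] and the (product) topology. *)
Notation R3 := (R * R * R)%type.

Definition crd1 (x : R3) : R := fst (fst x).
Definition crd2 (x : R3) : R := snd (fst x).
Definition crd3 (x : R3) : R := snd x.

Definition enorm (x : R3) : R :=
  sqrt (crd1 x ^ 2 + crd2 x ^ 2 + crd3 x ^ 2).

Definition hat (x : R3) : R3 := scal (/ enorm x) x.

Definition oball (c : R3) (rho : R) (x : R3) : Prop := enorm (minus x c) < rho.
Definition cball (c : R3) (rho : R) (x : R3) : Prop := enorm (minus x c) <= rho.

(** ** Harmonic functions *)

Inductive axis : Set := ax1 | ax2 | ax3.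

Definition basis (i : axis) : R3 :=
  match i with
  | ax1 => (1, 0, 0)
  | ax2 => (0, 1, 0)
  | ax3 => (0, 0, 1)
  end.

Definition ex_partial (i : axis) (u : R3 -> R) (x : R3) : Prop :=
  ex_derive (fun h : R => u (plus x (scal h (basis i)))) 0.
Definition partial (i : axis) (u : R3 -> R) (x : R3) : R :=
  Derive (fun h : R => u (plus x (scal h (basis i)))) 0.

(** [D] is meant to be open in the next three definitions. *)
Definition C1_on (D : R3 -> Prop) (u : R3 -> R) : Prop :=
  forall x, D x -> forall i, ex_partial i u x /\ continuous (partial i u) x.

Definition C2_on (D : R3 -> Prop) (u : R3 -> R) : Prop :=
  C1_on D u /\ forall i, C1_on D (partial i u).

Definition laplacian (u : R3 -> R) (x : R3) : R :=
  partial ax1 (partial ax1 u) x + partial ax2 (partial ax2 u) x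
  + partial ax3 (partial ax3 u) x.

Definition harmonic_on_R (D : R3 -> Prop) (u : R3 -> R) : Prop :=
  C2_on D u /\ forall x, D x -> laplacian u x = 0.

Definition harmonic_on (D : R3 -> Prop) (f : R3 -> C) : Prop :=
  harmonic_on_R D (fun x => Re (f x)) /\ harmonic_on_R D (fun x => Im (f x)).

(** ** The unit sphere *)

Definition sph (theta phi : R) : R3 :=
  (sin theta * cos phi, sin theta * sin phi, cos theta).

(** Angular coordinates of a unit vector, with values in [[0, PI]] and
    [(-PI, PI]].  On the polar axis the azimuth takes the conventional value
    [acos 0], which is irrelevant since [assoc_legendre n m] vanishes at [1]
    and [-1] for [m <> 0]. *)
Definition polar (xi : R3) : R := acos (crd3 xi).
Definition azimuth (xi : R3) : R :=
  let a := acos (crd1 xi / sqrt (crd1 xi ^ 2 + crd2 xi ^ 2)) in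
  if Rle_dec 0 (crd2 xi) then a else - a.

(** Integral with respect to surface measure, [dS = sin theta dphi dtheta]. *)
Definition sphere_RInt_R (g : R3 -> R) : R :=
  RInt (fun theta =>
    RInt (fun phi => g (sph theta phi) * sin theta) 0 (2 * PI)) 0 PI.

Definition sphere_RInt (g : R3 -> C) : C :=
  (sphere_RInt_R (fun xi => Re (g xi)), sphere_RInt_R (fun xi => Im (g xi))).

(** ** Spherical harmonics *)

(** Rodrigues' formula. *)
Definition legendre (n : nat) (x : R) : R :=
  / (2 ^ n * INR (fact n)) * Derive_n (fun y => (y ^ 2 - 1) ^ n) n x.

(** Order [m >= 0], with the Condon-Shortley sign;
    [sqrt (1 - x ^ 2) ^ m] is (1 - x^2)^(m/2). *)
Definition assoc_legendre_nat (n m : nat) (x : R) : R :=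
  (-1) ^ m * sqrt (1 - x ^ 2) ^ m * Derive_n (legendre n) m x.

Definition assoc_legendre (n : nat) (m : Z) (x : R) : R :=
  if Z_le_dec 0 m then assoc_legendre_nat n (Z.abs_nat m) x
  else let k := Z.abs_nat m in
       (-1) ^ k * (INR (fact (n - k)) / INR (fact (n + k)))
       * assoc_legendre_nat n k x.

Definition expi (t : R) : C := (cos t, sin t).

(** Used only for [- n <= m <= n]. *)
Definition Y (n : nat) (m : Z) (xi : R3) : C :=
  (RtoC (sqrt ((2 * INR n + 1) / (4 * PI)
               * (INR (fact (Z.to_nat (Z.of_nat n - m)))
                  / INR (fact (Z.to_nat (Z.of_nat n + m))))))
   * expi (IZR m * azimuth xi)
   * RtoC (assoc_legendre n m (cos (polar xi))))%C.

(** At [x = 0] the first formula gives [0] for [n > 0] and [1 / sqrt (4 PI)]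
    for [n = 0], since [0 ^ 0 = 1]; the second is meaningful for [x <> 0]. *)
Definition solid_R (n : nat) (m : Z) (x : R3) : C :=
  (RtoC (enorm x ^ n) * Y n m (hat x))%C.
Definition solid_I (n : nat) (m : Z) (x : R3) : C :=
  (RtoC (/ enorm x ^ (n + 1)) * Y n m (hat x))%C.

(** ** Local and multipole expansions

    The radius [rho] at which the coefficients are computed is an explicit
    argument; the admissibility predicates say when it may be used.  There,
    [dom] is the domain of definition of [f], which must contain the closed
    set on which [f] is required to be continuous: values given to [f] outside
    [dom] by totality (such as [/ 0]) never count. *)

(** Sum of [a n m] over [0 <= n <= p] and [- n <= m <= n], with [m = k - n]. *)
Definition sum_nm (p : nat) (a : nat -> Z -> C) : C :=
  sum_n (fun n => sum_n (fun k => a n (Z.of_nat k - Z.of_nat n)%Z) (2 * n)) p.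

Definition local_admissible
    (dom : R3 -> Prop) (f : R3 -> C) (c : R3) (rho : R) : Prop :=
  0 < rho
  /\ (forall x, cball c rho x -> dom x)
  /\ harmonic_on (oball c rho) f
  /\ continuous_on (cball c rho) f.

Definition local_coef (f : R3 -> C) (c : R3) (rho : R) (n : nat) (m : Z) : C :=
  (RtoC (/ rho ^ n)
   * sphere_RInt (fun xi => f (plus c (scal rho xi)) * Cconj (Y n m xi)))%C.

Definition local_exp (p : nat) (f : R3 -> C) (c : R3) (rho : R) (x : R3) : C :=
  sum_nm p (fun n m => local_coef f c rho n m * solid_R n m (minus x c))%C.

(** The exterior of the ball is the open set [rho < |x - c|]. *)
Definition multipole_admissible
    (dom : R3 -> Prop) (f : R3 -> C) (c : R3) (rho : R) : Prop :=
  0 < rho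
  /\ (forall x, ~ oball c rho x -> dom x)
  /\ harmonic_on (fun x => ~ cball c rho x) f
  /\ continuous_on (fun x => ~ oball c rho x) f
  /\ (forall eps, 0 < eps ->
        exists M, forall x, M < enorm x -> Cmod (f x) < eps).

Definition multipole_coef (f : R3 -> C) (c : R3) (rho : R) (n : nat) (m : Z)
  : C :=
  (RtoC (rho ^ (n + 1))
   * sphere_RInt (fun xi => f (plus c (scal rho xi)) * Cconj (Y n m xi)))%C.

(** Defined for [x <> c]. *)
Definition multipole_exp (p : nat) (f : R3 -> C) (c : R3) (rho : R) (x : R3)
  : C :=
  sum_nm p (fun n m => multipole_coef f c rho n m * solid_I n m (minus x c))%C.

(** Defined for [x <> s]. *)
Definition point_potential (s : R3) (x : R3) : C :=
  RtoC (/ enorm (minus x s)).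

(* Main.v *)
Require Import Defs.
From Stdlib Require Import Reals.
From Coquelicot Require Import Coquelicot.
From Stdlib Require Import ZArith Lra Lia Psatz FunctionalExtensionality.
Open Scope R_scope.

(** The potential of [s] is, near [c], the sum over [n] of its multipole terms
    [psi_n].  Let [A n k] be the term of degree [k] of the Taylor expansion of
    [psi_n] at [c], taken at [y = t - c].  The two local expansions differ by the
    sum of [A n k] over [k <= q] and [n > p].  Estimating the difference of the
    functions on a sphere would lose a factor depending on [q], because cutting
    off a local expansion does not decrease the supremum norm.  The terms have to
    be bounded one by one:
      [|A n k| <= binom (n + k, k) |s| ^ n |y| ^ k / |c| ^ (n + k + 1)].
    The sum of the right hand sides over all [k] is
    [|s| ^ n / (|c| - |y|) ^ (n + 1) <= r ^ n / R' ^ (n + 1)], and the sum of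
    these over [n > p] is the claimed bound ([double_tail]).

    The bound on [A n k] comes from Whittaker's integral ([whittaker]).  Let [d]
    be a unit vector and let [e t] run through the unit vectors orthogonal to [d].
    For [|w| < D], the number [1 / |D d + w|] is the mean over [t] of
    [1 / (D + w . zeta)], where [zeta = d + i e t] satisfies
    [|w . zeta| <= |w|].  With [D d = c], expanding under the integral writes
    [A n k], up to sign, as the mean of
      [binom (n + k, k) (s . zeta) ^ n (y . zeta) ^ k / |c| ^ (n + k + 1)].

    It remains to compute the expansions defined by integrals against the
    spherical harmonics.  The vector [zeta] is isotropic, and
    [(y . zeta) ^ n] is a combination of the solid harmonics of degree [n]
    ([wave_span]): with [zeta] written through a spinor [(a, b)], it is
      [(2 a b y3 + a ^ 2 (y1 + i y2) - b ^ 2 (y1 - i y2)) ^ n],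
    a generating function of the solid harmonics.  By orthonormality, which
    follows from Rodrigues' formula through integration by parts, a function that
    is on a sphere the uniform sum of such combinations has exactly these as the
    terms of its expansion ([projection]).

    The multipole expansion at [0], the local expansion of the potential and the
    local expansion of the multipole terms lead to means over circles around the
    directions of [s], [c - s] and [c].  They are compared through the
    uniqueness of the expansion of [1 / |x + a v|] in powers of [a]
    ([taylor_coef_frame]). *)

(** * Finite sums of complex numbers *)

(** [sum_n] over [C] produces equations in the carrier of a canonical structure;
    [ring] and [field] only recognise [C] itself. *)
Ltac Ceq := match goal with |- @eq _ ?a ?b => change (@eq C a b) end.
Ltac Req := match goal with |- @eq _ ?a ?b => change (@eq R a b) end.

Lemma csum_O (a : nat -> C) : sum_n a 0 = a 0%nat.
Proof. exact (sum_O a). Qed.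

Lemma csum_S (a : nat -> C) n : sum_n a (S n) = (sum_n a n + a (S n))%C.
Proof. exact (sum_Sn a n). Qed.

Lemma csum_plus (a b : nat -> C) n :
  sum_n (fun k => (a k + b k)%C) n = (sum_n a n + sum_n b n)%C.
Proof. exact (sum_n_plus a b n). Qed.

Lemma csum_mult_l c (a : nat -> C) n :
  sum_n (fun k => (c * a k)%C) n = (c * sum_n a n)%C.
Proof. exact (sum_n_mult_l (K := C_Ring) c a n). Qed.

Lemma csum_mult_r c (a : nat -> C) n :
  sum_n (fun k => (a k * c)%C) n = (sum_n a n * c)%C.
Proof. exact (sum_n_mult_r (K := C_Ring) c a n). Qed.

Lemma csum_minus (a b : nat -> C) n :
  sum_n (fun k => (a k - b k)%C) n = (sum_n a n - sum_n b n)%C.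
Proof.
  induction n as [|n IH]; [now rewrite !csum_O|].
  rewrite !csum_S, IH. Ceq; ring.
Qed.

Lemma rsum_O (a : nat -> R) : sum_n a 0 = a 0%nat.
Proof. exact (sum_O a). Qed.

Lemma rsum_S (a : nat -> R) n : sum_n a (S n) = sum_n a n + a (S n).
Proof. exact (sum_Sn a n). Qed.

Lemma rsum_mult_l c (a : nat -> R) n :
  sum_n (fun k => c * a k) n = c * sum_n a n.
Proof. exact (sum_n_mult_l (K := R_Ring) c a n). Qed.

Lemma rsum_le (a b : nat -> R) n :
  (forall k, (k <= n)%nat -> a k <= b k) -> sum_n a n <= sum_n b n.
Proof.
  induction n as [|n IH]; intros H; [rewrite !rsum_O; auto|].
  rewrite !rsum_S. apply Rplus_le_compat; auto.
Qed.

Lemma csum_Cmod (a : nat -> C) n :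
  Cmod (sum_n a n) <= sum_n (fun k => Cmod (a k)) n.
Proof.
  induction n as [|n IH]; [rewrite !sum_O; lra|].
  rewrite csum_S, rsum_S.
  eapply Rle_trans; [apply Cmod_triangle|]. lra.
Qed.

Lemma csum_head (a : nat -> C) n :
  sum_n a (S n) = (a 0%nat + sum_n (fun k => a (S k)) n)%C.
Proof.
  induction n as [|n IH].
  - rewrite csum_S, !csum_O. reflexivity.
  - rewrite csum_S, IH, csum_S. Ceq; ring.
Qed.

Lemma csum_single (a : nat -> C) j n :
  (j <= n)%nat -> (forall k, (k <= n)%nat -> k <> j -> a k = 0%C) ->
  sum_n a n = a j.
Proof.
  induction n as [|n IH]; intros Hj H.
  - rewrite csum_O. f_equal. lia.
  - rewrite csum_S. destruct (Nat.eq_dec j (S n)) as [->|Hne].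
    + replace (sum_n a n) with (RtoC 0); [Ceq; ring|].
      assert (E : forall m, (m <= n)%nat -> @eq C (sum_n a m) 0).
      { induction m as [|m IHm]; intros Hm.
        - rewrite csum_O. apply H; lia.
        - rewrite csum_S, IHm by lia. rewrite H by lia. Ceq; ring. }
      symmetry. apply E. lia.
    + rewrite IH; [|lia|intros; apply H; lia].
      rewrite (H (S n)) by lia. Ceq; ring.
Qed.

Lemma csum_zero (a : nat -> C) n :
  (forall k, (k <= n)%nat -> a k = 0%C) -> @eq C (sum_n a n) 0%C.
Proof.
  intros H. rewrite (csum_single a 0); auto with arith.
Qed.

Lemma Cconj_RtoC x : Cconj (RtoC x) = RtoC x.
Proof. unfold Cconj, RtoC; simpl; f_equal; ring. Qed.

Lemma sign_sq k : (-1) ^ k * (-1) ^ k = 1.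
Proof.
  rewrite <- Rpow_mult_distr. replace (-1 * -1) with 1 by ring. apply pow1.
Qed.

Lemma ratio_bounds a b : 0 <= a < b -> 0 <= a / b < 1.
Proof.
  intros H. split; [apply Rdiv_le_0_compat; lra|].
  apply Rmult_lt_reg_r with b; [lra|]. unfold Rdiv. rewrite Rmult_assoc, Rinv_l; lra.
Qed.

(** * Integration functionals *)

Definition cont {T : UniformSpace} (f : T -> R) : Prop :=
  forall x, continuous f x.
(** Continuity by components: [C] carries two uniform structures in the
    hierarchy, and this avoids choosing between them. *)
Definition ccont {T : UniformSpace} (g : T -> C) : Prop :=
  cont (fun x => Re (g x)) /\ cont (fun x => Im (g x)).

(** What is used of an integral: linearity and boundedness on continuous
    functions.  Two instances are needed, the mean over a circle and the integral
    over the sphere; taking integrands on the parameter space makes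
    continuity that of functions of the parameters. *)
Record mean (T : UniformSpace) := Mean {
  mint : (T -> R) -> R;
  mass : R;
  mint_lin : forall a b f g, cont f -> cont g ->
    mint (fun x => a * f x + b * g x) = a * mint f + b * mint g;
  mint_bound : forall f M, cont f -> (forall x, Rabs (f x) <= M) ->
    Rabs (mint f) <= mass * M }.
Arguments mint {T}.
Arguments mass {T}.

Definition cint {T} (m : mean T) (g : T -> C) : C :=
  (mint m (fun x => Re (g x)), mint m (fun x => Im (g x))).

Section Continuity.
Context {T : UniformSpace}.

Lemma cont_const c : cont (fun _ : T => c).
Proof. intros x. apply continuous_const. Qed.

Lemma cont_plus (f g : T -> R) : cont f -> cont g -> cont (fun x => f x + g x).
Proof. intros Hf Hg x. apply (continuous_plus f g); auto. Qed.

Lemma cont_opp (f : T -> R) : cont f -> cont (fun x => - f x).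
Proof. intros Hf x. apply (continuous_opp f); auto. Qed.

Lemma cont_minus (f g : T -> R) : cont f -> cont g -> cont (fun x => f x - g x).
Proof. intros Hf Hg. apply cont_plus; [auto|now apply cont_opp]. Qed.

Lemma cont_mult (f g : T -> R) : cont f -> cont g -> cont (fun x => f x * g x).
Proof. intros Hf Hg x. apply (continuous_mult f g); auto. Qed.

Lemma cont_inv (f : T -> R) :
  cont f -> (forall x, f x <> 0) -> cont (fun x => / f x).
Proof.
  intros Hf H x. apply (continuous_comp f Rinv); [apply Hf|].
  now apply continuous_Rinv.
Qed.

Lemma ccont_const c : ccont (fun _ : T => c).
Proof. split; [exact (cont_const (Re c))|exact (cont_const (Im c))]. Qed.

Lemma ccont_RtoC (f : T -> R) : cont f -> ccont (fun x => RtoC (f x)).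
Proof. split; [auto|exact (cont_const 0)]. Qed.

Lemma ccont_pair (f g : T -> R) : cont f -> cont g -> ccont (fun x => (f x, g x)).
Proof. split; auto. Qed.

Lemma ccont_plus (f g : T -> C) :
  ccont f -> ccont g -> ccont (fun x => (f x + g x)%C).
Proof.
  intros [F1 F2] [G1 G2]; split;
    [exact (cont_plus _ _ F1 G1)|exact (cont_plus _ _ F2 G2)].
Qed.

Lemma ccont_opp (f : T -> C) : ccont f -> ccont (fun x => (- f x)%C).
Proof. intros [F1 F2]; split; [exact (cont_opp _ F1)|exact (cont_opp _ F2)]. Qed.

Lemma ccont_minus (f g : T -> C) :
  ccont f -> ccont g -> ccont (fun x => (f x - g x)%C).
Proof. intros Hf Hg. apply ccont_plus; [auto|now apply ccont_opp]. Qed.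

Lemma ccont_mult (f g : T -> C) :
  ccont f -> ccont g -> ccont (fun x => (f x * g x)%C).
Proof.
  intros [F1 F2] [G1 G2]; split.
  - exact (cont_minus _ _ (cont_mult _ _ F1 G1) (cont_mult _ _ F2 G2)).
  - exact (cont_plus _ _ (cont_mult _ _ F1 G2) (cont_mult _ _ F2 G1)).
Qed.

Lemma ccont_conj (f : T -> C) : ccont f -> ccont (fun x => Cconj (f x)).
Proof. intros [F1 F2]; split; [exact F1|exact (cont_opp _ F2)]. Qed.

Lemma ccont_pow (f : T -> C) n : ccont f -> ccont (fun x => (f x ^ n)%C).
Proof.
  intros Hf. induction n as [|n IH]; [exact (ccont_const 1)|].
  exact (ccont_mult f (fun x => f x ^ n)%C Hf IH).
Qed.

Lemma ccont_inv (f : T -> C) :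
  ccont f -> (forall x, f x <> 0%C) -> ccont (fun x => (/ f x)%C).
Proof.
  intros [Hr Hi] H.
  assert (Hd : cont (fun x => / (Re (f x) ^ 2 + Im (f x) ^ 2))).
  { apply cont_inv.
    - apply cont_plus; simpl;
        repeat (apply cont_mult; [assumption|]); exact (cont_const 1).
    - intros x E. apply (H x).
      assert (E1 : Re (f x) = 0) by nra. assert (E2 : Im (f x) = 0) by nra.
      destruct (f x) as [u v]. simpl in E1, E2. now subst. }
  split.
  - exact (cont_mult _ _ Hr Hd).
  - exact (cont_mult _ _ (cont_opp _ Hi) Hd).
Qed.

Lemma ccont_sum (f : nat -> T -> C) n :
  (forall k, ccont (f k)) -> ccont (fun x => sum_n (fun k => f k x) n).
Proof.
  intros H. induction n as [|n IH].
  - replace (fun x => sum_n (fun k => f k x) 0) with (f 0%nat); [auto|].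
    extensionality x. now rewrite csum_O.
  - replace (fun x => sum_n (fun k => f k x) (S n))
      with (fun x => (sum_n (fun k => f k x) n + f (S n) x)%C).
    + now apply ccont_plus.
    + extensionality x. now rewrite csum_S.
Qed.

Lemma cont_uniform_limit (f : T -> R) :
  (forall eps, 0 < eps -> exists g, cont g /\ forall x, Rabs (f x - g x) <= eps)
  -> cont f.
Proof.
  intros H x. apply filterlim_locally. intros eps.
  destruct (H (eps / 3)) as [g [Hg Hfg]]; [destruct eps; simpl; lra|].
  assert (He : 0 < eps / 3) by (destruct eps; simpl; lra).
  generalize (proj1 (filterlim_locally g (g x)) (Hg x) (mkposreal _ He)).
  apply filter_imp. intros y Hy.
  change (Rabs (f y - f x) < eps). change (Rabs (g y - g x) < eps / 3) in Hy.
  pose proof (Hfg x). pose proof (Hfg y).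
  replace (f y - f x) with ((f y - g y) + (g y - g x) - (f x - g x)) by ring.
  eapply Rle_lt_trans; [apply Rabs_triang|].
  rewrite Rabs_Ropp.
  pose proof (Rabs_triang (f y - g y) (g y - g x)). lra.
Qed.

Lemma ccont_uniform_limit (f : T -> C) :
  (forall eps, 0 < eps ->
     exists g, ccont g /\ forall x, Cmod (f x - g x)%C <= eps) ->
  ccont f.
Proof.
  intros H. split; apply cont_uniform_limit; intros eps He;
    destruct (H eps He) as [g [[H1 H2] Hg]].
  - exists (fun x => Re (g x)). split; [auto|]. intros x.
    eapply Rle_trans; [|apply (Hg x)]. apply (re_le_Cmod (f x - g x)).
  - exists (fun x => Im (g x)). split; [auto|]. intros x.
    eapply Rle_trans; [|apply (Hg x)].
    eapply Rle_trans; [|apply (Rmax_Cmod (f x - g x)%C)]. apply Rmax_r.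
Qed.

End Continuity.

Section Mean.
Context {T : UniformSpace} (m : mean T).

Lemma cint_ext (f g : T -> C) : (forall x, f x = g x) -> cint m f = cint m g.
Proof. intros H. f_equal. now extensionality x. Qed.

Lemma cint_plus (f g : T -> C) : ccont f -> ccont g ->
  cint m (fun x => (f x + g x)%C) = (cint m f + cint m g)%C.
Proof.
  intros [F1 F2] [G1 G2]. unfold cint, Cplus; simpl. f_equal.
  - rewrite <- (Rmult_1_l (mint m (fun x => Re (f x)))),
      <- (Rmult_1_l (mint m (fun x => Re (g x)))), <- mint_lin by auto.
    f_equal. extensionality x. unfold Re. ring.
  - rewrite <- (Rmult_1_l (mint m (fun x => Im (f x)))),
      <- (Rmult_1_l (mint m (fun x => Im (g x)))), <- mint_lin by auto.
    f_equal. extensionality x. unfold Im. ring.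
Qed.

Lemma cint_scal (c : C) (f : T -> C) : ccont f ->
  cint m (fun x => (c * f x)%C) = (c * cint m f)%C.
Proof.
  intros [F1 F2]. unfold cint, Cmult; simpl. destruct c as [a b]; simpl. f_equal.
  - replace (a * mint m (fun x => Re (f x)) - b * mint m (fun x => Im (f x)))
      with (a * mint m (fun x => Re (f x)) + (- b) * mint m (fun x => Im (f x)))
      by ring.
    rewrite <- mint_lin by auto. f_equal. extensionality x. unfold Re, Im. ring.
  - now rewrite <- mint_lin by auto.
Qed.

Lemma cint_scal_r (c : C) (f : T -> C) : ccont f ->
  cint m (fun x => (f x * c)%C) = (cint m f * c)%C.
Proof.
  intros F. rewrite Cmult_comm, <- cint_scal by auto. f_equal.
  extensionality x. ring.
Qed.

Lemma cint_minus (f g : T -> C) : ccont f -> ccont g ->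
  cint m (fun x => (f x - g x)%C) = (cint m f - cint m g)%C.
Proof.
  intros F G.
  replace (fun x => (f x - g x)%C) with (fun x => (f x + (- (1)) * g x)%C).
  - rewrite cint_plus, cint_scal; auto; [ring|].
    apply ccont_mult; [apply ccont_const|auto].
  - extensionality x. ring.
Qed.

Lemma cint_sum (f : nat -> T -> C) n : (forall k, ccont (f k)) ->
  cint m (fun x => sum_n (fun k => f k x) n) = sum_n (fun k => cint m (f k)) n.
Proof.
  intros H. induction n as [|n IH].
  - rewrite csum_O. f_equal. extensionality x. now rewrite csum_O.
  - rewrite csum_S, <- IH, <- cint_plus; auto; [|now apply ccont_sum].
    f_equal. extensionality x. now rewrite csum_S.
Qed.

(** Rotating the integral onto the positive real axis reduces the estimate to
    the real one, so the constant stays [mass m]. *)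
Lemma cint_bound (f : T -> C) M : ccont f -> (forall x, Cmod (f x) <= M) ->
  Cmod (cint m f) <= mass m * M.
Proof.
  intros F H.
  destruct (Req_dec (Cmod (cint m f)) 0) as [E|E].
  - rewrite E. pose proof (mint_bound _ m _ _ (proj1 F)
      (fun x => Rle_trans _ _ _ (re_le_Cmod (f x)) (H x))).
    eapply Rle_trans; [apply Rabs_pos|eassumption].
  - set (z := cint m f) in *.
    set (u := (Cconj z / RtoC (Cmod z))%C).
    assert (E' : RtoC (Cmod z) <> 0%C) by (intros K; apply E; now injection K).
    assert (Hu : (u * z)%C = RtoC (Cmod z)).
    { unfold u.
      replace (Cconj z / Cmod z * z)%C with ((z * Cconj z) / Cmod z)%C
        by (field; auto).
      rewrite <- Cmod2_conj. rewrite RtoC_pow. field. auto. }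
    assert (Hm : Cmod u = 1).
    { unfold u. rewrite Cmod_div, Cmod_conj, Cmod_R by auto.
      rewrite Rabs_right by (apply Rle_ge, Cmod_ge_0). field. auto. }
    assert (Hc : ccont (fun x => (u * f x)%C))
      by (apply ccont_mult; [apply ccont_const|auto]).
    assert (Hr : Cmod z = mint m (fun x => Re (u * f x)%C)).
    { assert (K : cint m (fun x => (u * f x)%C) = RtoC (Cmod z)).
      { rewrite cint_scal by auto. exact Hu. }
      now injection K. }
    rewrite Hr. eapply Rle_trans; [apply Rle_abs|].
    apply mint_bound; [apply Hc|]. intros x.
    eapply Rle_trans; [apply re_le_Cmod|].
    rewrite Cmod_mult, Hm, Rmult_1_l. apply H.
Qed.

End Mean.

(** * Integrals of continuous functions *)

Lemma cont_ex_RInt (f : R -> R) a b : cont f -> ex_RInt f a b.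
Proof. intros H. apply (ex_RInt_continuous (V := R_CompleteNormedModule)); auto. Qed.

Lemma RInt_lin a b (f g : R -> R) u v : cont f -> cont g ->
  RInt (fun x => a * f x + b * g x) u v = a * RInt f u v + b * RInt g u v.
Proof.
  intros Hf Hg.
  assert (Ha : ex_RInt (fun x => scal a (f x)) u v)
    by (apply (ex_RInt_scal (V := R_NormedModule)); now apply cont_ex_RInt).
  assert (Hb : ex_RInt (fun x => scal b (g x)) u v)
    by (apply (ex_RInt_scal (V := R_NormedModule)); now apply cont_ex_RInt).
  transitivity (RInt (fun x => plus (scal a (f x)) (scal b (g x))) u v);
    [reflexivity|].
  rewrite (RInt_plus (V := R_CompleteNormedModule)) by auto.
  rewrite 2(RInt_scal (V := R_CompleteNormedModule)) by now apply cont_ex_RInt.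
  reflexivity.
Qed.

(** By uniform continuity on the compact segment of integration. *)
Lemma cont_RInt_param (h : R * R -> R) a b : a <= b -> cont h ->
  cont (fun x => RInt (fun y => h (x, y)) a b).
Proof.
  intros Hab Hh x. apply filterlim_locally. intros eps.
  assert (H2 : forall y, a <= y <= b ->
    continuity_2d_pt (fun x y => h (x, y)) x y).
  { intros y _. apply continuity_2d_pt_filterlim.
    apply (continuous_ext h (fun z => h (fst z, snd z))); [now intros []|apply Hh]. }
  assert (He : 0 < eps / (b - a + 1)).
  { apply Rdiv_lt_0_compat; [apply cond_pos|lra]. }
  destruct (uniform_continuity_2d_1d' _ a b x H2 (mkposreal _ He)) as [d Hd].
  exists d. intros z Hz. change (Rabs (z - x) < d) in Hz.
  change (Rabs (RInt (fun y => h (z, y)) a b - RInt (fun y => h (x, y)) a b) < eps).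
  assert (Hc : forall w, cont (fun y => h (w, y))).
  { intros w y. apply (continuous_comp_2 (fun _ => w) (fun y => y)
      (fun u v => h (u, v)) y).
    - apply continuous_const.
    - apply continuous_id.
    - apply (continuous_ext h (fun z => h (fst z, snd z))); [now intros []|].
      apply Hh. }
  replace (RInt (fun y => h (z, y)) a b - RInt (fun y => h (x, y)) a b)
    with (RInt (fun y => 1 * h (z, y) + (-1) * h (x, y)) a b)
    by (rewrite RInt_lin by auto; Req; ring).
  eapply Rle_lt_trans.
  - apply (abs_RInt_le_const _ a b (eps / (b - a + 1))); auto.
    + apply cont_ex_RInt.
      apply (cont_plus (T := R_UniformSpace));
        apply cont_mult; auto; apply cont_const.
    + intros t Ht. left.
      replace (1 * h (z, t) + -1 * h (x, t)) with (h (z, t) - h (x, t)) by ring.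
      apply Rabs_def2 in Hz. pose proof (cond_pos d).
      apply (Hd t x t z); try lra.
      rewrite Rminus_diag, Rabs_R0. apply cond_pos.
  - apply Rmult_lt_reg_r with (b - a + 1); [lra|].
    replace ((b - a) * (eps / (b - a + 1)) * (b - a + 1)) with ((b - a) * eps)
      by (field; lra).
    pose proof (cond_pos eps). nra.
Qed.

Lemma cont_comp_pair {T : UniformSpace} (h : R * R -> R) (f g : T -> R) :
  cont h -> cont f -> cont g -> cont (fun x => h (f x, g x)).
Proof.
  intros Hh Hf Hg x. apply (continuous_comp_2 f g (fun u v => h (u, v)) x); auto.
  apply (continuous_ext h (fun z => h (fst z, snd z))); [now intros []|apply Hh].
Qed.

Lemma cont_fst : cont (T := prod_UniformSpace R_UniformSpace R_UniformSpace) fst.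
Proof. intros x. destruct x. apply continuous_fst. Qed.
Lemma cont_snd : cont (T := prod_UniformSpace R_UniformSpace R_UniformSpace) snd.
Proof. intros x. destruct x. apply continuous_snd. Qed.
Lemma cont_id : cont (T := R_UniformSpace) (fun x => x).
Proof. intros x. apply continuous_id. Qed.
Lemma cont_sin {T : UniformSpace} (f : T -> R) : cont f -> cont (fun x => sin (f x)).
Proof. intros H x. apply (continuous_comp f sin); [apply H|apply continuous_sin]. Qed.
Lemma cont_cos {T : UniformSpace} (f : T -> R) : cont f -> cont (fun x => cos (f x)).
Proof. intros H x. apply (continuous_comp f cos); [apply H|apply continuous_cos]. Qed.

(** * The mean over the circle *)

Definition circle : mean R_UniformSpace.
Proof.
  refine {| mint := fun f => RInt f 0 (2 * PI) / (2 * PI); mass := 1 |}.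
  - intros a b f g Hf Hg. rewrite RInt_lin by auto. unfold Rdiv. ring.
  - intros f M Hf H. pose proof PI_RGT_0.
    unfold Rdiv. rewrite Rabs_mult, (Rabs_right (/ (2 * PI))).
    2:{ left. apply Rinv_0_lt_compat. lra. }
    apply Rmult_le_reg_r with (2 * PI); [lra|].
    rewrite Rmult_assoc, Rinv_l, Rmult_1_r by lra.
    eapply Rle_trans; [apply (abs_RInt_le_const f 0 (2 * PI) M)|]; try lra.
    + now apply cont_ex_RInt.
    + auto.
Defined.

Notation circ := (cint circle).

(** * The integral over the sphere, in the coordinates [(theta, phi)] *)

Notation RR := (prod_UniformSpace R_UniformSpace R_UniformSpace).

Lemma cont_sphere_inner (h : RR -> R) : cont h ->
  cont (fun theta => RInt (fun phi => h (theta, phi) * sin theta) 0 (2 * PI)).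
Proof.
  intros H. pose proof PI_RGT_0.
  apply (cont_RInt_param (fun z => h z * sin (fst z))); [lra|].
  apply cont_mult; [auto|]. apply cont_sin, cont_fst.
Qed.

Lemma cont_slice (h : RR -> R) x : cont h -> cont (fun y => h (x, y)).
Proof.
  intros H. apply (cont_comp_pair h (fun _ => x) (fun y => y)); auto.
  - apply cont_const.
  - apply cont_id.
Qed.

Definition sphere : mean RR.
Proof.
  refine {| mint := fun h => RInt (fun theta =>
              RInt (fun phi => h (theta, phi) * sin theta) 0 (2 * PI)) 0 PI;
            mass := 2 * PI * PI |}.
  - intros a b f g Hf Hg.
    rewrite <- RInt_lin by now apply cont_sphere_inner.
    f_equal. extensionality theta.
    rewrite <- RInt_lin.
    + f_equal. extensionality phi. ring.
    + apply cont_mult; [now apply cont_slice|apply cont_const].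
    + apply cont_mult; [now apply cont_slice|apply cont_const].
  - intros f M Hf H. pose proof PI_RGT_0.
    replace (2 * PI * PI * M) with ((PI - 0) * ((2 * PI - 0) * M)) by ring.
    apply abs_RInt_le_const; [lra| |].
    + apply cont_ex_RInt. now apply cont_sphere_inner.
    + intros theta _. apply abs_RInt_le_const; [lra| |].
      * apply cont_ex_RInt.
        apply cont_mult; [now apply cont_slice|apply cont_const].
      * intros phi _. rewrite Rabs_mult.
        pose proof (H (theta, phi)). pose proof (Rabs_pos (f (theta, phi))).
        pose proof (Rabs_pos (sin theta)).
        assert (Rabs (sin theta) <= 1)
          by (apply Rabs_le; pose proof (SIN_bound theta); lra).
        nra.
Defined.

Lemma sphere_RInt_cint (g : R3 -> C) :
  sphere_RInt g = cint sphere (fun z => g (sph (fst z) (snd z))).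
Proof. reflexivity. Qed.

(** * Fourier modes *)

Lemma expi_plus a b : expi (a + b) = (expi a * expi b)%C.
Proof.
  unfold expi, Cmult; simpl. rewrite cos_plus, sin_plus. f_equal; ring.
Qed.

Lemma expi_0 : expi 0 = 1%C.
Proof. unfold expi. rewrite cos_0, sin_0. reflexivity. Qed.

Lemma expi_opp a : expi (- a) = Cconj (expi a).
Proof. unfold expi, Cconj; simpl. now rewrite cos_neg, sin_neg. Qed.

Lemma expi_pow a n : expi (INR n * a) = (expi a ^ n)%C.
Proof.
  induction n as [|n IH].
  - replace (INR 0 * a) with 0 by (simpl; ring). apply expi_0.
  - rewrite S_INR, Rmult_plus_distr_r, expi_plus, IH, Rmult_1_l.
    change (expi a ^ S n)%C with (expi a * expi a ^ n)%C. ring.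
Qed.

Lemma Cmod_expi a : Cmod (expi a) = 1.
Proof.
  unfold Cmod, expi; simpl fst; simpl snd.
  replace (cos a ^ 2 + sin a ^ 2) with 1; [apply sqrt_1|].
  pose proof (sin2_cos2 a) as H. unfold Rsqr in H. nra.
Qed.

Lemma expi_conj_mult a : (expi a * expi (- a) = 1)%C.
Proof. rewrite <- expi_plus, Rplus_opp_r. apply expi_0. Qed.

Lemma ccont_expi {T : UniformSpace} (f : T -> R) : cont f -> ccont (fun x => expi (f x)).
Proof. intros H. split; [now apply cont_cos|now apply cont_sin]. Qed.

Lemma circ_const c : circ (fun _ => c) = c.
Proof.
  unfold cint; simpl. pose proof PI_RGT_0.
  rewrite !(RInt_const (V := R_CompleteNormedModule)).
  unfold scal; simpl; unfold mult; simpl. destruct c as [a b]; simpl.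
  f_equal; field; lra.
Qed.

Lemma circ_mode (k : Z) : k <> 0%Z -> circ (fun t => expi (IZR k * t)) = 0%C.
Proof.
  intros Hk. apply (not_0_IZR k) in Hk. unfold cint; simpl.
  assert (Hs : sin (IZR k * (2 * PI)) = 0).
  { apply sin_eq_0_1. exists (2 * k)%Z. rewrite mult_IZR. ring. }
  assert (Hc : cos (IZR k * (2 * PI)) = 1).
  { replace (IZR k * (2 * PI)) with (2 * (IZR k * PI)) by ring.
    rewrite cos_2a_sin, (sin_eq_0_1 (IZR k * PI)) by eauto. ring. }
  assert (H1 : is_RInt (fun t => cos (IZR k * t)) 0 (2 * PI) 0).
  { replace 0 with (minus (sin (IZR k * (2 * PI)) / IZR k) (sin (IZR k * 0) / IZR k)) at 2.
    - apply (is_RInt_derive (fun t => sin (IZR k * t) / IZR k)).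
      + intros x _. auto_derive; [auto|field; auto].
      + intros x _. apply (cont_cos (fun t => IZR k * t)).
        apply cont_mult; [apply cont_const|apply cont_id].
    - rewrite Hs, Rmult_0_r, sin_0. unfold minus, plus, opp; simpl. field; auto. }
  assert (H2 : is_RInt (fun t => sin (IZR k * t)) 0 (2 * PI) 0).
  { replace 0 with (minus (- cos (IZR k * (2 * PI)) / IZR k) (- cos (IZR k * 0) / IZR k)) at 2.
    - apply (is_RInt_derive (fun t => - cos (IZR k * t) / IZR k)).
      + intros x _. auto_derive; [auto|field; auto].
      + intros x _. apply (cont_sin (fun t => IZR k * t)).
        apply cont_mult; [apply cont_const|apply cont_id].
    - rewrite Hc, Rmult_0_r, cos_0. unfold minus, plus, opp; simpl. field; auto. }
  apply (is_RInt_unique (V := R_CompleteNormedModule)) in H1.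
  apply (is_RInt_unique (V := R_CompleteNormedModule)) in H2.
  rewrite H1, H2. unfold Rdiv. rewrite Rmult_0_l. reflexivity.
Qed.

(** * The geometric series on the unit circle *)

Lemma limit_nonpos (x : R) (u : nat -> R) :
  (forall n, x <= u n) -> is_lim_seq u 0 -> x <= 0.
Proof.
  intros H Hu.
  apply (is_lim_seq_le (fun _ => x) u x 0); auto. apply is_lim_seq_const.
Qed.

Lemma Cmod_small_eq (a b : C) (u : nat -> R) :
  (forall n, Cmod (a - b)%C <= u n) -> is_lim_seq u 0 -> a = b.
Proof.
  intros H Hu.  assert (E : (a - b)%C = 0%C).
  { apply Cmod_eq_0. apply Rle_antisym; [now apply (limit_nonpos _ u)|].
    apply Cmod_ge_0. }
  replace a with ((a - b) + b)%C by ring. rewrite E. ring.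
Qed.

Lemma Cmod_1_minus (z : C) : Cmod z < 1 -> 1 - Cmod z <= Cmod (1 - z)%C.
Proof.
  intros H. pose proof (Cmod_triangle (1 - z)%C z) as K.
  replace (1 - z + z)%C with (RtoC 1) in K by ring. rewrite Cmod_1 in K. lra.
Qed.

Lemma C1_minus_neq0 (z : C) : Cmod z < 1 -> (1 - z)%C <> 0%C.
Proof.
  intros H E. pose proof (Cmod_1_minus z H) as K. rewrite E, Cmod_0 in K. lra.
Qed.

Lemma geometric_remainder (z : C) n : (1 - z)%C <> 0%C ->
  (/ (1 - z) - sum_n (fun k => z ^ k)%C n)%C = (z ^ S n / (1 - z))%C.
Proof.
  intros H. induction n as [|n IH].
  - rewrite csum_O. simpl. field. auto.
  - rewrite csum_S. 
    replace (/ (1 - z) - (sum_n (fun k => z ^ k) n + z ^ S n))%C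
      with ((/ (1 - z) - sum_n (fun k => z ^ k) n) - z ^ S n)%C by (Ceq; ring).
    rewrite IH. rewrite (Cpow_S z (S n)). field. auto.
Qed.

Lemma is_lim_seq_geom0 c q : 0 <= q < 1 -> is_lim_seq (fun n => c * q ^ S n) 0.
Proof.
  intros Hq. replace (Finite 0) with (Rbar_mult c 0) by (simpl; f_equal; ring).
  apply is_lim_seq_scal_l.
  apply (is_lim_seq_incr_1 (fun n => q ^ n)).
  apply is_lim_seq_geom. rewrite Rabs_right; lra.
Qed.

(** The mean value property at the origin for [1 / (1 - z)]: in the geometric
    series only the constant term has a nonzero mean. *)
Lemma circ_geometric (mu : C) (k : Z) : Cmod mu < 1 -> k <> 0%Z ->
  circ (fun t => (/ (1 - mu * expi (IZR k * t)))%C) = 1%C.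
Proof.
  intros Hmu Hk.
  set (z := fun t => (mu * expi (IZR k * t))%C).
  assert (Hz : forall t, Cmod (z t) = Cmod mu).
  { intros t. unfold z. rewrite Cmod_mult, Cmod_expi. ring. }
  assert (Hn : forall t, (1 - z t)%C <> 0%C).
  { intros t. apply C1_minus_neq0. now rewrite Hz. }
  assert (Cz : ccont (T := R_UniformSpace) z).
  { apply ccont_mult; [apply ccont_const|]. apply ccont_expi.
    apply cont_mult; [apply cont_const|apply cont_id]. }
  assert (Ci : ccont (T := R_UniformSpace) (fun t => (/ (1 - z t))%C)).
  { apply ccont_inv; auto. apply ccont_minus; auto. apply ccont_const. }
  apply (Cmod_small_eq _ _ (fun n => / (1 - Cmod mu) * Cmod mu ^ S n)).
  2:{ apply is_lim_seq_geom0. split; [apply Cmod_ge_0|auto]. }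
  intros n.
  assert (Hs : circ (fun t => sum_n (fun j => z t ^ j)%C n) = 1%C).
  { rewrite (cint_sum circle (fun j t => (z t ^ j)%C)) by (intros; now apply ccont_pow).
    rewrite (csum_single _ 0); [|lia|].
    - apply (circ_const 1).
    - intros j _ Hj. unfold z.
      rewrite (cint_ext circle _
        (fun t => (mu ^ j * expi (IZR (Z.of_nat j * k) * t))%C)).
      + rewrite (cint_scal circle).
        * rewrite circ_mode by lia. ring.
        * apply ccont_expi. apply cont_mult; [apply cont_const|apply cont_id].
      + intros t. rewrite Cpow_mult_l, <- expi_pow.
        do 2 f_equal. rewrite mult_IZR, <- INR_IZR_INZ. ring. }
  assert (Csum : ccont (T := R_UniformSpace) (fun t => sum_n (fun j => z t ^ j)%C n)).
  { apply (ccont_sum (fun j t => (z t ^ j)%C)). intros; now apply ccont_pow. }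
  pose proof (cint_minus circle _ _ Ci Csum) as Hd. rewrite Hs in Hd. 
  change (Cmod (circ (fun t : R_UniformSpace => / (1 - z t)) - 1)%C
          <= / (1 - Cmod mu) * Cmod mu ^ S n).
  rewrite <- Hd, <- (Rmult_1_l (_ * _)). apply (cint_bound circle).
  { now apply ccont_minus. }
  intros t. rewrite geometric_remainder by auto.
  rewrite Cmod_div, Cmod_pow, Hz by auto. unfold Rdiv. rewrite Rmult_comm.
  apply Rmult_le_compat_r; [apply pow_le, Cmod_ge_0|].
  apply Rinv_le_contravar; [lra|]. rewrite <- (Hz t).
  apply Cmod_1_minus. now rewrite Hz.
Qed.

(** * Euclidean geometry *)

Definition dot (x y : R3) : R :=
  crd1 x * crd1 y + crd2 x * crd2 y + crd3 x * crd3 y.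

Lemma R3_eq (x y : R3) :
  crd1 x = crd1 y -> crd2 x = crd2 y -> crd3 x = crd3 y -> x = y.
Proof.
  destruct x as [[? ?] ?], y as [[? ?] ?]. unfold crd1, crd2, crd3. simpl.
  now intros -> -> ->.
Qed.

Ltac R3_ring :=
  apply R3_eq; unfold crd1, crd2, crd3, minus, plus, opp, scal, zero; simpl;
  unfold minus, plus, opp, scal, zero; simpl; unfold mult; simpl; Req; ring.

Lemma enorm_ge0 x : 0 <= enorm x.
Proof. apply sqrt_pos. Qed.

Lemma dot_ge0 x : 0 <= dot x x.
Proof. unfold dot. nra. Qed.

Lemma enorm_sqrt x : enorm x = sqrt (dot x x).
Proof. unfold enorm, dot. f_equal. ring. Qed.

Lemma enorm_sq x : enorm x * enorm x = dot x x.
Proof. rewrite enorm_sqrt. apply sqrt_sqrt, dot_ge0. Qed.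

Lemma dot_sym x y : dot x y = dot y x.
Proof. unfold dot. ring. Qed.

Lemma dot_plus_l x y z : dot (plus x y) z = dot x z + dot y z.
Proof.
  destruct x as [[? ?] ?], y as [[? ?] ?], z as [[? ?] ?].
  unfold dot, crd1, crd2, crd3, plus; simpl. unfold plus; simpl. ring.
Qed.

Lemma dot_scal_l a y z : dot (scal a y) z = a * dot y z.
Proof.
  destruct y as [[? ?] ?], z as [[? ?] ?].
  unfold dot, crd1, crd2, crd3, scal; simpl. unfold scal; simpl.
  unfold mult; simpl. ring.
Qed.

Lemma minus_scal (x y : R3) : minus x y = plus x (scal (-1) y).
Proof.
  destruct x as [[? ?] ?], y as [[? ?] ?].
  R3_ring.
Qed.

Lemma dot_plus_r x y z : dot x (plus y z) = dot x y + dot x z.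
Proof. rewrite !(dot_sym x). apply dot_plus_l. Qed.

Lemma dot_scal_r a y z : dot y (scal a z) = a * dot y z.
Proof. rewrite !(dot_sym y). apply dot_scal_l. Qed.

Lemma enorm_eq x y : dot x x = dot y y -> enorm x = enorm y.
Proof. intros H. now rewrite !enorm_sqrt, H. Qed.

Lemma enorm_pos x y : 0 <= y -> dot x x = y * y -> enorm x = y.
Proof. intros Hy H. rewrite enorm_sqrt, H. now apply sqrt_square. Qed.

Lemma enorm_scal a x : enorm (scal a x) = Rabs a * enorm x.
Proof.
  apply enorm_pos.
  - apply Rmult_le_pos; [apply Rabs_pos|apply enorm_ge0].
  - rewrite dot_scal_l, dot_scal_r, <- enorm_sq.
    assert (Rabs a * Rabs a = a * a) by (rewrite <- Rabs_mult; apply Rabs_right; nra).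
    nra.
Qed.

Lemma enorm_minus_sym (x y : R3) : enorm (minus x y) = enorm (minus y x).
Proof.
  apply enorm_eq. rewrite !minus_scal.
  rewrite !dot_plus_l, !dot_plus_r, !dot_scal_l, !dot_scal_r, (dot_sym y x). ring.
Qed.

Lemma cauchy_schwarz x y : dot x y <= enorm x * enorm y.
Proof.
  pose proof (enorm_ge0 x) as Hx. pose proof (enorm_ge0 y) as Hy.
  assert (H : dot x y * dot x y <= (enorm x * enorm y) * (enorm x * enorm y)).
  { replace (enorm x * enorm y * (enorm x * enorm y))
      with ((enorm x * enorm x) * (enorm y * enorm y)) by ring.
    rewrite !enorm_sq. unfold dot.
    generalize (crd1 x) (crd2 x) (crd3 x) (crd1 y) (crd2 y) (crd3 y).
    intros a b c d e f.
    pose proof (pow2_ge_0 (a * e - b * d)). pose proof (pow2_ge_0 (a * f - c * d)).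
    pose proof (pow2_ge_0 (b * f - c * e)). nra. }
  apply Rsqr_incr_0_var; [exact H|nra].
Qed.

Lemma enorm_triangle x y : enorm (plus x y) <= enorm x + enorm y.
Proof.
  pose proof (enorm_ge0 x) as Hx. pose proof (enorm_ge0 y) as Hy.
  apply Rsqr_incr_0_var; [|lra]. unfold Rsqr.
  rewrite enorm_sq, dot_plus_l, !dot_plus_r, (dot_sym y x).
  pose proof (cauchy_schwarz x y). rewrite <- !enorm_sq. nra.
Qed.

Lemma enorm_0 x : enorm x = 0 -> x = zero.
Proof.
  intros H. pose proof (enorm_sq x) as K. rewrite H in K. unfold dot in K.
  apply R3_eq; unfold zero; simpl; unfold crd1, crd2, crd3 in *; simpl; unfold zero; simpl; nra.
Qed.

(** * Frames and null waves *)

(** An orthonormal basis [(d, e1, e2)], with [d] the axis of the circle of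
    isotropic vectors below.  Completeness is recorded as [parseval], a polynomial
    identity for explicit frames. *)
Record frame := Frame {
  fd : R3; fe1 : R3; fe2 : R3;
  fd_unit : dot fd fd = 1;
  fe1_unit : dot fe1 fe1 = 1;
  fe2_unit : dot fe2 fe2 = 1;
  fd_fe1 : dot fd fe1 = 0;
  fd_fe2 : dot fd fe2 = 0;
  fe1_fe2 : dot fe1 fe2 = 0;
  parseval : forall y, dot y y = dot y fd ^ 2 + dot y fe1 ^ 2 + dot y fe2 ^ 2 }.

(** Away from the poles, [e1] and [e2] are tangent to the parallel and to the
    meridian through [d]. *)
Lemma unit_frame d : dot d d = 1 -> exists F, fd F = d.
Proof.
  destruct d as [[a b] c]. intros H. unfold dot, crd1, crd2, crd3 in H; simpl in H.
  destruct (Req_dec (a ^ 2 + b ^ 2) 0) as [E|E].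
  - assert (a = 0) by nra. assert (b = 0) by nra. subst.
    assert (Hc : c * c = 1) by nra.
    unshelve eexists (Frame (0, 0, c) (1, 0, 0) (0, 1, 0) _ _ _ _ _ _ _);
      try reflexivity; try (intros [[? ?] ?]); unfold dot, crd1, crd2, crd3; simpl; nra.
  - set (h := sqrt (a ^ 2 + b ^ 2)).
    assert (Hh : h * h = a ^ 2 + b ^ 2) by (apply sqrt_sqrt; nra).
    assert (Hh0 : h <> 0) by nra.
    assert (Hg : exists g, g * h = 1) by (exists (/ h); field; auto).
    destruct Hg as [g Hg].
    assert (Hgg : (a ^ 2 + b ^ 2) * (g * g) = 1) by (rewrite <- Hh; nra).
    assert (Hgg' : (g * g) * (1 - c * c) = 1) by nra.
    unshelve eexists (Frame (a, b, c) (- b * g, a * g, 0)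
       (- a * c * g, - b * c * g, h) _ _ _ _ _ _ _);
      try reflexivity; try (intros [[x y] z]); cbv [dot crd1 crd2 crd3 fst snd].
    + nra.
    + nra.
    + replace (- a * c * g * (- a * c * g) + - b * c * g * (- b * c * g) + h * h)
        with (c * c * ((a ^ 2 + b ^ 2) * (g * g)) + h * h) by ring.
      rewrite Hgg, Hh. nra.
    + ring.
    + replace (a * (- a * c * g) + b * (- b * c * g) + c * h)
        with (c * (h - (a ^ 2 + b ^ 2) * g)) by ring.
      rewrite <- Hh. replace (h * h * g) with (h * (g * h)) by ring. rewrite Hg. ring.
    + ring.
    + assert (Hab : a * a + b * b = h * h) by nra.
      assert (Hcc : c * c = 1 - h * h) by nra.
      assert (K : h * h * ((a * x + b * y) * (a * x + b * y) * (g * g) +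
                   (a * y - b * x) * (a * y - b * x) * (g * g))
                  = h * h * (x * x + y * y)).
      { replace (h * h * ((a * x + b * y) * (a * x + b * y) * (g * g) +
                   (a * y - b * x) * (a * y - b * x) * (g * g)))
          with ((g * h) * (g * h) * ((a * a + b * b) * (x * x + y * y))) by ring.
        rewrite Hg, Hab. ring. }
      apply Rmult_eq_reg_l in K; [|nra].
      set (p := a * x + b * y) in *. set (q := a * y - b * x) in *.
      replace ((x * a + y * b + z * c) ^ 2) with ((p + z * c) ^ 2)
        by (unfold p; ring).
      replace ((x * (- b * g) + y * (a * g) + z * 0) ^ 2) with (q * q * (g * g))
        by (unfold q; ring).
      replace ((x * (- a * c * g) + y * (- b * c * g) + z * h) ^ 2)
        with ((z * h - c * g * p) ^ 2) by (unfold p; ring).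
      replace ((p + z * c) ^ 2 + q * q * (g * g) + (z * h - c * g * p) ^ 2)
        with (p * p + 2 * p * z * c * (1 - g * h) + z * z * (c * c + h * h)
              + (p * p * (g * g) + q * q * (g * g))
              + (c * c - 1) * (p * p * (g * g))) by ring.
      rewrite K, Hg, Hcc.
      replace ((1 - h * h - 1) * (p * p * (g * g))) with (- (p * p * ((g * h) * (g * h))))
        by ring.
      rewrite Hg. ring.
Qed.

Lemma frame_exists x : exists F, x = scal (enorm x) (fd F).
Proof.
  destruct (Req_dec (enorm x) 0) as [E|E].
  - destruct (unit_frame (1, 0, 0)) as [F HF].
    { unfold dot, crd1, crd2, crd3; simpl. ring. }
    exists F. rewrite E. apply enorm_0 in E. subst x. rewrite HF.
    R3_ring.
  - destruct (unit_frame (scal (/ enorm x) x)) as [F HF].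
    { rewrite dot_scal_l, dot_scal_r, <- enorm_sq. field. auto. }
    exists F. rewrite HF. rewrite scal_assoc.
    unfold mult; simpl. rewrite Rinv_r by auto. symmetry. apply (scal_one x).
Qed.

(** [y . zeta], where [zeta = d + i (cos t e1 + sin t e2)] is isotropic. *)
Definition wave (F : frame) (t : R) (y : R3) : C :=
  (dot y (fd F), cos t * dot y (fe1 F) + sin t * dot y (fe2 F)).

Lemma ccont_wave F y : ccont (T := R_UniformSpace) (fun t => wave F t y).
Proof.
  apply ccont_pair; [apply cont_const|].
  apply cont_plus; apply cont_mult; try apply cont_const;
    [apply cont_cos|apply cont_sin]; apply cont_id.
Qed.

Lemma wave_plus F t x y : wave F t (plus x y) = (wave F t x + wave F t y)%C.
Proof. unfold wave, Cplus; simpl. rewrite !dot_plus_l. f_equal. ring. Qed.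

Lemma wave_scal F t a x : wave F t (scal a x) = (RtoC a * wave F t x)%C.
Proof. unfold wave, Cmult; simpl. rewrite !dot_scal_l. f_equal; ring. Qed.

(** The real part of [y . zeta] and its imaginary part are the components of [y]
    along two orthonormal vectors. *)
Lemma wave_bound F t y : Cmod (wave F t y) <= enorm y.
Proof.
  rewrite enorm_sqrt. unfold Cmod. apply sqrt_le_1_alt. rewrite (parseval F).
  unfold wave; simpl fst; simpl snd.
  generalize (dot y (fe1 F)) (dot y (fe2 F)). intros u v.
  pose proof (sin2_cos2 t) as H. unfold Rsqr in H.
  assert ((cos t * u + sin t * v) ^ 2 <= u ^ 2 + v ^ 2).
  { replace (u ^ 2 + v ^ 2) with ((u ^ 2 + v ^ 2) * (sin t * sin t + cos t * cos t))
      by (rewrite H; ring).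
    pose proof (pow2_ge_0 (cos t * v - sin t * u)). nra. }
  lra.
Qed.

(** Whittaker's integral.  As a function of [exp (i t)] the denominator is, up to
    a constant, [(1 - mu exp (i t)) (1 - nu exp (- i t))] with [mu] and [nu] in the
    unit disc; by partial fractions [circ_geometric] gives the mean of its
    inverse. *)
Lemma whittaker F D w : enorm w < D ->
  circ (fun t => (/ (D + wave F t w))%C)
  = RtoC (/ enorm (plus (scal D (fd F)) w)).
Proof.
  intros Hw. pose proof (enorm_ge0 w) as Hw0.
  set (u := D + dot w (fd F)). set (v1 := dot w (fe1 F)). set (v2 := dot w (fe2 F)).
  assert (Hu : 0 < u).
  { pose proof (cauchy_schwarz (scal (-1) w) (fd F)) as K.
    rewrite dot_scal_l, enorm_scal in K.
    rewrite (enorm_pos (fd F) 1) in K by (rewrite ?fd_unit; lra).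
    rewrite Rabs_left in K by lra. unfold u. lra. }
  set (N := enorm (plus (scal D (fd F)) w)).
  assert (HN : N * N = u * u + v1 * v1 + v2 * v2).
  { unfold N. rewrite enorm_sq, dot_plus_l, !dot_plus_r, !dot_scal_l, !dot_scal_r.
    rewrite fd_unit, (dot_sym (fd F)), (parseval F w). fold v1 v2. unfold u. ring. }
  assert (HN0 : 0 <= N) by apply enorm_ge0.
  assert (HNu : u <= N) by nra.
  assert (HNu0 : N + u <> 0) by lra.
  (* [mu] and [nu] have modulus [sqrt q]; the product
     [(1 - mu exp (i t)) (1 - nu exp (- i t))] must have constant term
     proportional to [u] and oscillating part to [v1 cos t + v2 sin t]. *)
  set (l1 := v1 / (N + u)). set (l2 := v2 / (N + u)).
  set (q := l1 * l1 + l2 * l2).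
  assert (Hq : q * (N + u) = N - u).
  { unfold q, l1, l2. apply Rmult_eq_reg_r with (N + u); auto.
    replace ((N - u) * (N + u)) with (v1 * v1 + v2 * v2) by nra. field. auto. }
  assert (Hq1 : 0 <= q < 1) by (split; [unfold q|]; nra).
  set (mu := (- l2, - l1) : C). set (nu := (l2, - l1) : C).
  assert (Hmu : Cmod mu < 1).
  { unfold mu, Cmod; simpl fst; simpl snd. rewrite <- sqrt_1. apply sqrt_lt_1_alt.
    unfold q in Hq1. nra. }
  assert (Hnu : Cmod nu < 1).
  { unfold nu, Cmod; simpl fst; simpl snd. rewrite <- sqrt_1. apply sqrt_lt_1_alt.
    unfold q in Hq1. nra. }
  set (z1 := fun t => (mu * expi (IZR 1 * t))%C).
  set (z2 := fun t => (nu * expi (IZR (-1) * t))%C).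
  assert (Hz1 : forall t, (1 - z1 t)%C <> 0%C).
  { intros t. apply C1_minus_neq0. unfold z1. now rewrite Cmod_mult, Cmod_expi, Rmult_1_r. }
  assert (Hz2 : forall t, (1 - z2 t)%C <> 0%C).
  { intros t. apply C1_minus_neq0. unfold z2. now rewrite Cmod_mult, Cmod_expi, Rmult_1_r. }
  assert (Hfac : forall t, (D + wave F t w)%C
            = (RtoC ((N + u) / 2) * ((1 - z1 t) * (1 - z2 t)))%C).
  { intros t.
    assert (Hprod : ((1 - z1 t) * (1 - z2 t))%C
       = (1 - q, 2 * (l1 * cos t + l2 * sin t)) :> C).
    { unfold z1, z2. 
      replace ((1 - mu * expi (1 * t)) * (1 - nu * expi (-1 * t)))%C
        with (1 + mu * nu * (expi t * expi (- t)) - (mu * expi t + nu * expi (- t)))%C.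
      - rewrite expi_conj_mult. unfold mu, nu, expi, Cminus, Cplus, Cmult, Copp, RtoC.
        simpl. rewrite cos_neg, sin_neg. unfold q. f_equal; ring.
      - rewrite Rmult_1_l. replace (-1 * t) with (- t) by ring. ring. }
    rewrite Hprod. unfold wave, Cplus, Cmult, RtoC; simpl. fold v1 v2. f_equal.
    - fold u. nra.
    - unfold l1, l2. field. auto. }
  assert (Hinv : forall t, (/ (D + wave F t w))%C
     = (RtoC (/ N) * (/ (1 - z1 t) + (/ (1 - z2 t) - 1)))%C).
  { intros t. rewrite Hfac.
    assert (Hz12 : (z1 t * z2 t)%C = RtoC (- q)).
    { unfold z1, z2.
      replace (mu * expi (1 * t) * (nu * expi (-1 * t)))%C
        with (mu * nu * (expi t * expi (- t)))%C.
      - rewrite expi_conj_mult. unfold mu, nu, Cmult, RtoC; simpl.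
        unfold q. f_equal; ring.
      - rewrite Rmult_1_l. replace (-1 * t) with (- t) by ring. ring. }
    assert (E : (/ (1 - z1 t) + (/ (1 - z2 t) - 1))%C
       = ((1 - z1 t * z2 t) / ((1 - z1 t) * (1 - z2 t)))%C).
    { field. auto. }
    rewrite E, Hz12.
    replace (1 - RtoC (- q))%C with (RtoC (1 + q))
      by (unfold RtoC, Cminus, Cplus, Copp; simpl; f_equal; ring).
    replace (1 + q) with (2 * N / (N + u)).
    2:{ apply Rmult_eq_reg_r with (N + u); auto. field_simplify; [|auto]. nra. }
    assert (N <> 0) by lra.
    assert (HNC : RtoC N <> 0%C) by (intros K; injection K; auto).
    assert (HNuC : (RtoC N + RtoC u)%C <> 0%C)
      by (rewrite <- RtoC_plus; intros K; injection K; auto).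
    rewrite !RtoC_div, RtoC_inv, RtoC_mult, !RtoC_plus by (auto; lra).
    field. repeat split; auto. }
  etransitivity; [exact (cint_ext circle _ _ Hinv)|].
  assert (C1 : ccont (T := R_UniformSpace) (fun t => / (1 - z1 t))%C).
  { apply ccont_inv; auto. apply ccont_minus; [apply ccont_const|].
    apply ccont_mult; [apply ccont_const|]. apply ccont_expi.
    apply cont_mult; [apply cont_const|apply cont_id]. }
  assert (C2 : ccont (T := R_UniformSpace) (fun t => / (1 - z2 t))%C).
  { apply ccont_inv; auto. apply ccont_minus; [apply ccont_const|].
    apply ccont_mult; [apply ccont_const|]. apply ccont_expi.
    apply cont_mult; [apply cont_const|apply cont_id]. }
  assert (C3 : ccont (T := R_UniformSpace) (fun t => / (1 - z2 t) - 1)%C)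
    by (apply ccont_minus; [auto|apply ccont_const]).
  rewrite (cint_scal circle), (cint_plus circle), (cint_minus circle); auto;
    try (apply ccont_const); try (now apply ccont_plus).
  unfold z1, z2. rewrite !circ_geometric, (circ_const 1) by (auto; lia). ring.
Qed.

(** * Derivatives of [(x ^ 2 - 1) ^ n] *)

(** The coefficient of [h ^ (n + k)] in [((x + h) ^ 2 - 1) ^ n], that is, the
    derivative of order [n + k] of [(x ^ 2 - 1) ^ n] divided by [(n + k)!].
    Multiplication by [(x ^ 2 - 1) + 2 x h + h ^ 2] gives the recurrence; indices
    in [Z] make negative orders available, and the coefficients vanish by
    themselves for [|k| > n]. *)
Fixpoint rodrigues (n : nat) (k : Z) (x : R) : R :=
  match n with
  | O => if Z.eq_dec k 0 then 1 else 0
  | S n => 2 * x * rodrigues n k x + rodrigues n (k - 1) x + (x ^ 2 - 1) * rodrigues n (k + 1) x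
  end.

Lemma rodrigues_zero n : forall k x, (Z.of_nat n < Z.abs k)%Z -> rodrigues n k x = 0.
Proof.
  induction n as [|n IH]; intros k x H; simpl rodrigues.
  - destruct (Z.eq_dec k 0); [lia|auto].
  - rewrite !IH by lia. ring.
Qed.

Lemma rodrigues_derive n : forall k x,
  is_derive (rodrigues n k) x (IZR (Z.of_nat n + k + 1) * rodrigues n (k + 1) x).
Proof.
  induction n as [|n IH]; intros k x.
  - simpl rodrigues. 
    replace (IZR (Z.of_nat 0 + k + 1) * (if Z.eq_dec (k + 1) 0 then 1 else 0)) with 0.
    + exact (is_derive_const (K := R_AbsRing) (V := R_NormedModule) _ x).
    + destruct (Z.eq_dec (k + 1) 0) as [E|E]; [|ring].
      replace (Z.of_nat 0 + k + 1)%Z with 0%Z by lia. simpl; ring.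
  - change (is_derive (fun x => 2 * x * rodrigues n k x + rodrigues n (k - 1) x
              + (x ^ 2 - 1) * rodrigues n (k + 1) x) x
      (IZR (Z.of_nat (S n) + k + 1) * (2 * x * rodrigues n (k + 1) x
         + rodrigues n (k + 1 - 1) x + (x ^ 2 - 1) * rodrigues n (k + 1 + 1) x))).
    pose proof (IH k x) as D0. pose proof (IH (k - 1)%Z x) as D1.
    pose proof (IH (k + 1)%Z x) as D2.
    auto_derive.
    + repeat split; try (eexists; eassumption); auto.
    + apply is_derive_unique in D0, D1, D2.
      change (Derive (rodrigues n k) x) with (Derive (fun y => rodrigues n k y) x) in D0.
      change (Derive (rodrigues n (k - 1)) x) with (Derive (fun y => rodrigues n (k - 1) y) x) in D1.
      change (Derive (rodrigues n (k + 1)) x) with (Derive (fun y => rodrigues n (k + 1) y) x) in D2.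
      rewrite D0, D1, D2.
      replace (k + 1 - 1)%Z with k by lia. replace (k - 1 + 1)%Z with k by lia.
      rewrite Nat2Z.inj_succ. unfold Z.succ. rewrite !plus_IZR, !minus_IZR. ring.
Qed.

Lemma Derive_rodrigues n k x :
  Derive (fun y => rodrigues n k y) x = IZR (Z.of_nat n + k + 1) * rodrigues n (k + 1) x.
Proof. apply (is_derive_unique (rodrigues n k)), rodrigues_derive. Qed.

Lemma rodrigues_low n x : rodrigues n (- Z.of_nat n) x = (x ^ 2 - 1) ^ n.
Proof.
  induction n as [|n IH]; [reflexivity|].
  cbn [rodrigues]. rewrite (rodrigues_zero n (- Z.of_nat (S n))) by lia.
  rewrite (rodrigues_zero n (- Z.of_nat (S n) - 1)) by lia.
  replace (- Z.of_nat (S n) + 1)%Z with (- Z.of_nat n)%Z by lia.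
  rewrite IH. simpl. ring.
Qed.

Lemma rodrigues_top n x : rodrigues n (Z.of_nat n) x = 1.
Proof.
  induction n as [|n IH]; [reflexivity|].
  cbn [rodrigues]. rewrite (rodrigues_zero n (Z.of_nat (S n))) by lia.
  rewrite (rodrigues_zero n (Z.of_nat (S n) + 1)) by lia.
  replace (Z.of_nat (S n) - 1)%Z with (Z.of_nat n) by lia.
  rewrite IH. ring.
Qed.

(** The generating polynomial [((x ^ 2 - 1) + 2 x h + h ^ 2) ^ n] is, up to a
    monomial factor, invariant under [h |-> (x ^ 2 - 1) / h]. *)
Lemma rodrigues_sym n : forall (k : nat) x,
  rodrigues n (- Z.of_nat k) x = (x ^ 2 - 1) ^ k * rodrigues n (Z.of_nat k) x.
Proof.
  induction n as [|n IH]; intros k x.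
  - destruct k as [|k]; simpl; ring.
  - destruct k as [|k]; [simpl; ring|].
    cbn [rodrigues].
    replace (- Z.of_nat (S k) - 1)%Z with (- Z.of_nat (S (S k)))%Z by lia.
    replace (- Z.of_nat (S k) + 1)%Z with (- Z.of_nat k)%Z by lia.
    replace (Z.of_nat (S k) - 1)%Z with (Z.of_nat k) by lia.
    replace (Z.of_nat (S k) + 1)%Z with (Z.of_nat (S (S k))) by lia.
    rewrite !IH. cbn [pow]. ring.
Qed.

Lemma cont_rodrigues n k : cont (T := R_UniformSpace) (rodrigues n k).
Proof.
  intros x. apply (ex_derive_continuous (rodrigues n k)). eexists. apply rodrigues_derive.
Qed.

Lemma Derive_n_rodrigues n j x :
  Derive_n (fun y => (y ^ 2 - 1) ^ n) j x
  = INR (fact j) * rodrigues n (Z.of_nat j - Z.of_nat n) x.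
Proof.
  revert x. induction j as [|j IH]; intros x.
  - simpl Derive_n. replace (Z.of_nat 0 - Z.of_nat n)%Z with (- Z.of_nat n)%Z by lia.
    rewrite rodrigues_low. simpl. ring.
  - change (Derive (Derive_n (fun y => (y ^ 2 - 1) ^ n) j) x
       = INR (fact (S j)) * rodrigues n (Z.of_nat (S j) - Z.of_nat n) x).
    rewrite (Derive_ext _ _ x IH), Derive_scal.
    rewrite (is_derive_unique _ _ _ (rodrigues_derive n _ x)).
    rewrite fact_simpl, mult_INR, INR_IZR_INZ.
    replace (Z.of_nat n + (Z.of_nat j - Z.of_nat n) + 1)%Z with (Z.of_nat (S j)) by lia.
    replace (Z.of_nat j - Z.of_nat n + 1)%Z with (Z.of_nat (S j) - Z.of_nat n)%Z by lia.
    rewrite (INR_IZR_INZ (S j)). ring.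
Qed.

Lemma legendre_rodrigues n x : legendre n x = / 2 ^ n * rodrigues n 0 x.
Proof.
  unfold legendre. rewrite Derive_n_rodrigues, Z.sub_diag.
  field. split; first [apply INR_fact_neq_0|apply pow_nonzero; lra].
Qed.

Lemma Derive_n_legendre n m x :
  Derive_n (legendre n) m x
  = INR (fact (n + m)) / (INR (fact n) * 2 ^ n) * rodrigues n (Z.of_nat m) x.
Proof.
  revert x. induction m as [|m IH]; intros x.
  - simpl Derive_n. rewrite legendre_rodrigues, Nat.add_0_r. simpl Z.of_nat.
    field. split; first [apply INR_fact_neq_0|apply pow_nonzero; lra].
  - change (Derive (Derive_n (legendre n) m) x =
      INR (fact (n + S m)) / (INR (fact n) * 2 ^ n) * rodrigues n (Z.of_nat (S m)) x).
    rewrite (Derive_ext _ _ x IH), Derive_scal.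
    rewrite (is_derive_unique _ _ _ (rodrigues_derive n _ x)).
    replace (n + S m)%nat with (S (n + m)) by lia.
    rewrite fact_simpl, mult_INR.
    replace (Z.of_nat n + Z.of_nat m + 1)%Z with (Z.of_nat (S (n + m))) by lia.
    replace (Z.of_nat m + 1)%Z with (Z.of_nat (S m)) by lia.
    rewrite (INR_IZR_INZ (S (n + m))). field.
    split; first [apply INR_fact_neq_0|apply pow_nonzero; lra].
Qed.

(** * Orthogonality *)

(** By [rodrigues_sym], up to the sign [(-1) ^ m] this is the integral of the two
    functions of order [m] against the weight [(1 - x ^ 2) ^ m].  The order [- m]
    on one side makes integration by parts shift [m]. *)
Definition pairing (n n' : nat) (m : Z) : R :=
  RInt (fun x => rodrigues n (- m) x * rodrigues n' m x) (-1) 1.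

(** Integration by parts; by [rodrigues_sym] the boundary terms contain a positive
    power of [x ^ 2 - 1]. *)
Lemma pairing_step n n' (m : nat) :
  IZR (Z.of_nat (n' + m + 1)) * pairing n n' (Z.of_nat (S m))
  = - IZR (Z.of_nat n - Z.of_nat m) * pairing n n' (Z.of_nat m).
Proof.
  set (F := fun x => rodrigues n (- Z.of_nat (S m)) x * rodrigues n' (Z.of_nat m) x).
  set (a := IZR (Z.of_nat n - Z.of_nat m)).
  set (b := IZR (Z.of_nat (n' + m + 1))).
  assert (HF : forall x, is_derive F x
    (a * (rodrigues n (- Z.of_nat m) x * rodrigues n' (Z.of_nat m) x)
     + b * (rodrigues n (- Z.of_nat (S m)) x * rodrigues n' (Z.of_nat (S m)) x))).
  { intros x. unfold F.
    remember (- Z.of_nat (S m))%Z as k eqn:Ek.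
    pose proof (rodrigues_derive n k x) as D1.
    pose proof (rodrigues_derive n' (Z.of_nat m) x) as D2.
    auto_derive.
    - repeat split; eexists; eassumption.
    - rewrite !Derive_rodrigues.
      replace (k + 1)%Z with (- Z.of_nat m)%Z by lia.
      replace (Z.of_nat m + 1)%Z with (Z.of_nat (S m)) by lia.
      replace (Z.of_nat n + k + 1)%Z with (Z.of_nat n - Z.of_nat m)%Z by lia.
      replace (Z.of_nat n' + Z.of_nat m + 1)%Z with (Z.of_nat (n' + m + 1)) by lia.
      fold a b. ring. }
  assert (C : forall k k', cont (T := R_UniformSpace) (fun x => rodrigues n k x * rodrigues n' k' x))
    by (intros; apply cont_mult; apply cont_rodrigues).
  assert (HI : is_RInt (fun x => a * (rodrigues n (- Z.of_nat m) x * rodrigues n' (Z.of_nat m) x)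
     + b * (rodrigues n (- Z.of_nat (S m)) x * rodrigues n' (Z.of_nat (S m)) x)) (-1) 1
     (minus (F 1) (F (-1)))).
  { apply (is_RInt_derive F); [intros; apply HF|]. intros x _.
    apply cont_plus; apply cont_mult; try apply cont_const; apply C. }
  apply (is_RInt_unique (V := R_CompleteNormedModule)) in HI.
  rewrite RInt_lin in HI by apply C. unfold pairing.
  assert (F0 : forall x, x ^ 2 - 1 = 0 -> F x = 0).
  { intros x E. unfold F. rewrite rodrigues_sym, E, pow_i by lia. ring. }
  rewrite !F0 in HI by ring. 
  assert (Z0 : minus 0 0 = 0) by (unfold minus, plus, opp; simpl; ring).
  rewrite Z0 in HI. fold a b.
  match type of HI with ?A + ?B = 0 => assert (E : B = - A) by (revert HI; generalize A B; intros; lra) end.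
  rewrite E. ring.
Qed.

(** [pairing_step] raises [m] up to [n], where the right factor is a derivative of
    [(x ^ 2 - 1) ^ n'] of order greater than [2 n']. *)
Lemma pairing_0 n n' (m : nat) : (n' < n)%nat -> (m <= n)%nat ->
  pairing n n' (Z.of_nat m) = 0.
Proof.
  intros Hn Hm.
  assert (H : forall j, (j <= n)%nat -> pairing n n' (Z.of_nat (n - j)) = 0).
  { induction j as [|j IH]; intros Hj.
    - rewrite Nat.sub_0_r. unfold pairing.
      erewrite RInt_ext with (g := fun _ => 0).
      + rewrite RInt_const. apply Rmult_0_r.
      + intros x _. rewrite (rodrigues_zero n') by lia. apply Rmult_0_r.
    - pose proof (pairing_step n n' (n - S j)) as K.
      replace (S (n - S j)) with (n - j)%nat in K by lia.
      rewrite IH, Rmult_0_r in K by lia. symmetry in K.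
      apply Rmult_integral in K. destruct K as [K|K]; auto.
      exfalso. apply Ropp_eq_0_compat in K. rewrite Ropp_involutive in K.
      apply eq_IZR in K. lia. }
  replace m with (n - (n - m))%nat by lia. apply H. lia.
Qed.

(** The recurrence in [n] is the integral of the derivative of
    [x (1 - x ^ 2) ^ (n + 1)]. *)
Lemma RInt_one_minus_sq n :
  RInt (fun x => (1 - x ^ 2) ^ n) (-1) 1
  = 2 * 4 ^ n * INR (fact n) ^ 2 / INR (fact (2 * n + 1)).
Proof.
  assert (C : forall n, cont (T := R_UniformSpace) (fun x => (1 - x ^ 2) ^ n)).
  { intros k x. apply (ex_derive_continuous (fun x => (1 - x ^ 2) ^ k)).
    auto_derive. auto. }
  induction n as [|n IH].
  - rewrite (RInt_ext _ (fun _ => 1)) by (intros; reflexivity).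
    rewrite RInt_const. unfold scal; simpl; unfold mult; simpl. field.
  - set (F := fun x => x * (1 - x ^ 2) ^ (S n)).
    set (c := 2 * INR n + 3). set (d := - (2 * INR n + 2)).
    assert (HI : is_RInt (fun x => c * (1 - x ^ 2) ^ (S n) + d * (1 - x ^ 2) ^ n) (-1) 1
      (minus (F 1) (F (-1)))).
    { apply (is_RInt_derive F).
      - intros x _. unfold F. auto_derive; auto.
        change (match n with O => 1 | S _ => INR n + 1 end) with (INR (S n)).
        rewrite S_INR. unfold c, d.
        replace (1 + - (x * (x * 1))) with (1 - x ^ 2) by ring.
        rewrite <- (tech_pow_Rmult (1 - x ^ 2) n).
        generalize ((1 - x ^ 2) ^ n). intros p. ring.
      - intros x _. apply cont_plus; apply cont_mult; try apply cont_const; apply C. }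
    apply (is_RInt_unique (V := R_CompleteNormedModule)) in HI.
    rewrite RInt_lin in HI by apply C. rewrite IH in HI.
    assert (E : minus (F 1) (F (-1)) = 0).
    { unfold F. replace (1 - 1 ^ 2) with 0 by ring. replace (1 - (-1) ^ 2) with 0 by ring.
      rewrite pow_i by lia. unfold minus, plus, opp; simpl; ring. }
    rewrite E in HI.
    replace (2 * S n + 1)%nat with (S (S (2 * n + 1))) by lia.
    rewrite !fact_simpl, !mult_INR, !S_INR, plus_INR, mult_INR. simpl (INR 2). simpl (INR 1).
    pose proof (INR_fact_neq_0 (2 * n + 1)). pose proof (pos_INR n).
    apply Rmult_eq_reg_l with c; [|unfold c; lra].
    match type of HI with ?A + ?B = 0 => transitivity (- B); [revert HI; generalize A B; intros; lra|] end.
    unfold c, d. simpl pow. field. repeat split; auto; lra.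
Qed.

(** As for [pairing_0], but at [m = n] the factors are [(x ^ 2 - 1) ^ n] and [1]. *)
Lemma pairing_diag n (m : nat) : (m <= n)%nat ->
  pairing n n (Z.of_nat m)
  = (-1) ^ m * (2 * 4 ^ n * INR (fact n) ^ 2
     / ((2 * INR n + 1) * INR (fact (n + m)) * INR (fact (n - m)))).
Proof.
  intros Hm.
  assert (H : forall j, (j <= n)%nat -> pairing n n (Z.of_nat (n - j))
    = (-1) ^ (n - j) * (2 * 4 ^ n * INR (fact n) ^ 2
     / ((2 * INR n + 1) * INR (fact (n + (n - j))) * INR (fact j)))).
  { induction j as [|j IH]; intros Hj.
    - rewrite Nat.sub_0_r. unfold pairing.
      rewrite (RInt_ext _ (fun x => (-1) ^ n * (1 - x ^ 2) ^ n + 0 * 0)).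
      2:{ intros x _. rewrite rodrigues_low, rodrigues_top, <- Rpow_mult_distr.
          replace (-1 * (1 - x ^ 2)) with (x ^ 2 - 1) by ring. Req. ring. }
      rewrite RInt_lin.
      2:{ intros x. apply (ex_derive_continuous (fun x => (1 - x ^ 2) ^ n)).
          auto_derive. auto. }
      2:{ apply cont_const. }
      rewrite RInt_one_minus_sq. replace (2 * n + 1)%nat with (S (n + n)) by lia.
      rewrite fact_simpl, mult_INR, S_INR, plus_INR. simpl (fact 0). simpl (INR 1).
      pose proof (INR_fact_neq_0 (n + n)). pose proof (pos_INR n).
      field. split; auto; lra.
    - pose proof (pairing_step n n (n - S j)) as K.
      replace (S (n - S j)) with (n - j)%nat in K by lia.
      rewrite IH in K by lia.
      replace (Z.of_nat n - Z.of_nat (n - S j))%Z with (Z.of_nat (S j)) in K by lia.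
      rewrite <- !INR_IZR_INZ in K.
      pose proof (pos_INR j). pose proof (INR_fact_neq_0 j).
      pose proof (INR_fact_neq_0 (n + (n - S j))). pose proof (pos_INR n).
      pose proof (pos_INR (n + (n - S j))).
      apply Rmult_eq_reg_l with (- INR (S j)); [|rewrite S_INR; lra].
      rewrite <- K.
      replace (n + (n - j))%nat with (S (n + (n - S j))) by lia.
      replace (n + (n - S j) + 1)%nat with (S (n + (n - S j))) by lia.
      replace (n - j)%nat with (S (n - S j)) by lia.
      rewrite !fact_simpl, !mult_INR, !S_INR. cbn [pow].
      field. repeat split; auto; lra. }
  replace m with (n - (n - m))%nat by lia. rewrite H by lia.
  replace (n - (n - (n - m)))%nat with (n - m)%nat by lia. reflexivity.
Qed.

(** * Polar profiles *)

(** The factor of the solid harmonic [solid n k] that depends on the height [x]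
    and the distance [s] to the axis; the other factor is [exp (i k phi)]. *)
Fixpoint profile (n : nat) (k : Z) (x s : R) : R :=
  match n with
  | O => if Z.eq_dec k 0 then 1 else 0
  | S n => 2 * x * profile n k x s + s * profile n (k - 1) x s - s * profile n (k + 1) x s
  end.

Lemma profile_neg n x s : forall k : nat,
  profile n (- Z.of_nat k) x s = (-1) ^ k * profile n (Z.of_nat k) x s.
Proof.
  induction n as [|n IH]; intros k.
  - destruct k as [|k]; simpl; ring.
  - destruct k as [|k]; [simpl; ring|].
    cbn [profile].
    replace (- Z.of_nat (S k) - 1)%Z with (- Z.of_nat (S (S k)))%Z by lia.
    replace (- Z.of_nat (S k) + 1)%Z with (- Z.of_nat k)%Z by lia.
    replace (Z.of_nat (S k) - 1)%Z with (Z.of_nat k) by lia.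
    replace (Z.of_nat (S k) + 1)%Z with (Z.of_nat (S (S k))) by lia.
    rewrite !IH. cbn [pow]. ring.
Qed.

Lemma profile_rodrigues n x s : s * s = 1 - x ^ 2 -> forall k : nat,
  profile n (Z.of_nat k) x s = s ^ k * rodrigues n (Z.of_nat k) x.
Proof.
  intros Hs. induction n as [|n IH]; intros k.
  - destruct k as [|k]; simpl; ring.
  - destruct k as [|k].
    + pose proof (profile_neg n x s 1) as E1. pose proof (rodrigues_sym n 1 x) as E2.
      pose proof (IH 1%nat) as E3. pose proof (IH 0%nat) as E4.
      simpl in E1, E2, E3, E4. simpl. rewrite E1, E2, E3, E4.
      replace (x * (x * 1) - 1) with (- (s * s)) by (rewrite Hs; ring). ring.
    + cbn [profile rodrigues].
      replace (Z.of_nat (S k) - 1)%Z with (Z.of_nat k) by lia.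
      replace (Z.of_nat (S k) + 1)%Z with (Z.of_nat (S (S k))) by lia.
      rewrite !IH. cbn [pow].
      replace (x * (x * 1) - 1) with (- (s * s)) by (rewrite Hs; ring). ring.
Qed.

Lemma RInt_cos_subst (h : R -> R) : cont h ->
  RInt (fun t => h (cos t) * sin t) 0 PI = RInt h (-1) 1.
Proof.
  intros Hh.
  assert (H : RInt (fun t => scal (- sin t) (h (cos t))) 0 PI = RInt h (cos 0) (cos PI)).
  { apply (RInt_comp (V := R_CompleteNormedModule) h cos (fun t => - sin t)).
    - intros; apply Hh.
    - intros t _. split; [apply is_derive_cos|].
      apply (cont_opp (fun t => sin t)). apply cont_sin, cont_id. }
  rewrite cos_0, cos_PI in H. rewrite <- (opp_RInt_swap h) in H by now apply cont_ex_RInt.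
  replace (RInt h (-1) 1) with (- opp (RInt h (-1) 1)) by (unfold opp; simpl; ring).
  rewrite <- H.
  transitivity (RInt (fun t => (-1) * (scal (- sin t) (h (cos t))) + 0 * 0) 0 PI).
  - apply RInt_ext. intros t _. unfold scal; simpl; unfold mult; simpl. ring.
  - rewrite RInt_lin; [Req; ring| |apply cont_const].
    apply cont_mult.
    + apply (cont_opp (fun t => sin t)). apply cont_sin, cont_id.
    + intros t. apply (continuous_comp cos h); [apply continuous_cos|apply Hh].
Qed.

Definition polar_inner (n n' : nat) (k : Z) : R :=
  RInt (fun t => profile n k (cos t) (sin t) * profile n' k (cos t) (sin t) * sin t) 0 PI.

Lemma polar_inner_pairing n n' k :
  polar_inner n n' k = (-1) ^ Z.abs_nat k * pairing n n' (Z.of_nat (Z.abs_nat k)).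
Proof.
  set (m := Z.abs_nat k).
  assert (E : forall t, profile n k (cos t) (sin t) * profile n' k (cos t) (sin t)
    = (fun x => (1 - x ^ 2) ^ m * (rodrigues n (Z.of_nat m) x * rodrigues n' (Z.of_nat m) x)) (cos t)).
  { intros t. cbv beta.
    assert (Hs : sin t * sin t = 1 - cos t ^ 2).
    { pose proof (sin2_cos2 t) as H. unfold Rsqr in H. nra. }
    rewrite <- Hs, Rpow_mult_distr.
    destruct (Z_le_dec 0 k) as [Hk|Hk].
    - replace k with (Z.of_nat m) at 1 2 by (unfold m; lia).
      rewrite !profile_rodrigues by auto. ring.
    - replace k with (- Z.of_nat m)%Z at 1 2 by (unfold m; lia).
      rewrite !profile_neg, !profile_rodrigues by auto.
      transitivity ((-1) ^ m * (-1) ^ m * (sin t ^ m * sin t ^ m *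
       (rodrigues n (Z.of_nat m) (cos t) * rodrigues n' (Z.of_nat m) (cos t)))); [ring|].
      rewrite sign_sq. ring. }
  unfold polar_inner.
  transitivity (RInt (fun x => (1 - x ^ 2) ^ m * (rodrigues n (Z.of_nat m) x * rodrigues n' (Z.of_nat m) x)) (-1) 1).
  - rewrite <- RInt_cos_subst.
    + apply RInt_ext. intros t _. now rewrite E.
    + apply cont_mult; [|apply cont_mult; apply cont_rodrigues].
      intros x. apply (ex_derive_continuous (fun x => (1 - x ^ 2) ^ m)). auto_derive. auto.
  - unfold pairing.
    transitivity (RInt (fun x => (-1) ^ m * (rodrigues n (- Z.of_nat m) x * rodrigues n' (Z.of_nat m) x) + 0 * 0) (-1) 1).
    + apply RInt_ext. intros x _. rewrite rodrigues_sym.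
      replace (1 - x ^ 2) with (-1 * (x ^ 2 - 1)) by ring.
      rewrite Rpow_mult_distr. Req. ring.
    + rewrite RInt_lin; [Req; ring|apply cont_mult; apply cont_rodrigues|apply cont_const].
Qed.

Lemma polar_inner_sym n n' k : polar_inner n n' k = polar_inner n' n k.
Proof. unfold polar_inner. apply RInt_ext. intros; Req; ring. Qed.

Lemma polar_inner_0 n n' k : n <> n' ->
  (Z.abs k <= Z.of_nat n)%Z -> (Z.abs k <= Z.of_nat n')%Z -> polar_inner n n' k = 0.
Proof.
  intros Hn Hk Hk'. destruct (Nat.lt_total n n') as [H|[H|H]]; [|lia|].
  - rewrite polar_inner_sym, polar_inner_pairing, pairing_0 by lia. ring.
  - rewrite polar_inner_pairing, pairing_0 by lia. ring.
Qed.

Lemma polar_inner_diag n k : (Z.abs k <= Z.of_nat n)%Z ->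
  polar_inner n n k = 2 * 4 ^ n * INR (fact n) ^ 2
     / ((2 * INR n + 1) * INR (fact (Z.to_nat (Z.of_nat n + k)))
        * INR (fact (Z.to_nat (Z.of_nat n - k)))).
Proof.
  intros Hk. rewrite polar_inner_pairing, pairing_diag, <- Rmult_assoc by lia.
  rewrite sign_sq, Rmult_1_l. f_equal. rewrite !Rmult_assoc. f_equal.
  destruct (Z_le_dec 0 k) as [H|H].
  - f_equal; do 2 f_equal; lia.
  - rewrite Rmult_comm. f_equal; do 2 f_equal; lia.
Qed.

(** * Solid harmonics as polynomials *)

Definition equatorial (y : R3) : C := (crd1 y, crd2 y).

(** The coefficient of [w ^ k] in
    [(2 y3 + (y1 + i y2) w - (y1 - i y2) / w) ^ n].  The recurrence shows at once
    that these are polynomials, which the definition of [Y] through polar angles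
    hides. *)
Fixpoint solid (n : nat) (k : Z) (y : R3) : C :=
  match n with
  | O => if Z.eq_dec k 0 then 1%C else 0%C
  | S n => (2 * crd3 y * solid n k y + equatorial y * solid n (k - 1) y
            - Cconj (equatorial y) * solid n (k + 1) y)%C
  end.

Lemma solid_zero n y : forall k, (Z.of_nat n < Z.abs k)%Z -> solid n k y = 0%C.
Proof.
  induction n as [|n IH]; intros k H; cbn [solid].
  - destruct (Z.eq_dec k 0); [lia|auto].
  - rewrite !IH by lia. ring.
Qed.

Lemma solid_scal n a y : forall k,
  solid n k (scal a y) = (RtoC (a ^ n) * solid n k y)%C.
Proof.
  induction n as [|n IH]; intros k; cbn [solid].
  - simpl. ring.
  - rewrite !IH.
    replace (crd3 (scal a y)) with (a * crd3 y) by reflexivity.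
    replace (equatorial (scal a y)) with (RtoC a * equatorial y)%C.
    2:{ unfold equatorial, crd1, crd2, Cmult; simpl. unfold scal; simpl. 
        unfold scal; simpl; unfold mult; simpl. f_equal; ring. }
    rewrite Cmult_conj. 
    rewrite Cconj_RtoC.
    cbn [pow]. rewrite !RtoC_mult. ring.
Qed.

Lemma solid_cylindrical n y h az : equatorial y = (RtoC h * expi az)%C ->
  forall k, solid n k y = (expi (IZR k * az) * RtoC (profile n k (crd3 y) h))%C.
Proof.
  intros Hy. induction n as [|n IH]; intros k; cbn [solid profile].
  - destruct (Z.eq_dec k 0) as [->|]; [|ring].
    rewrite Rmult_0_l, expi_0. ring.
  - rewrite !IH, Hy, minus_IZR, plus_IZR.
    rewrite Cmult_conj, <- expi_opp. 
    rewrite Cconj_RtoC.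
    replace (expi (IZR k * az)) with (expi ((IZR k - 1) * az) * expi az)%C
      by (rewrite <- expi_plus; f_equal; ring).
    replace (expi ((IZR k + 1) * az)) with (expi ((IZR k - 1) * az) * expi az * expi az)%C
      by (rewrite <- !expi_plus; f_equal; ring).
    rewrite RtoC_minus, RtoC_plus, !RtoC_mult.
    replace (RtoC h * expi (- az) *
       (expi ((IZR k - 1) * az) * expi az * expi az * profile n (k + 1) (crd3 y) h))%C
      with (RtoC h * (expi az * expi (- az)) *
       (expi ((IZR k - 1) * az) * expi az * profile n (k + 1) (crd3 y) h))%C by ring.
    rewrite expi_conj_mult. ring.
Qed.

(** Holds on the axis as well, where both sides vanish whatever the azimuth. *)
Lemma equatorial_azimuth y :
  equatorial y = (RtoC (sqrt (crd1 y ^ 2 + crd2 y ^ 2)) * expi (azimuth y))%C.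
Proof.
  unfold equatorial, azimuth.
  set (u := crd1 y). set (v := crd2 y). set (h := sqrt (u ^ 2 + v ^ 2)).
  assert (Hh : h * h = u ^ 2 + v ^ 2) by (apply sqrt_sqrt; nra).
  assert (Hh0 : 0 <= h) by apply sqrt_pos.
  destruct (Req_dec h 0) as [E|E].
  - rewrite E. assert (u = 0) by nra. assert (v = 0) by nra.
    replace u with 0 by auto. replace v with 0 by auto.
    rewrite Cmult_0_l. reflexivity.
  - assert (Hb : -1 <= u / h <= 1).
    { split; apply Rmult_le_reg_r with h; try lra; unfold Rdiv;
        rewrite Rmult_assoc, Rinv_l by auto; nra. }
    assert (Hs : h * sqrt (1 - (u / h)²) = Rabs v).
    {
      replace (1 - (u / h)²) with ((v / h)²).
      - rewrite sqrt_Rsqr_abs. unfold Rdiv. rewrite Rabs_mult, (Rabs_right (/ h)).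
        + field. auto.
        + left. apply Rinv_0_lt_compat. lra.
      - unfold Rsqr. apply Rmult_eq_reg_r with (h * h); [|nra].
        field_simplify; [|auto|auto]. nra. }
    assert (Hc : h * (u / h) = u) by (field; auto).
    unfold expi, Cmult, RtoC; simpl.
    destruct (Rle_dec 0 v) as [Hv|Hv].
    + rewrite cos_acos, sin_acos, Hc, Hs, Rabs_right by (auto; lra).
      f_equal; ring_simplify; auto.
    + rewrite cos_neg, sin_neg, cos_acos, sin_acos by auto.
      f_equal; ring_simplify; [now rewrite Hc|].
      replace (- h * sqrt (1 - (u / h)²)) with (- (h * sqrt (1 - (u / h)²))) by ring.
      rewrite Hs, Rabs_left by lra. ring.
Qed.

(** For negative orders the sign and factorials in the convention for
    [assoc_legendre] are those of [profile_neg], so that one formula covers all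
    orders. *)
Lemma assoc_legendre_profile n m x h : (Z.abs m <= Z.of_nat n)%Z ->
  0 <= h -> h * h = 1 - x ^ 2 ->
  assoc_legendre n m x
  = (-1) ^ Z.abs_nat m * (INR (fact (Z.to_nat (Z.of_nat n + m)))
      / (INR (fact n) * 2 ^ n)) * profile n m x h.
Proof.
  intros Hm Hh Hhx.
  assert (Hsq : sqrt (1 - x ^ 2) = h) by (rewrite <- Hhx; now apply sqrt_square).
  pose proof (INR_fact_neq_0 n). assert (2 ^ n <> 0) by (apply pow_nonzero; lra).
  unfold assoc_legendre, assoc_legendre_nat. rewrite Hsq, Derive_n_legendre.
  destruct (Z_le_dec 0 m) as [Hp|Hp].
  - replace (profile n m x h) with (profile n (Z.of_nat (Z.abs_nat m)) x h) by (f_equal; lia).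
    rewrite profile_rodrigues by auto.
    replace (Z.to_nat (Z.of_nat n + m)) with (n + Z.abs_nat m)%nat by lia. ring.
  - replace (profile n m x h) with (profile n (- Z.of_nat (Z.abs_nat m)) x h) by (f_equal; lia).
    rewrite profile_neg, profile_rodrigues by auto.
    replace (Z.to_nat (Z.of_nat n + m)) with (n - Z.abs_nat m)%nat by lia.
    pose proof (INR_fact_neq_0 (n + Z.abs_nat m)).
    field. auto.
Qed.

(** The factor between [Y n m] and [solid n m] on the sphere. *)
Definition normalizer (n : nat) (m : Z) : R :=
  sqrt ((2 * INR n + 1) / (4 * PI)
        * (INR (fact (Z.to_nat (Z.of_nat n - m)))
           / INR (fact (Z.to_nat (Z.of_nat n + m)))))
  * ((-1) ^ Z.abs_nat m * (INR (fact (Z.to_nat (Z.of_nat n + m)))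
      / (INR (fact n) * 2 ^ n))).

Lemma Y_solid n m xi : (Z.abs m <= Z.of_nat n)%Z -> enorm xi = 1 ->
  Y n m xi = (RtoC (normalizer n m) * solid n m xi)%C.
Proof.
  intros Hm Hxi.
  assert (H1 : crd1 xi ^ 2 + crd2 xi ^ 2 = 1 - crd3 xi ^ 2).
  { pose proof (enorm_sq xi) as K. rewrite Hxi in K. unfold dot in K. nra. }
  unfold Y, polar. rewrite cos_acos by nra.
  rewrite (solid_cylindrical n xi _ _ (equatorial_azimuth xi)).
  rewrite (assoc_legendre_profile n m (crd3 xi) (sqrt (crd1 xi ^ 2 + crd2 xi ^ 2)) Hm).
  - unfold normalizer. rewrite !RtoC_mult. ring.
  - apply sqrt_pos.
  - rewrite sqrt_sqrt; nra.
Qed.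

Lemma enorm_hat x : enorm x <> 0 -> enorm (hat x) = 1.
Proof.
  intros H. unfold hat. rewrite enorm_scal. pose proof (enorm_ge0 x).
  rewrite Rabs_right by (left; apply Rinv_0_lt_compat; lra). now field.
Qed.

Lemma scal_hat x : enorm x <> 0 -> x = scal (enorm x) (hat x).
Proof.
  intros H. unfold hat. rewrite scal_assoc. unfold mult; simpl.
  rewrite Rinv_r by auto. symmetry. apply (scal_one x).
Qed.

(** Also true at the origin, where [hat x] is not a unit vector: for
    [n > 0] both sides vanish there, and for [n = 0] both are constant. *)
Lemma solid_R_solid n m x : (Z.abs m <= Z.of_nat n)%Z ->
  solid_R n m x = (RtoC (normalizer n m) * solid n m x)%C.
Proof.
  intros Hm. unfold solid_R. destruct (Req_dec (enorm x) 0) as [E|E].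
  - destruct n as [|n].
    + assert (m = 0%Z) by lia. subst m. simpl pow. unfold Y.
      rewrite Rmult_0_l, expi_0.
      replace (assoc_legendre 0 0 (cos (polar (hat x)))) with 1.
      2:{ unfold assoc_legendre, assoc_legendre_nat. simpl.
          rewrite legendre_rodrigues. simpl. field. }
      unfold normalizer. simpl.
      replace (1 * (1 / (1 * 1))) with 1 by field. rewrite Rmult_1_r. ring.
    + rewrite E, pow_i by lia.
      assert (Ez : x = scal 0 x).
      { apply enorm_0 in E. rewrite E. 
        R3_ring. }
      rewrite Ez, solid_scal, pow_i by lia. ring.
  - rewrite Y_solid by (auto; now apply enorm_hat).
    rewrite (scal_hat x E) at 3. rewrite solid_scal. ring.
Qed.

Lemma solid_I_solid n m x : (Z.abs m <= Z.of_nat n)%Z -> enorm x <> 0 ->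
  solid_I n m x = (RtoC (/ enorm x ^ (2 * n + 1)) * solid_R n m x)%C.
Proof.
  intros Hm E. unfold solid_I, solid_R. rewrite Cmult_assoc, <- RtoC_mult.
  do 2 f_equal. replace (2 * n + 1)%nat with (n + (n + 1))%nat by lia.
  rewrite (pow_add _ n (n + 1)). field. split; now apply pow_nonzero.
Qed.

(** * Integrals of products of solid harmonics *)

Lemma ccont_solid {T : UniformSpace} (p : T -> R3) n :
  cont (fun x => crd1 (p x)) -> cont (fun x => crd2 (p x)) ->
  cont (fun x => crd3 (p x)) ->
  forall k, ccont (fun x => solid n k (p x)).
Proof.
  intros H1 H2 H3. induction n as [|n IH]; intros k; cbn [solid].
  - apply ccont_const.
  - assert (He : ccont (fun x => equatorial (p x))) by now apply ccont_pair.
    apply ccont_minus; [apply ccont_plus|]; apply ccont_mult; auto.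
    + apply ccont_mult; [apply ccont_const|now apply ccont_RtoC].
    + now apply ccont_conj.
Qed.

Definition on_sphere (g : R3 -> C) (z : RR) : C := g (sph (fst z) (snd z)).

Lemma ccont_solid_sph n k : ccont (on_sphere (solid n k)).
Proof.
  apply (ccont_solid (T := RR) (fun z => sph (fst z) (snd z))); cbn.
  - apply (cont_mult (T := RR)); [apply (cont_sin (T := RR)), cont_fst|apply (cont_cos (T := RR)), cont_snd].
  - apply (cont_mult (T := RR)); [apply (cont_sin (T := RR)), cont_fst|apply (cont_sin (T := RR)), cont_snd].
  - apply (cont_cos (T := RR)), cont_fst.
Qed.

Lemma solid_sph n k theta phi :
  solid n k (sph theta phi)
  = (expi (IZR k * phi) * RtoC (profile n k (cos theta) (sin theta)))%C.
Proof.
  apply (solid_cylindrical n (sph theta phi) (sin theta) phi).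
  unfold equatorial, sph, crd1, crd2, expi, Cmult, RtoC; simpl. f_equal; ring.
Qed.

Lemma enorm_sph theta phi : enorm (sph theta phi) = 1.
Proof.
  apply enorm_pos; [lra|]. unfold dot, sph, crd1, crd2, crd3; simpl.
  pose proof (sin2_cos2 theta) as H1. pose proof (sin2_cos2 phi) as H2. unfold Rsqr in *.
  transitivity (sin theta * sin theta * (sin phi * sin phi + cos phi * cos phi)
    + cos theta * cos theta); [ring|]. rewrite H2. lra.
Qed.

Lemma solid_bound n y : enorm y = 1 -> forall k, Cmod (solid n k y) <= 4 ^ n.
Proof.
  intros Hy. pose proof (enorm_sq y) as Hd. rewrite Hy in Hd. unfold dot in Hd.
  assert (H3 : Rabs (crd3 y) <= 1) by (apply Rabs_le; nra).
  assert (He : Cmod (equatorial y) <= 1).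
  { unfold Cmod, equatorial; simpl fst; simpl snd. rewrite <- sqrt_1.
    apply sqrt_le_1_alt. nra. }
  induction n as [|n IH]; intros k; cbn [solid].
  - destruct (Z.eq_dec k 0); rewrite ?Cmod_0, ?Cmod_1; simpl; lra.
  - assert (K : forall (c w : C) u, Cmod c <= u -> Cmod w <= 4 ^ n -> Cmod (c * w)%C <= u * 4 ^ n).
    { intros c w u Hc Hw. rewrite Cmod_mult.
      apply Rmult_le_compat; auto; apply Cmod_ge_0. }
    eapply Rle_trans; [apply Cmod_triangle|].
    rewrite Cmod_opp.
    eapply Rle_trans; [apply Rplus_le_compat_r, Cmod_triangle|].
    assert (Cmod (2 * crd3 y)%C <= 2) by (rewrite <- RtoC_mult, Cmod_R, Rabs_mult, (Rabs_right 2); lra).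
    pose proof (K _ _ 2 H (IH k)). pose proof (K _ _ 1 He (IH (k - 1)%Z)).
    assert (He' : Cmod (Cconj (equatorial y)) <= 1) by now rewrite Cmod_conj.
    pose proof (K _ _ 1 He' (IH (k + 1)%Z)). simpl pow. lra.
Qed.

Lemma sphere_separate (a b : R -> R) : cont a -> cont b ->
  mint sphere (fun z => a (snd z) * b (fst z))
  = mint circle a * (2 * PI * RInt (fun t => b t * sin t) 0 PI).
Proof.
  intros Ha Hb. simpl. pose proof PI_RGT_0.
  transitivity (RInt (fun t => RInt a 0 (2 * PI) * (b t * sin t) + 0 * 0) 0 PI).
  - apply RInt_ext. intros t _.
    transitivity (RInt (fun phi => (b t * sin t) * a phi + 0 * 0) 0 (2 * PI)).
    + apply RInt_ext. intros; Req; ring.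
    + rewrite RInt_lin; [Req; ring|auto|apply cont_const].
  - rewrite RInt_lin; [Req; field; lra| |apply cont_const].
    apply cont_mult; [auto|]. apply cont_sin, cont_id.
Qed.

Lemma sphere_inner n n' k k' :
  cint sphere (on_sphere (fun y => solid n k y * Cconj (solid n' k' y))%C)
  = (circ (fun t => expi (IZR (k - k') * t))
     * RtoC (2 * PI * RInt (fun t => (profile n k (cos t) (sin t)
                  * profile n' k' (cos t) (sin t) * sin t)%R) 0 PI))%C.
Proof.
  set (b := fun t => profile n k (cos t) (sin t) * profile n' k' (cos t) (sin t)).
  assert (Cp : forall n k, cont (T := R_UniformSpace) (fun t => profile n k (cos t) (sin t))).
  { induction n0 as [|n0 IH]; intros j; cbn [profile]; [apply cont_const|].
    assert (Cc : cont (T := R_UniformSpace) cos) by apply cont_cos, cont_id.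
    assert (Cs : cont (T := R_UniformSpace) sin) by apply cont_sin, cont_id.
    apply cont_minus; [apply cont_plus|]; apply cont_mult; auto.
    apply cont_mult; [apply cont_const|auto]. }
  assert (Cb : cont (T := R_UniformSpace) b) by (apply cont_mult; apply Cp).
  assert (Ck : cont (T := R_UniformSpace) (fun t => IZR (k - k') * t))
    by (apply cont_mult; [apply cont_const|apply cont_id]).
  rewrite (cint_ext sphere (on_sphere _)
    (fun z => (cos (IZR (k - k') * snd z) * b (fst z),
               sin (IZR (k - k') * snd z) * b (fst z)))).
  - transitivity ((mint sphere (fun z => cos (IZR (k - k') * snd z) * b (fst z)),
      mint sphere (fun z => sin (IZR (k - k') * snd z) * b (fst z))) : C); [reflexivity|].
    rewrite (sphere_separate (fun t => cos (IZR (k - k') * t)) b) by (auto; now apply cont_cos).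
    rewrite (sphere_separate (fun t => sin (IZR (k - k') * t)) b) by (auto; now apply cont_sin).
    unfold Cmult, RtoC; simpl fst; simpl snd. 
    change (fun t => b t * sin t) with (fun t => profile n k (cos t) (sin t) * profile n' k' (cos t) (sin t) * sin t).
    f_equal; simpl; ring.
  - intros [theta phi]. unfold on_sphere. cbn [fst snd]. rewrite !solid_sph.
    rewrite Cmult_conj, <- expi_opp.
    rewrite Cconj_RtoC.
    transitivity (expi (IZR (k - k') * phi) * RtoC (b theta))%C.
    + replace (IZR (k - k') * phi) with (IZR k * phi + - (IZR k' * phi))
        by (rewrite minus_IZR; ring).
      rewrite expi_plus. unfold b. rewrite RtoC_mult. ring.
    + unfold expi, Cmult, RtoC; simpl. f_equal; ring.
Qed.

Lemma solid_orthogonal n n' k k' :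
  (Z.abs k <= Z.of_nat n)%Z -> (Z.abs k' <= Z.of_nat n')%Z ->
  (n <> n' \/ k <> k') ->
  cint sphere (on_sphere (fun y => solid n k y * Cconj (solid n' k' y))%C) = 0%C.
Proof.
  intros Hk Hk' H. rewrite sphere_inner.
  destruct (Z.eq_dec k k') as [<-|E].
  - destruct H as [H|H]; [|easy].
    change (RInt _ 0 PI) with (polar_inner n n' k).
    rewrite polar_inner_0 by auto. rewrite Rmult_0_r. ring.
  - rewrite circ_mode by lia. ring.
Qed.

Lemma solid_norm n k : (Z.abs k <= Z.of_nat n)%Z ->
  (RtoC (normalizer n k ^ 2)
   * cint sphere (on_sphere (fun y => solid n k y * Cconj (solid n k y))%C))%C = 1%C.
Proof.
  intros Hk. rewrite sphere_inner, Z.sub_diag.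
  rewrite (cint_ext circle _ (fun _ => 1%C)), circ_const.
  2:{ intros t. rewrite Rmult_0_l. apply expi_0. }
  change (RInt _ 0 PI) with (polar_inner n n k).
  rewrite polar_inner_diag by auto. rewrite Cmult_1_l, <- RtoC_mult. f_equal.
  unfold normalizer.
  set (P := INR (fact (Z.to_nat (Z.of_nat n + k)))).
  set (M := INR (fact (Z.to_nat (Z.of_nat n - k)))).
  set (N := INR (fact n)).
  assert (HP : 0 < P) by apply INR_fact_lt_0.
  assert (HM : 0 < M) by apply INR_fact_lt_0.
  assert (HN : 0 < N) by apply INR_fact_lt_0.
  pose proof PI_RGT_0 as Hpi. pose proof (pos_INR n) as Hn.
  assert (H2 : 0 < 2 ^ n) by (apply pow_lt; lra).
  replace (4 ^ n) with (2 ^ n * 2 ^ n)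
    by (rewrite <- Rpow_mult_distr; f_equal; ring).
  rewrite !Rpow_mult_distr, pow2_sqrt.
  2:{ apply Rmult_le_pos; left; apply Rdiv_lt_0_compat; lra. }
  replace (((-1) ^ Z.abs_nat k) ^ 2) with 1.
  2:{ rewrite <- pow_mult, Nat.mul_comm, pow_mult.
      replace ((-1) ^ 2) with 1 by ring. symmetry. apply pow1. }
  field. repeat split; lra.
Qed.

(** * Projection *)

(** Combinations of the solid harmonics of degree [n]; the index [j] stands for the
    order [j - n]. *)
Definition solid_span (n : nat) (h : R3 -> C) : Prop :=
  exists a : nat -> C, forall y,
    h y = sum_n (fun j => a j * solid n (Z.of_nat j - Z.of_nat n) y)%C (2 * n).

Lemma solid_span_scal n c h : solid_span n h -> solid_span n (fun y => c * h y)%C.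
Proof.
  intros [a Ha]. exists (fun j => c * a j)%C. intros y. rewrite Ha, <- csum_mult_l.
  apply sum_n_ext. intros j. Ceq. ring.
Qed.

Lemma solid_span_plus n h h' : solid_span n h -> solid_span n h' ->
  solid_span n (fun y => h y + h' y)%C.
Proof.
  intros [a Ha] [b Hb]. exists (fun j => a j + b j)%C. intros y.
  rewrite Ha, Hb, <- csum_plus. apply sum_n_ext. intros j. Ceq. ring.
Qed.

Lemma solid_span_sum n (h : nat -> R3 -> C) p : (forall i, solid_span n (h i)) ->
  solid_span n (fun y => sum_n (fun i => h i y) p).
Proof.
  intros H. induction p as [|p IH].
  - destruct (H 0%nat) as [a Ha]. exists a. intros y. now rewrite csum_O.
  - destruct (solid_span_plus n _ _ IH (H (S p))) as [a Ha]. exists a. intros y.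
    rewrite csum_S. apply Ha.
Qed.

Lemma solid_span_homogeneous n h r y : solid_span n h ->
  h (scal r y) = (RtoC (r ^ n) * h y)%C.
Proof.
  intros [a Ha]. rewrite !Ha, <- csum_mult_l. apply sum_n_ext. intros j.
  rewrite solid_scal. Ceq. ring.
Qed.

Lemma ccont_solid_span n h : solid_span n h -> ccont (on_sphere h).
Proof.
  intros [a Ha].
  replace (on_sphere h) with (fun z : RR => sum_n (fun j => a j *
    solid n (Z.of_nat j - Z.of_nat n) (sph (fst z) (snd z)))%C (2 * n)).
  - apply (ccont_sum (T := RR) (fun j z => a j *
    solid n (Z.of_nat j - Z.of_nat n) (sph (fst z) (snd z)))%C). intros j.
    apply ccont_mult; [apply ccont_const|apply ccont_solid_sph].
  - extensionality z. unfold on_sphere. now rewrite Ha.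
Qed.

(** Integration against [Y n m] commutes with the uniform limit, and orthogonality
    leaves only the term of degree [n] and order [m]; the square of [normalizer]
    coming from [Y] and [solid_R] cancels the squared norm of [solid n m]. *)
Lemma projection (F : R3 -> C) (h : nat -> R3 -> C) (eps : nat -> R) :
  (forall k, solid_span k (h k)) ->
  (forall K xi, enorm xi = 1 ->
     Cmod (F xi - sum_n (fun k => h k xi) K)%C <= eps K) ->
  is_lim_seq eps 0 ->
  forall n x,
    sum_n (fun j => let m := (Z.of_nat j - Z.of_nat n)%Z in
       (sphere_RInt (fun xi => (F xi * Cconj (Y n m xi))%C) * solid_R n m x)%C) (2 * n)
    = h n x.
Proof.
  intros Hh Hap Hlim n x.
  destruct (Hh n) as [a Ha]. rewrite Ha.
  apply sum_n_ext_loc. intros j Hj. cbv zeta. Ceq.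
  set (m := (Z.of_nat j - Z.of_nat n)%Z).
  assert (Hm : (Z.abs m <= Z.of_nat n)%Z) by lia.
  rewrite solid_R_solid by auto.
  set (G := fun y => Cconj (solid n m y)).
  assert (CG : ccont (on_sphere G)) by (apply (ccont_conj (T := RR)), ccont_solid_sph).
  assert (Cpart : forall K, ccont (on_sphere (fun y => sum_n (fun k => h k y) K))).
  { intros K. apply (ccont_sum (T := RR) (fun k => on_sphere (h k))).
    intros k. eapply ccont_solid_span, Hh. }
  assert (CF : ccont (on_sphere F)).
  { apply ccont_uniform_limit. intros e He.
    apply is_lim_seq_spec in Hlim. destruct (Hlim (mkposreal e He)) as [K HK].
    exists (on_sphere (fun y => sum_n (fun k => h k y) K)).
    split; [apply Cpart|]. intros z.
    eapply Rle_trans; [apply Hap, enorm_sph|].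
    specialize (HK K (Nat.le_refl K)). simpl in HK.
    rewrite Rminus_0_r in HK. apply Rabs_def2 in HK. lra. }
  assert (E1 : sphere_RInt (fun xi => F xi * Cconj (Y n m xi))%C
     = (RtoC (normalizer n m) * cint sphere (on_sphere (fun y => F y * G y)%C))%C).
  { rewrite sphere_RInt_cint, <- (cint_scal sphere (RtoC (normalizer n m)) (on_sphere _)).
    - apply cint_ext. intros z. unfold on_sphere. rewrite Y_solid by (auto; apply enorm_sph).
      rewrite Cmult_conj, Cconj_RtoC. unfold G. ring.
    - apply (ccont_mult (T := RR) (on_sphere F) (on_sphere G)); auto. }
  assert (E2 : cint sphere (on_sphere (fun y => F y * G y)%C)
     = (a j * cint sphere (on_sphere (fun y => solid n m y * Cconj (solid n m y))%C))%C).
  { (* [G] is bounded, so uniform convergence passes to the integrals. *)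
    assert (HB : exists B, 0 <= B /\ forall z, Cmod (on_sphere G z) <= B).
    { exists (4 ^ n). split; [apply pow_le; lra|]. intros z. unfold on_sphere, G.
      rewrite Cmod_conj. apply solid_bound, enorm_sph. }
    destruct HB as [B [HB0 HB]].
    apply (Cmod_small_eq _ _ (fun K => (2 * PI * PI * B) * eps (n + K)%nat)).
    2:{ replace (Finite 0) with (Rbar_mult (2 * PI * PI * B) 0) by (simpl; f_equal; ring).
        apply is_lim_seq_scal_l.
        apply (is_lim_seq_ext (fun K => eps (K + n)%nat)); [intros; f_equal; lia|].
        now apply is_lim_seq_incr_n. }
    intros K.
    assert (E3 : cint sphere (on_sphere (fun y => sum_n (fun k => h k y) (n + K) * G y)%C)
      = (a j * cint sphere (on_sphere (fun y => solid n m y * Cconj (solid n m y))%C))%C).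
    { rewrite (cint_ext sphere _ (fun z => sum_n (fun k => on_sphere (fun y => h k y * G y)%C z) (n + K))).
      2:{ intros z. unfold on_sphere. now rewrite csum_mult_r. }
      assert (Chk : forall k, ccont (on_sphere (fun y => h k y * G y)%C)).
      { intros k. apply (ccont_mult (T := RR) (on_sphere (h k)) (on_sphere G)); auto.
        eapply ccont_solid_span, Hh. }
      rewrite (cint_sum sphere (fun k => on_sphere (fun y => h k y * G y)%C)) by exact Chk.
      assert (Ek : forall k b, (forall y, h k y = sum_n (fun i => b i * solid k (Z.of_nat i - Z.of_nat k) y)%C (2 * k)) ->
        cint sphere (on_sphere (fun y => h k y * G y)%C)
        = sum_n (fun i => b i * cint sphere (on_sphere (fun y => solid k (Z.of_nat i - Z.of_nat k) y * G y)%C))%C (2 * k)).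
      { intros k b Hb.
        assert (Cs : forall i, ccont (on_sphere (fun y => solid k (Z.of_nat i - Z.of_nat k) y * G y)%C)).
        { intros i. apply (ccont_mult (T := RR) (on_sphere (solid k (Z.of_nat i - Z.of_nat k)))
            (on_sphere G)); auto. apply ccont_solid_sph. }
        rewrite (cint_ext sphere _ (fun z => sum_n (fun i => b i * on_sphere (fun y => solid k (Z.of_nat i - Z.of_nat k) y * G y) z)%C (2 * k))).
        - rewrite (cint_sum sphere (fun i z => b i * on_sphere (fun y => solid k (Z.of_nat i - Z.of_nat k) y * G y) z)%C).
          + apply sum_n_ext. intros i. now rewrite (cint_scal sphere) by apply Cs.
          + intros i. apply ccont_mult; [apply ccont_const|apply Cs].
        - intros z. unfold on_sphere. rewrite Hb, <- csum_mult_r. apply sum_n_ext. intros i. Ceq. ring. }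
      rewrite (csum_single _ n); [|lia|].
      - rewrite (Ek n a Ha). rewrite (csum_single _ j); [reflexivity|lia|].
        intros i Hi Hij. unfold G. rewrite solid_orthogonal by lia. ring.
      - intros k _ Hkn. destruct (Hh k) as [b Hb]. rewrite (Ek k b Hb).
        apply csum_zero. intros i Hi. unfold G. rewrite solid_orthogonal by lia. ring. }
    assert (C1 : ccont (on_sphere (fun y => F y * G y)%C))
      by (apply (ccont_mult (T := RR) (on_sphere F) (on_sphere G)); auto).
    assert (C2 : ccont (on_sphere (fun y => sum_n (fun k => h k y) (n + K) * G y)%C))
      by (apply (ccont_mult (T := RR) (on_sphere (fun y => sum_n (fun k => h k y) (n + K))) (on_sphere G)); auto).
    rewrite <- E3, <- (cint_minus sphere) by auto.
    rewrite Rmult_assoc.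
    apply (cint_bound sphere); [now apply (ccont_minus (T := RR))|].
    intros z. unfold on_sphere. replace (F (sph (fst z) (snd z)) * G (sph (fst z) (snd z)) -
       sum_n (fun k => h k (sph (fst z) (snd z))) (n + K) * G (sph (fst z) (snd z)))%C
     with ((F (sph (fst z) (snd z)) - sum_n (fun k => h k (sph (fst z) (snd z))) (n + K)) * G (sph (fst z) (snd z)))%C by (Ceq; ring).
    rewrite Cmod_mult, Rmult_comm.
    apply Rmult_le_compat; try apply Cmod_ge_0; [apply HB|].
    apply Hap, enorm_sph. }
  rewrite E1, E2.
  pose proof (solid_norm n m Hm) as E4.
  set (I := cint sphere (on_sphere (fun y => solid n m y * Cconj (solid n m y))%C)) in *.
  transitivity (RtoC (normalizer n m ^ 2) * I * (a j * solid n m x))%C.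
  - simpl pow. rewrite !RtoC_mult. ring.
  - rewrite E4. ring.
Qed.

(** * Powers of null linear forms are solid harmonics *)

(** [a ^ j b ^ l] for [j + l] even, in terms of [al = a ^ 2], [be = b ^ 2] and
    [ga = a b].  No square root is taken, so the value depends continuously on an
    isotropic vector. *)
Definition spinor_monomial (al be ga : C) (j l : nat) : C :=
  ((if Nat.even j then 1 else ga) * (al ^ Nat.div2 j * be ^ Nat.div2 l))%C.

Lemma spinor_monomial_al al be ga j l : (al * spinor_monomial al be ga j l)%C = spinor_monomial al be ga (S (S j)) l.
Proof. unfold spinor_monomial. cbn [Nat.even Nat.div2]. rewrite Cpow_S. ring. Qed.

Lemma spinor_monomial_be al be ga j l : (be * spinor_monomial al be ga j l)%C = spinor_monomial al be ga j (S (S l)).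
Proof. unfold spinor_monomial. cbn [Nat.div2]. rewrite Cpow_S. ring. Qed.

Lemma spinor_monomial_ga al be ga j l : (ga * ga = al * be)%C -> Nat.Even (j + l) ->
  (ga * spinor_monomial al be ga j l)%C = spinor_monomial al be ga (S j) (S l).
Proof.
  intros H He. unfold spinor_monomial.
  destruct (Nat.Even_or_Odd j) as [[i ->]|[i ->]].
  - assert (Hl : exists i', l = (2 * i')%nat)
      by (destruct He as [q Hq]; exists (q - i)%nat; lia).
    destruct Hl as [i' ->].
    rewrite Nat.even_succ, <- Nat.negb_even, Nat.even_mul, !Nat.div2_succ_double, !Nat.div2_double.
    simpl. ring.
  - assert (Hl : exists i', l = (2 * i' + 1)%nat)
      by (destruct He as [q Hq]; exists (q - i - 1)%nat; lia).
    destruct Hl as [i' ->].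
    replace (S (2 * i + 1)) with (2 * S i)%nat by lia.
    replace (S (2 * i' + 1)) with (2 * S i')%nat by lia.
    rewrite Nat.even_mul, Nat.even_add, Nat.even_mul.
    replace (2 * i + 1)%nat with (S (2 * i)) by lia.
    replace (2 * i' + 1)%nat with (S (2 * i')) by lia.
    rewrite !Nat.div2_succ_double, !Nat.div2_double. simpl Nat.even. cbn [orb Bool.eqb].
    rewrite !Cpow_S.
    transitivity ((ga * ga) * (al ^ i * be ^ i'))%C; [ring|]. rewrite H. ring.
Qed.

(** With [al = a ^ 2], [be = b ^ 2], [ga = a b] this is the expansion defining
    [solid], homogenised by [w = a / b]. *)
Lemma generating al be ga n y : (ga * ga = al * be)%C ->
  ((2 * ga * crd3 y + al * equatorial y - be * Cconj (equatorial y)) ^ n)%C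
  = sum_n (fun j => spinor_monomial al be ga j (2 * n - j)
                    * solid n (Z.of_nat j - Z.of_nat n) y)%C (2 * n).
Proof.
  intros H. induction n as [|n IH].
  - rewrite csum_O. unfold spinor_monomial. simpl. Ceq. ring.
  - set (L := (2 * ga * crd3 y + al * equatorial y - be * Cconj (equatorial y))%C) in *.
    set (T := fun j => (spinor_monomial al be ga j (2 * n - j) * solid n (Z.of_nat j - Z.of_nat n) y)%C) in IH.
    set (g := fun j => spinor_monomial al be ga j (2 * S n - j)).
    (* The three terms of the recurrence for [solid] give three shifts of the sum
       for [n], because [solid n k] vanishes for [|k| > n]. *)
    assert (E1 : sum_n (fun j => g j * solid n (Z.of_nat j - Z.of_nat n - 1) y)%C (2 * S n)
                 = (ga * sum_n T (2 * n))%C).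
    { replace (2 * S n)%nat with (S (S (2 * n))) by lia.
      rewrite csum_head, csum_S, (solid_zero n y (_ - _ - 1)) by lia.
      rewrite (solid_zero n y (Z.of_nat (S (S (2 * n))) - Z.of_nat n - 1)) by lia.
      rewrite <- csum_mult_l.
      rewrite (sum_n_ext_loc _ (fun k => ga * T k)%C (2 * n)); [Ceq; ring|].
      intros j Hj. unfold T, g. rewrite Cmult_assoc, spinor_monomial_ga by (auto; exists n; lia).
      do 2 f_equal; lia. }
    assert (E2 : sum_n (fun j => g j * solid n (Z.of_nat j - Z.of_nat n - 2) y)%C (2 * S n)
                 = (al * sum_n T (2 * n))%C).
    { replace (2 * S n)%nat with (S (S (2 * n))) by lia.
      rewrite !csum_head, (solid_zero n y (Z.of_nat 0 - _ - 2)) by lia.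
      rewrite (solid_zero n y (Z.of_nat 1 - Z.of_nat n - 2)) by lia.
      rewrite <- csum_mult_l.
      rewrite (sum_n_ext_loc _ (fun k => al * T k)%C (2 * n)); [Ceq; ring|].
      intros j Hj. unfold T, g. rewrite Cmult_assoc, spinor_monomial_al.
      do 2 f_equal; lia. }
    assert (E3 : sum_n (fun j => g j * solid n (Z.of_nat j - Z.of_nat n) y)%C (2 * S n)
                 = (be * sum_n T (2 * n))%C).
    { replace (2 * S n)%nat with (S (S (2 * n))) by lia.
      rewrite !csum_S, (solid_zero n y (Z.of_nat (S (2 * n)) - _)) by lia.
      rewrite (solid_zero n y (Z.of_nat (S (S (2 * n))) - Z.of_nat n)) by lia.
      rewrite <- csum_mult_l.
      rewrite (sum_n_ext_loc _ (fun k => be * T k)%C (2 * n)); [Ceq; ring|].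
      intros j Hj. unfold T, g. rewrite Cmult_assoc, spinor_monomial_be.
      do 2 f_equal; lia. }
    rewrite Cpow_S, IH.
    transitivity (2 * crd3 y * (ga * sum_n T (2 * n)) + equatorial y * (al * sum_n T (2 * n))
                  - Cconj (equatorial y) * (be * sum_n T (2 * n)))%C; [unfold L; Ceq; ring|].
    rewrite <- E1, <- E2, <- E3, <- !csum_mult_l, <- csum_plus, <- csum_minus.
    apply sum_n_ext. intros j. Ceq. cbn [solid].
    replace (Z.of_nat j - Z.of_nat (S n))%Z with (Z.of_nat j - Z.of_nat n - 1)%Z by lia.
    replace (Z.of_nat j - Z.of_nat n - 1 - 1)%Z with (Z.of_nat j - Z.of_nat n - 2)%Z by lia.
    replace (Z.of_nat j - Z.of_nat n - 1 + 1)%Z with (Z.of_nat j - Z.of_nat n)%Z by lia.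
    unfold g. ring.
Qed.

(** * Averages of powers of null waves *)

(** The coordinates of the isotropic vector [zeta]. *)
Definition zeta (F : frame) (crd : R3 -> R) (t : R) : C :=
  (crd (fd F), cos t * crd (fe1 F) + sin t * crd (fe2 F)).

Lemma ccont_zeta F crd : ccont (T := R_UniformSpace) (zeta F crd).
Proof.
  apply ccont_pair; [apply cont_const|].
  apply cont_plus; apply cont_mult; try apply cont_const;
    [apply cont_cos|apply cont_sin]; apply cont_id.
Qed.

Lemma zeta_null F t :
  (zeta F crd1 t * zeta F crd1 t + zeta F crd2 t * zeta F crd2 t
   + zeta F crd3 t * zeta F crd3 t)%C = 0%C.
Proof.
  destruct F as [d e1 e2 Hd H1 H2 Hd1 Hd2 H12 HP]. unfold zeta, dot in *. simpl in *.
  pose proof (sin2_cos2 t) as Ht. unfold Rsqr in Ht.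
  unfold Cplus, Cmult, RtoC; simpl. f_equal.
  - transitivity (1 - (cos t * cos t * (crd1 e1 * crd1 e1 + crd2 e1 * crd2 e1 + crd3 e1 * crd3 e1)
      + sin t * sin t * (crd1 e2 * crd1 e2 + crd2 e2 * crd2 e2 + crd3 e2 * crd3 e2)
      + 2 * cos t * sin t * (crd1 e1 * crd1 e2 + crd2 e1 * crd2 e2 + crd3 e1 * crd3 e2))).
    + rewrite <- Hd at 1. ring.
    + rewrite H1, H2, H12. lra.
  - transitivity (2 * (cos t * (crd1 d * crd1 e1 + crd2 d * crd2 e1 + crd3 d * crd3 e1)
      + sin t * (crd1 d * crd1 e2 + crd2 d * crd2 e2 + crd3 d * crd3 e2))); [ring|].
    rewrite Hd1, Hd2. ring.
Qed.

(** The weight [w] will carry the dependence on a second vector.  The coefficients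
    in the solid harmonics are means of continuous functions of [t], because
    [spinor_monomial] is continuous. *)
Lemma wave_span F (w : R -> C) n : ccont (T := R_UniformSpace) w ->
  solid_span n (fun y => circ (fun t => (w t * wave F t y ^ n)%C)).
Proof.
  intros Cw.
  set (al := fun t => ((zeta F crd1 t - Ci * zeta F crd2 t) * / 2)%C).
  set (be := fun t => ((- zeta F crd1 t - Ci * zeta F crd2 t) * / 2)%C).
  set (ga := fun t => (zeta F crd3 t * / 2)%C).
  assert (Cal : ccont (T := R_UniformSpace) al).
  { apply ccont_mult; [|apply ccont_const]. apply ccont_minus; [apply ccont_zeta|].
    apply ccont_mult; [apply ccont_const|apply ccont_zeta]. }
  assert (Cbe : ccont (T := R_UniformSpace) be).
  { apply ccont_mult; [|apply ccont_const].
    apply ccont_minus; [apply ccont_opp, ccont_zeta|].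
    apply ccont_mult; [apply ccont_const|apply ccont_zeta]. }
  assert (Cga : ccont (T := R_UniformSpace) ga)
    by (apply ccont_mult; [apply ccont_zeta|apply ccont_const]).
  assert (Cspin : forall j l, ccont (T := R_UniformSpace) (fun t => spinor_monomial (al t) (be t) (ga t) j l)).
  { intros j l. apply ccont_mult.
    - destruct (Nat.even j); [apply ccont_const|exact Cga].
    - apply (ccont_mult (fun t => al t ^ Nat.div2 j)%C (fun t => be t ^ Nat.div2 l)%C);
        now apply ccont_pow. }
  assert (C2 : RtoC 2 <> 0%C) by (intros K; injection K; lra).
  assert (CiCi : (Ci * Ci)%C = (-1)%C) by (unfold Ci, Cmult, RtoC; simpl; f_equal; ring).
  assert (Hnull : forall t, (ga t * ga t = al t * be t)%C).
  { intros t. pose proof (zeta_null F t) as N. unfold al, be, ga.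
    transitivity ((zeta F crd3 t * zeta F crd3 t) * (/ 2 * / 2))%C; [ring|].
    transitivity ((- (zeta F crd1 t * zeta F crd1 t)
       + (Ci * Ci) * (zeta F crd2 t * zeta F crd2 t)) * (/ 2 * / 2))%C; [|ring].
    rewrite CiCi. f_equal.
    transitivity ((zeta F crd1 t * zeta F crd1 t + zeta F crd2 t * zeta F crd2 t
       + zeta F crd3 t * zeta F crd3 t) - (zeta F crd1 t * zeta F crd1 t
       + zeta F crd2 t * zeta F crd2 t))%C; [ring|].
    rewrite N. ring. }
  assert (Hw : forall t y, wave F t y
     = (2 * ga t * crd3 y + al t * equatorial y - be t * Cconj (equatorial y))%C).
  { intros t y.
    transitivity (RtoC (crd1 y) * zeta F crd1 t + RtoC (crd2 y) * zeta F crd2 t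
                  + RtoC (crd3 y) * zeta F crd3 t)%C.
    - unfold wave, zeta, dot, Cplus, Cmult, RtoC; simpl. f_equal; ring.
    - replace (Cconj (equatorial y)) with (crd1 y - Ci * crd2 y)%C
        by (unfold equatorial, Cconj, Ci, Cminus, Cplus, Copp, Cmult, RtoC; simpl; f_equal; ring).
      replace (equatorial y) with (crd1 y + Ci * crd2 y)%C
        by (unfold equatorial, Ci, Cplus, Cmult, RtoC; simpl; f_equal; ring).
      unfold al, be, ga.
      transitivity (crd1 y * zeta F crd1 t - (Ci * Ci) * crd2 y * zeta F crd2 t
                  + crd3 y * zeta F crd3 t)%C; [rewrite CiCi; ring|].
      field. }
  exists (fun j => circ (fun t => (w t * spinor_monomial (al t) (be t) (ga t) j (2 * n - j))%C)).
  intros y.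
  rewrite (cint_ext circle _ (fun t => sum_n (fun j =>
     (w t * spinor_monomial (al t) (be t) (ga t) j (2 * n - j))
     * solid n (Z.of_nat j - Z.of_nat n) y)%C (2 * n))).
  - rewrite (cint_sum circle (fun j t => (w t * spinor_monomial (al t) (be t) (ga t) j (2 * n - j))
     * solid n (Z.of_nat j - Z.of_nat n) y)%C).
    + apply sum_n_ext. intros j. Ceq. apply (cint_scal_r circle). now apply ccont_mult.
    + intros j. apply ccont_mult; [now apply ccont_mult|apply ccont_const].
  - intros t. rewrite Hw, generating by auto. rewrite <- csum_mult_l.
    apply sum_n_ext. intros j. Ceq. ring.
Qed.

(** * Negative binomial series *)

(** The coefficient of [z ^ k] in [1 / (1 - z) ^ (n + 1)]. *)
Definition multichoose (n k : nat) : R := Binomial.C (n + k) k.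

Lemma multichoose_0_r n : multichoose n 0 = 1.
Proof. unfold multichoose. apply C_n_0. Qed.

Lemma multichoose_0_l k : multichoose 0 k = 1.
Proof. unfold multichoose. simpl. apply C_n_n. Qed.

Lemma multichoose_SS n k : multichoose (S n) (S k) = multichoose (S n) k + multichoose n (S k).
Proof.
  unfold multichoose. replace (S n + S k)%nat with (S (S n + k)) by lia.
  rewrite <- pascal by lia. replace (n + S k)%nat with (S n + k)%nat by lia. reflexivity.
Qed.

Lemma multichoose_sym n k : multichoose n k = multichoose k n.
Proof.
  unfold multichoose. rewrite pascal_step1 by lia. f_equal; lia.
Qed.

Lemma multichoose_ge0 n k : 0 <= multichoose n k.
Proof.
  unfold multichoose, Binomial.C. apply Rmult_le_pos; [apply pos_INR|].
  left. apply Rinv_0_lt_compat. apply Rmult_lt_0_compat; apply INR_fact_lt_0.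
Qed.

Definition tail (n K : nat) (z : C) : C :=
  (/ (1 - z) ^ S n - sum_n (fun k => multichoose n k * z ^ k) K)%C.

Definition Rtail (n K : nat) (x : R) : R :=
  / (1 - x) ^ S n - sum_n (fun k => multichoose n k * x ^ k) K.

Lemma RtoC_sum (a : nat -> R) n : RtoC (sum_n a n) = sum_n (fun k => RtoC (a k)) n.
Proof.
  induction n as [|n IH]; [now rewrite rsum_O, csum_O|].
  now rewrite rsum_S, csum_S, RtoC_plus, IH.
Qed.

Lemma RtoC_Rtail n K x : x <> 1 -> RtoC (Rtail n K x) = tail n K x.
Proof.
  intros H. unfold Rtail, tail.
  rewrite RtoC_minus, RtoC_inv by (apply pow_nonzero; lra).
  rewrite RtoC_pow, RtoC_minus, RtoC_sum. f_equal. f_equal.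
  extensionality k. now rewrite RtoC_mult, RtoC_pow.
Qed.

Lemma tail_0 K z : (1 - z)%C <> 0%C -> tail 0 K z = (z ^ S K / (1 - z))%C.
Proof.
  intros H. rewrite <- geometric_remainder by auto. unfold tail.
  rewrite Cpow_1_r. f_equal. f_equal. extensionality k. rewrite multichoose_0_l. ring.
Qed.

(** Multiplication by [1 - z] turns [multichoose (S n)] into differences, which are
    [multichoose n] by Pascal's rule. *)
Lemma tail_S n K z : (1 - z)%C <> 0%C ->
  tail (S n) K z = ((tail n K z + multichoose (S n) K * z ^ S K) / (1 - z))%C.
Proof.
  intros H.
  assert (E : ((1 - z) * sum_n (fun k => multichoose (S n) k * z ^ k)%C K
     = sum_n (fun k => multichoose n k * z ^ k)%C K - multichoose (S n) K * z ^ S K)%C).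
  { induction K as [|K IH].
    - rewrite !csum_O, !multichoose_0_r. simpl. Ceq. ring.
    - rewrite !csum_S, Cmult_plus_distr_l, IH, multichoose_SS, RtoC_plus, !Cpow_S. Ceq. ring. }
  unfold tail.
  assert (H' : ((1 - z) ^ S n)%C <> 0%C) by now apply Cpow_nz.
  replace (/ (1 - z) ^ S n - sum_n (fun k => multichoose n k * z ^ k) K + multichoose (S n) K * z ^ S K)%C
    with (/ (1 - z) ^ S n - (1 - z) * sum_n (fun k => multichoose (S n) k * z ^ k) K)%C
    by (rewrite E; Ceq; ring).
  rewrite (Cpow_S _ (S n)). field. auto.
Qed.

Lemma one_minus_RtoC_neq0 x : x < 1 -> (1 - RtoC x)%C <> 0%C.
Proof. intros H K. rewrite <- RtoC_minus in K. injection K. lra. Qed.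

Lemma Rtail_0 K x : x < 1 -> Rtail 0 K x = x ^ S K / (1 - x).
Proof.
  intros H. apply RtoC_inj. rewrite RtoC_Rtail, tail_0 by (try apply one_minus_RtoC_neq0; lra).
  now rewrite RtoC_div, RtoC_pow, RtoC_minus by lra.
Qed.

Lemma Rtail_S n K x : x < 1 ->
  Rtail (S n) K x = (Rtail n K x + multichoose (S n) K * x ^ S K) / (1 - x).
Proof.
  intros H. apply RtoC_inj.
  rewrite RtoC_Rtail, tail_S by (try apply one_minus_RtoC_neq0; lra).
  rewrite RtoC_div, RtoC_plus, RtoC_mult, RtoC_pow, RtoC_minus by lra.
  now rewrite RtoC_Rtail by lra.
Qed.

(** All the Taylor coefficients are positive, so the tail at a complex point is
    dominated by the tail at any larger real one. *)
Lemma tail_bound n K z x : Cmod z <= x < 1 -> Cmod (tail n K z) <= Rtail n K x.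
Proof.
  intros [Hz Hx].
  assert (Hn : (1 - z)%C <> 0%C) by (apply C1_minus_neq0; lra).
  assert (Hi : / Cmod (1 - z)%C <= / (1 - x)).
  { apply Rinv_le_contravar; [lra|].
    pose proof (Cmod_1_minus z ltac:(lra)). lra. }
  assert (Hi0 : 0 <= / Cmod (1 - z)%C).
  { left. apply Rinv_0_lt_compat. now apply Cmod_gt_0. }
  assert (Hp : forall k, Cmod (z ^ k)%C <= x ^ k).
  { intros k. rewrite Cmod_pow. apply pow_incr. split; [apply Cmod_ge_0|auto]. }
  induction n as [|n IH].
  - rewrite tail_0, Rtail_0 by auto. rewrite Cmod_div by auto. unfold Rdiv.
    apply Rmult_le_compat; auto. apply Cmod_ge_0.
  - rewrite tail_S, Rtail_S by auto. rewrite Cmod_div by auto. unfold Rdiv.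
    apply Rmult_le_compat; auto; [apply Cmod_ge_0|].
    eapply Rle_trans; [apply Cmod_triangle|]. apply Rplus_le_compat; [auto|].
    rewrite Cmod_mult, Cmod_R, Rabs_right by (apply Rle_ge, multichoose_ge0).
    apply Rmult_le_compat_l; [apply multichoose_ge0|auto].
Qed.

Lemma Rtail_ge0 n K x : 0 <= x < 1 -> 0 <= Rtail n K x.
Proof.
  intros Hx. eapply Rle_trans; [apply Cmod_ge_0|].
  apply (tail_bound n K (RtoC x)). rewrite Cmod_R, Rabs_right; lra.
Qed.

(** The partial sums increase and are bounded, so their increments tend to [0]. *)
Lemma multichoose_term_lim n x : 0 <= x < 1 -> is_lim_seq (fun k => multichoose n k * x ^ k) 0.
Proof.
  intros Hx.
  set (s := fun K => sum_n (fun k => multichoose n k * x ^ k) K).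
  assert (Hp : forall k, 0 <= multichoose n k * x ^ k)
    by (intros; apply Rmult_le_pos; [apply multichoose_ge0|apply pow_le; lra]).
  destruct (ex_finite_lim_seq_incr s (/ (1 - x) ^ S n)) as [l Hl].
  - intros K. unfold s. rewrite rsum_S. pose proof (Hp (S K)). lra.
  - intros K. pose proof (Rtail_ge0 n K x Hx) as H. unfold Rtail in H. unfold s. lra.
  - apply is_lim_seq_incr_1.
    apply (is_lim_seq_ext (fun K => s (S K) - s K)).
    + intros K. unfold s. rewrite rsum_S. Req. ring.
    + replace (Finite 0) with (Finite (l - l)) by (f_equal; ring).
      apply is_lim_seq_minus'; [now apply (is_lim_seq_incr_1 s)|auto].
Qed.

Lemma Rtail_lim n x : 0 <= x < 1 -> is_lim_seq (fun K => Rtail n K x) 0.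
Proof.
  intros Hx. induction n as [|n IH].
  - apply (is_lim_seq_ext (fun K => / (1 - x) * x ^ S K)).
    + intros K. rewrite Rtail_0 by lra. unfold Rdiv. ring.
    + now apply is_lim_seq_geom0.
  - apply (is_lim_seq_ext (fun K => / (1 - x) * (Rtail n K x + x * (multichoose (S n) K * x ^ K)))).
    + intros K. rewrite Rtail_S by lra. simpl pow. field. lra.
    + replace (Finite 0) with (Rbar_mult (/ (1 - x)) (0 + x * 0)).
      * apply is_lim_seq_scal_l. apply is_lim_seq_plus'; [auto|].
        apply (is_lim_seq_scal_l _ x 0). now apply multichoose_term_lim.
      * simpl. f_equal. ring.
Qed.

(** * Uniqueness of asymptotic expansions *)

(** By induction on [n]: once the earlier coefficients agree, the difference of
    the two expansions of order [n] is [a ^ n (al n - be n)] and is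
    [O (a ^ (n + 1))]. *)
Lemma asymptotic_unique (f : R -> C) (al be : nat -> C) d (M : nat -> R) :
  0 < d ->
  (forall N a, 0 < a < d ->
     Cmod (f a - sum_n (fun k => RtoC (a ^ k) * al k)%C N)%C <= M N * a ^ S N) ->
  (forall N a, 0 < a < d ->
     Cmod (f a - sum_n (fun k => RtoC (a ^ k) * be k)%C N)%C <= M N * a ^ S N) ->
  forall n, al n = be n.
Proof.
  intros Hd Ha Hb n. induction n as [n IH] using (well_founded_induction lt_wf).
  assert (H : forall a, 0 < a < d -> Cmod (al n - be n)%C <= 2 * M n * a).
  { intros a Had.
    assert (E : (sum_n (fun k => RtoC (a ^ k) * al k)%C n - sum_n (fun k => RtoC (a ^ k) * be k)%C n)%C
       = (RtoC (a ^ n) * (al n - be n))%C).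
    { rewrite <- csum_minus, (csum_single _ n); [Ceq; ring|lia|].
      intros k Hk Hkn. rewrite (IH k) by lia. ring. }
    assert (K : Cmod (RtoC (a ^ n) * (al n - be n))%C <= 2 * (M n * a ^ S n)).
    { rewrite <- E.
      replace (sum_n (fun k => RtoC (a ^ k) * al k)%C n - sum_n (fun k => RtoC (a ^ k) * be k)%C n)%C
        with ((f a - sum_n (fun k => RtoC (a ^ k) * be k)%C n)
              + - (f a - sum_n (fun k => RtoC (a ^ k) * al k)%C n))%C by (Ceq; ring).
      eapply Rle_trans; [apply Cmod_triangle|]. rewrite Cmod_opp.
      pose proof (Ha n a Had). pose proof (Hb n a Had). lra. }
    assert (Hp : 0 < a ^ n) by (apply pow_lt; lra).
    rewrite Cmod_mult, Cmod_R, Rabs_right in K by lra.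
    apply Rmult_le_reg_l with (a ^ n); auto. simpl pow in K. lra. }
  apply (Cmod_small_eq _ _ (fun k => 2 * M n * (d / 2) * (/ 2) ^ S k)).
  - intros k. rewrite Rmult_assoc. 
    assert (0 < (/ 2) ^ S k) by (apply pow_lt; lra).
    assert ((/ 2) ^ S k <= 1) by (rewrite <- (pow1 (S k)); apply pow_incr; lra).
    apply H. nra.
  - apply is_lim_seq_geom0. lra.
Qed.

(** * Taylor coefficients of the potential *)

Definition asymptotic (f : R -> C) (al : nat -> C) : Prop :=
  exists (d : R) (M : nat -> R), 0 < d /\ forall N a, 0 < a < d ->
    Cmod (f a - sum_n (fun k => RtoC (a ^ k) * al k)%C N)%C <= M N * a ^ S N.

Lemma asymptotic_coef_unique f al be :
  asymptotic f al -> asymptotic f be -> forall n, al n = be n.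
Proof.
  intros [d1 [M1 [H1 A1]]] [d2 [M2 [H2 A2]]].
  apply (asymptotic_unique f al be (Rmin d1 d2) (fun N => Rmax (M1 N) (M2 N))).
  - now apply Rmin_pos.
  - intros N a Ha. pose proof (Rmin_l d1 d2).
    eapply Rle_trans; [apply A1; lra|].
    apply Rmult_le_compat_r; [apply pow_le; lra|apply Rmax_l].
  - intros N a Ha. pose proof (Rmin_r d1 d2).
    eapply Rle_trans; [apply A2; lra|].
    apply Rmult_le_compat_r; [apply pow_le; lra|apply Rmax_r].
Qed.

Lemma wave_zero F t : wave F t zero = 0%C.
Proof.
  replace (zero : R3) with (scal 0 (zero : R3)).
  - rewrite wave_scal. ring.
  - R3_ring.
Qed.

Lemma enorm_zero : enorm zero = 0.
Proof.
  apply enorm_pos; [lra|]. unfold dot, crd1, crd2, crd3, zero; simpl.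
  unfold zero; simpl. ring.
Qed.

Lemma wave_denominator F t w D : enorm w < D ->
  D - enorm w <= Cmod (D + wave F t w)%C /\ (D + wave F t w)%C <> 0%C.
Proof.
  intros H. pose proof (wave_bound F t w) as Hw. pose proof (enorm_ge0 w).
  assert (K : D - enorm w <= Cmod (D + wave F t w)%C).
  { pose proof (Cmod_triangle (D + wave F t w)%C (- wave F t w)%C) as T.
    replace (D + wave F t w + - wave F t w)%C with (RtoC D) in T by ring.
    rewrite Cmod_opp, Cmod_R, Rabs_right in T by lra. lra. }
  split; auto. apply Cmod_gt_0. lra.
Qed.

Lemma ccont_wave_inv F D w n : enorm w < D ->
  ccont (T := R_UniformSpace) (fun t => / (D + wave F t w) ^ n)%C.
Proof.
  intros H. apply ccont_inv.
  - apply (ccont_pow (fun t => D + wave F t w)%C).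
    apply ccont_plus; [apply ccont_const|apply ccont_wave].
  - intros t. apply Cpow_nz. now apply wave_denominator.
Qed.

Lemma ccont_wave_pow F v k : ccont (T := R_UniformSpace) (fun t => wave F t v ^ k)%C.
Proof. apply (ccont_pow (fun t => wave F t v)), ccont_wave. Qed.

(** The [k]-th derivative of [1 / |x|] at [D d + w] in the direction [v],
    divided by [(-1)^k k!]. *)
Definition taylor_coef (F : frame) (D : R) (w : R3) (k : nat) (v : R3) : C :=
  circ (fun t => (wave F t v ^ k * / (D + wave F t w) ^ S k)%C).

Lemma geometric_quotient (P Q : C) N : P <> 0%C -> (P + Q)%C <> 0%C ->
  (/ (P + Q) - sum_n (fun k => RtoC ((-1) ^ k) * (Q ^ k * / P ^ S k))%C N)%C
  = (RtoC ((-1) ^ S N) * (Q ^ S N * / P ^ S N) * / (P + Q))%C.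
Proof.
  intros HP HQ. set (z := (- Q / P)%C).
  assert (Hz : (1 - z)%C = ((P + Q) / P)%C) by (unfold z; field; auto).
  assert (Hz0 : (1 - z)%C <> 0%C).
  { rewrite Hz. intros K. apply HQ. 
    replace (P + Q)%C with ((P + Q) / P * P)%C by (field; auto). rewrite K. ring. }
  assert (Hzk : forall k, (z ^ k)%C = (RtoC ((-1) ^ k) * (Q ^ k * / P ^ k))%C).
  { intros k. unfold z. replace (- Q / P)%C with (RtoC (-1) * (Q * / P))%C.
    - rewrite !Cpow_mult_l, RtoC_pow, Cpow_inv by auto. reflexivity.
    - unfold Cdiv. ring. }
  pose proof (geometric_remainder z N Hz0) as G.
  assert (Hs : (sum_n (fun k => RtoC ((-1) ^ k) * (Q ^ k * / P ^ S k))%C N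
     = / P * sum_n (fun k => z ^ k)%C N)%C).
  { rewrite <- csum_mult_l. apply sum_n_ext. intros k. rewrite Hzk, Cpow_S.
    Ceq. field. split; [now apply Cpow_nz|auto]. }
  rewrite Hs.
  replace (/ (P + Q))%C with (/ P * / (1 - z))%C at 1 by (rewrite Hz; field; auto).
  replace (/ P * / (1 - z) - / P * sum_n (fun k => z ^ k) N)%C
    with (/ P * (/ (1 - z) - sum_n (fun k => z ^ k) N))%C by (Ceq; ring).
  rewrite G, Hz, Hzk. field. repeat split; auto; now apply Cpow_nz.
Qed.

(** Expand Whittaker's integral of [D d + w + a v] in powers of [a] under the
    integral sign. *)
Lemma taylor_coef_asymptotic F D w v : enorm w < D ->
  asymptotic (fun a => RtoC (/ enorm (plus (scal D (fd F)) (plus w (scal a v)))))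
    (fun k => (RtoC ((-1) ^ k) * taylor_coef F D w k v)%C).
Proof.
  intros Hw. set (e := D - enorm w). assert (He : 0 < e) by (unfold e; lra).
  pose proof (enorm_ge0 v) as Hv.
  (* Below this value of [a] the perturbation [a v] uses up at most half of the
     margin [e] between [|w|] and [D]. *)
  exists (e / (2 * (enorm v + 1))), (fun N => (enorm v / e) ^ S N * (2 / e)).
  split; [apply Rdiv_lt_0_compat; lra|]. intros N a [Ha0 Ha].
  assert (Hav : a * enorm v <= e / 2).
  { apply Rle_trans with (a * (enorm v + 1)); [nra|].
    replace (e / 2) with (e / (2 * (enorm v + 1)) * (enorm v + 1)) by (field; lra).
    apply Rmult_le_compat_r; lra. }
  assert (Hn : enorm (plus w (scal a v)) < D).
  { eapply Rle_lt_trans; [apply enorm_triangle|].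
    rewrite enorm_scal, Rabs_right by lra. unfold e in *. lra. }
  assert (Cd : forall k, ccont (T := R_UniformSpace)
     (fun t => wave F t v ^ k * / (D + wave F t w) ^ S k)%C).
  { intros k. apply (ccont_mult (fun t => wave F t v ^ k)%C);
      [apply ccont_wave_pow|now apply ccont_wave_inv]. }
  rewrite <- (whittaker F D _ Hn).
  assert (Es : sum_n (fun k => RtoC (a ^ k) * (RtoC ((-1) ^ k) * taylor_coef F D w k v))%C N
    = circ (fun t => sum_n (fun k => RtoC (a ^ k) * (RtoC ((-1) ^ k) *
        (wave F t v ^ k * / (D + wave F t w) ^ S k)))%C N)).
  { rewrite (cint_sum circle (fun k t => RtoC (a ^ k) * (RtoC ((-1) ^ k) *
        (wave F t v ^ k * / (D + wave F t w) ^ S k)))%C).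
    - apply sum_n_ext. intros k. rewrite !(cint_scal circle); auto.
      apply ccont_mult; [apply ccont_const|auto].
    - intros k. do 2 (apply ccont_mult; [apply ccont_const|]). auto. }
  rewrite Es, <- (cint_minus circle).
  2:{ apply ccont_inv; [apply ccont_plus; [apply ccont_const|apply ccont_wave]|].
      intros t. now apply wave_denominator. }
  2:{ apply (ccont_sum (fun k t => RtoC (a ^ k) * (RtoC ((-1) ^ k) *
        (wave F t v ^ k * / (D + wave F t w) ^ S k)))%C).
      intros k. do 2 (apply ccont_mult; [apply ccont_const|]). auto. }
  rewrite <- (Rmult_1_l (_ * a ^ S N)).
  assert (Hpt : forall t, (/ (D + wave F t (plus w (scal a v))) -
     sum_n (fun k => RtoC (a ^ k) * (RtoC ((-1) ^ k) *
        (wave F t v ^ k * / (D + wave F t w) ^ S k))) N)%C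
    = (RtoC ((-1) ^ S N) * ((RtoC a * wave F t v) ^ S N * / (D + wave F t w) ^ S N)
       * / (D + wave F t (plus w (scal a v))))%C).
  { intros t. destruct (wave_denominator F t w D Hw) as [_ Hd1].
    destruct (wave_denominator F t _ D Hn) as [_ Hd2].
    rewrite wave_plus, wave_scal in *.
    replace (D + (wave F t w + a * wave F t v))%C
      with ((D + wave F t w) + a * wave F t v)%C in * by ring.
    rewrite <- geometric_quotient by auto. f_equal. f_equal.
    extensionality k. rewrite Cpow_mult_l, <- RtoC_pow. ring. }
  apply (cint_bound circle).
  { apply ccont_minus.
    - apply ccont_inv; [apply ccont_plus; [apply ccont_const|apply ccont_wave]|].
      intros t. now apply wave_denominator.
    - apply (ccont_sum (fun k t => RtoC (a ^ k) * (RtoC ((-1) ^ k) *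
        (wave F t v ^ k * / (D + wave F t w) ^ S k)))%C).
      intros k. do 2 (apply ccont_mult; [apply ccont_const|]). auto. }
  intros t. rewrite Hpt.
  destruct (wave_denominator F t w D Hw) as [Hb1 Hd1].
  destruct (wave_denominator F t _ D Hn) as [Hb2 Hd2].
  assert (He2 : e / 2 <= Cmod (D + wave F t (plus w (scal a v)))%C).
  { eapply Rle_trans; [|exact Hb2].
    pose proof (enorm_triangle w (scal a v)) as T.
    rewrite enorm_scal, Rabs_right in T by lra. unfold e in *. lra. }
  rewrite !Cmod_mult, !Cmod_inv, !Cmod_pow by (try apply Cpow_nz; auto).
  rewrite Cmod_mult, !Cmod_R, <- RPow_abs, Rabs_m1, pow1, (Rabs_right a) by lra.
  rewrite Rmult_1_l.
  replace ((enorm v / e) ^ S N * (2 / e) * a ^ S N)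
    with ((a * enorm v) ^ S N * / e ^ S N * / (e / 2)).
  2:{ unfold Rdiv at 2. rewrite !Rpow_mult_distr, pow_inv. field. split; [lra|].
      apply pow_nonzero; lra. }
  apply Rmult_le_compat.
  - apply Rmult_le_pos; [apply pow_le, Rmult_le_pos; [lra|apply Cmod_ge_0]|].
    left. apply Rinv_0_lt_compat, pow_lt. fold e in Hb1. lra.
  - left. apply Rinv_0_lt_compat. lra.
  - apply Rmult_le_compat.
    + apply pow_le, Rmult_le_pos; [lra|apply Cmod_ge_0].
    + left. apply Rinv_0_lt_compat, pow_lt. fold e in Hb1. lra.
    + apply pow_incr. split; [apply Rmult_le_pos; [lra|apply Cmod_ge_0]|].
      apply Rmult_le_compat_l; [lra|apply wave_bound].
    + apply Rinv_le_contravar; [now apply pow_lt|]. apply pow_incr. split; [lra|auto].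
  - apply Rinv_le_contravar; lra.
Qed.

(** Both sides are the coefficients of the same function of [a].  This is how
    means over circles about different axes are compared. *)
Lemma taylor_coef_frame F D w (v : R3) G E u (v' : R3) :
  enorm w < D -> enorm u < E ->
  (forall a, enorm (plus (scal D (fd F)) (plus w (scal a v)))
             = enorm (plus (scal E (fd G)) (plus u (scal a v')))) ->
  forall k, taylor_coef F D w k v = taylor_coef G E u k v'.
Proof.
  intros Hw Hu H k.
  assert (A : (RtoC ((-1) ^ k) * taylor_coef F D w k v)%C = (RtoC ((-1) ^ k) * taylor_coef G E u k v')%C).
  { refine (asymptotic_coef_unique _ _ (fun k => RtoC ((-1) ^ k) * taylor_coef G E u k v')%C
      (taylor_coef_asymptotic F D w v Hw) _ k).
    destruct (taylor_coef_asymptotic G E u v' Hu) as [d [M [Hd HM]]].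
    exists d, M. split; auto. intros N a Ha. rewrite H. now apply HM. }
  assert (S2 : (RtoC ((-1) ^ k) * RtoC ((-1) ^ k))%C = 1%C).
  { now rewrite <- RtoC_mult, sign_sq. }
  transitivity (RtoC ((-1) ^ k) * RtoC ((-1) ^ k) * taylor_coef F D w k v)%C; [rewrite S2; ring|].
  rewrite <- Cmult_assoc, A, Cmult_assoc, S2. ring.
Qed.

(** [taylor_coef_asymptotic] at [w = 0] with an explicit error, uniform on spheres,
    as [projection] demands. *)
Lemma potential_series F D v K : enorm v < D ->
  Cmod (RtoC (/ enorm (plus (scal D (fd F)) v))
        - sum_n (fun k => RtoC ((-1) ^ k) * taylor_coef F D zero k v)%C K)%C
  <= (enorm v / D) ^ S K / (D - enorm v).
Proof.
  intros Hv. pose proof (enorm_ge0 v) as Hv0.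
  assert (HD : RtoC D <> 0%C) by (intros E; injection E; lra).
  assert (Cd : forall k, ccont (T := R_UniformSpace)
     (fun t => wave F t v ^ k * / (D + wave F t zero) ^ S k)%C).
  { intros k. apply (ccont_mult (fun t => wave F t v ^ k)%C);
      [apply ccont_wave_pow|apply ccont_wave_inv].
    rewrite enorm_zero. lra. }
  rewrite <- (whittaker F D v Hv).
  assert (Ci1 : ccont (T := R_UniformSpace) (fun t => / (D + wave F t v))%C).
  { apply ccont_inv; [apply ccont_plus; [apply ccont_const|apply ccont_wave]|].
    intros t. now apply wave_denominator. }
  assert (Cs : ccont (T := R_UniformSpace) (fun t => sum_n (fun k =>
     RtoC ((-1) ^ k) * (wave F t v ^ k * / (D + wave F t zero) ^ S k))%C K)).
  { apply (ccont_sum (fun k t => 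
     RtoC ((-1) ^ k) * (wave F t v ^ k * / (D + wave F t zero) ^ S k))%C).
    intros k. apply ccont_mult; [apply ccont_const|auto]. }
  assert (Es : sum_n (fun k => RtoC ((-1) ^ k) * taylor_coef F D zero k v)%C K
    = circ (fun t => sum_n (fun k =>
     RtoC ((-1) ^ k) * (wave F t v ^ k * / (D + wave F t zero) ^ S k))%C K)).
  { rewrite (cint_sum circle (fun k t => 
     RtoC ((-1) ^ k) * (wave F t v ^ k * / (D + wave F t zero) ^ S k))%C).
    - apply sum_n_ext. intros k. now rewrite (cint_scal circle).
    - intros k. apply ccont_mult; [apply ccont_const|auto]. }
  rewrite Es, <- (cint_minus circle) by auto.
  rewrite <- (Rmult_1_l (_ / _)).
  apply (cint_bound circle); [now apply ccont_minus|].
  intros t. destruct (wave_denominator F t v D Hv) as [Hb1 Hd1].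
  rewrite wave_zero, Cplus_0_r, geometric_quotient by auto.
  rewrite !Cmod_mult, !Cmod_inv, !Cmod_pow by (try apply Cpow_nz; auto).
  rewrite !Cmod_R, <- RPow_abs, Rabs_m1, pow1, (Rabs_right D) by lra.
  rewrite Rmult_1_l. unfold Rdiv. rewrite Rpow_mult_distr, pow_inv.
  apply Rmult_le_compat.
  - apply Rmult_le_pos; [apply pow_le, Cmod_ge_0|]. left. apply Rinv_0_lt_compat, pow_lt. lra.
  - left. apply Rinv_0_lt_compat. lra.
  - apply Rmult_le_compat_r; [left; apply Rinv_0_lt_compat, pow_lt; lra|].
    apply pow_incr. split; [apply Cmod_ge_0|apply wave_bound].
  - apply Rinv_le_contravar; lra.
Qed.

(** * Local and multipole expansions from series *)

Lemma local_exp_sum f (c : R3) rho (h : nat -> R3 -> C) eps q (t : R3) :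
  0 < rho -> (forall k, solid_span k (h k)) ->
  (forall K y, enorm y = rho ->
     Cmod (f (plus c y) - sum_n (fun k => h k y) K)%C <= eps K) ->
  is_lim_seq eps 0 ->
  local_exp q f c rho t = sum_n (fun k => h k (minus t c)) q.
Proof.
  intros Hr Hh Hap Hlim. unfold local_exp, sum_nm. apply sum_n_ext. intros n.
  assert (Hrn : rho ^ n <> 0) by (apply pow_nonzero; lra).
  pose proof (projection (fun xi => f (plus c (scal rho xi)))
    (fun k y => RtoC (rho ^ k) * h k y)%C eps) as P.
  transitivity (RtoC (/ rho ^ n) * (RtoC (rho ^ n) * h n (minus t c)))%C.
  2:{ rewrite Cmult_assoc, <- RtoC_mult, Rinv_l by auto. Ceq. ring. }
  rewrite <- P; auto.
  - rewrite <- csum_mult_l. apply sum_n_ext. intros j. cbv beta zeta. unfold local_coef.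
    Ceq. ring.
  - intros k. now apply solid_span_scal.
  - intros K xi Hxi.
    replace (sum_n (fun k => RtoC (rho ^ k) * h k xi)%C K)
      with (sum_n (fun k => h k (scal rho xi)) K).
    + apply Hap. rewrite enorm_scal, Hxi, Rabs_right; lra.
    + apply sum_n_ext. intros k. now apply solid_span_homogeneous.
Qed.

Lemma Cmult_swap a b c d : ((a * b) * (c * d) = (a * c) * (b * d))%C.
Proof. ring. Qed.

(** On the sphere, [Y n m] is both a local and a multipole harmonic, so the same
    [projection] serves. *)
Lemma multipole_exp_sum f (c : R3) rho (h : nat -> R3 -> C) eps p (x : R3) :
  0 < rho -> (forall k, solid_span k (h k)) ->
  (forall K xi, enorm xi = 1 ->
     Cmod (f (plus c (scal rho xi))
           - sum_n (fun k => RtoC (/ rho ^ (k + 1)) * h k xi)%C K)%C <= eps K) ->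
  is_lim_seq eps 0 -> enorm (minus x c) <> 0 ->
  multipole_exp p f c rho x
  = sum_n (fun k => RtoC (/ enorm (minus x c) ^ (2 * k + 1)) * h k (minus x c))%C p.
Proof.
  intros Hr Hh Hap Hlim Hx. unfold multipole_exp, sum_nm. apply sum_n_ext. intros n.
  assert (Hrn : rho ^ (n + 1) <> 0) by (apply pow_nonzero; lra).
  pose proof (projection (fun xi => f (plus c (scal rho xi)))
    (fun k y => RtoC (/ rho ^ (k + 1)) * h k y)%C eps) as P.
  transitivity (RtoC (rho ^ (n + 1)) * RtoC (/ enorm (minus x c) ^ (2 * n + 1))
     * (RtoC (/ rho ^ (n + 1)) * h n (minus x c)))%C.
  2:{ transitivity (RtoC (rho ^ (n + 1)) * RtoC (/ rho ^ (n + 1))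
     * (RtoC (/ enorm (minus x c) ^ (2 * n + 1)) * h n (minus x c)))%C; [Ceq; ring|].
      rewrite <- RtoC_mult, Rinv_r by auto. Ceq. ring. }
  rewrite <- P; auto.
  - rewrite <- csum_mult_l. apply sum_n_ext_loc. intros j Hj. cbv beta zeta. unfold multipole_coef.
    rewrite solid_I_solid by (auto; lia). apply Cmult_swap.
  - intros k. now apply solid_span_scal.
Qed.

Lemma taylor_coef_centre F D k v : 0 < D ->
  taylor_coef F D zero k v = circ (fun t => RtoC (/ D ^ S k) * wave F t v ^ k)%C.
Proof.
  intros HD. apply cint_ext. intros t.
  rewrite wave_zero, Cplus_0_r, <- RtoC_pow, RtoC_inv by (apply pow_nonzero; lra). ring.
Qed.

Lemma taylor_coef_scal F D w k a v : enorm w < D ->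
  taylor_coef F D w k (scal a v) = (RtoC (a ^ k) * taylor_coef F D w k v)%C.
Proof.
  intros Hw. unfold taylor_coef. rewrite <- (cint_scal circle).
  - apply cint_ext. intros t. rewrite wave_scal, Cpow_mult_l, <- RtoC_pow. ring.
  - apply (ccont_mult (fun t => wave F t v ^ k)%C);
      [apply ccont_wave_pow|now apply ccont_wave_inv].
Qed.

Lemma taylor_coef_centre_span F D k : 0 < D -> solid_span k (taylor_coef F D zero k).
Proof.
  intros HD.
  destruct (wave_span F (fun _ => RtoC (/ D ^ S k)) k) as [a Ha]; [apply ccont_const|].
  exists a. intros y. now rewrite taylor_coef_centre.
Qed.

(** For a unit vector [xi], reflection exchanges [rho xi - s] with
    [rho d - |s| xi], where [d] is the direction of [s].  The potential on the
    sphere of radius [rho] is therefore a potential at [rho d] displaced by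
    [- |s| xi], and its Taylor expansion there is its harmonic expansion in [xi]. *)
Lemma multipole_potential F p s rho x :
  s = scal (enorm s) (fd F) -> enorm s < rho -> enorm x <> 0 ->
  multipole_exp p (point_potential s) zero rho x
  = sum_n (fun n => taylor_coef F (enorm x) zero n (scal (enorm s) (hat x))) p.
Proof.
  intros Hs Hrho Hx. pose proof (enorm_ge0 s) as Hs0. pose proof (enorm_ge0 x) as Hx0.
  set (o := zero : R3).
  assert (Hm : minus x o = x) by apply (minus_zero_r x).
  assert (Ho : enorm o = 0) by apply enorm_zero.
  assert (Hxp : 0 < enorm x) by lra.
  rewrite (multipole_exp_sum _ _ _
    (fun k y => circ (fun t => RtoC (enorm s ^ k) * wave F t y ^ k)%C)
    (fun K => / (rho - enorm s) * (enorm s / rho) ^ S K)).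
  - rewrite Hm. apply sum_n_ext. intros n.
    rewrite taylor_coef_scal, taylor_coef_centre by (rewrite ?Ho, ?enorm_zero; lra).
    rewrite <- !(cint_scal circle).
    + apply cint_ext. intros t.
      replace (wave F t x) with (wave F t (scal (enorm x) (hat x)))
        by (f_equal; symmetry; now apply scal_hat).
      rewrite wave_scal, Cpow_mult_l, <- RtoC_pow.
      replace (/ enorm x ^ S n) with (/ enorm x ^ (2 * n + 1) * enorm x ^ n).
      * rewrite RtoC_mult. ring.
      * replace (2 * n + 1)%nat with (n + S n)%nat by lia. rewrite pow_add.
        field. split; now apply pow_nonzero.
    + apply ccont_mult; [apply ccont_const|apply ccont_wave_pow].
    + apply ccont_mult; [apply ccont_const|apply ccont_wave_pow].
  - lra.
  - intros k. apply wave_span. apply ccont_const.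
  - intros K xi Hxi.
    assert (Hv : enorm (scal (- enorm s) xi) = enorm s).
    { rewrite enorm_scal, Hxi, Rabs_Ropp, Rabs_right; lra. }
    pose proof (potential_series F rho (scal (- enorm s) xi) K) as P.
    rewrite Hv in P. specialize (P Hrho).
    eapply Rle_trans; [|eapply Rle_trans; [exact P|unfold Rdiv; lra]].
    right. do 2 f_equal.
    + unfold point_potential. do 2 f_equal.
      assert (Hp : plus o (scal rho xi) = scal rho xi) by apply (plus_zero_l (scal rho xi)).
      rewrite Hp. apply enorm_eq. rewrite minus_scal.
      rewrite Hs at 1 2.
      rewrite !dot_plus_l, !dot_plus_r, !dot_scal_l, !dot_scal_r, fd_unit, (dot_sym xi (fd F)).
      rewrite <- (enorm_sq xi), Hxi. ring.
    + f_equal. extensionality k.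
      rewrite taylor_coef_scal, taylor_coef_centre by (rewrite ?Ho, ?enorm_zero; lra).
      rewrite <- !(cint_scal circle).
      * apply cint_ext. intros t. replace (k + 1)%nat with (S k) by lia.
        replace (- enorm s) with (-1 * enorm s) by ring.
        rewrite Rpow_mult_distr, RtoC_mult.
        transitivity (RtoC ((-1) ^ k * (-1) ^ k) * (RtoC (/ rho ^ S k) * (RtoC (enorm s ^ k) * wave F t xi ^ k)))%C.
        -- rewrite sign_sq. ring.
        -- rewrite RtoC_mult. ring.
      * repeat (apply ccont_mult; [apply ccont_const|]). apply ccont_wave_pow.
      * repeat (apply ccont_mult; [apply ccont_const|]). apply ccont_wave_pow.
      * repeat (apply ccont_mult; [apply ccont_const|]). apply ccont_wave_pow.
  - apply is_lim_seq_geom0, ratio_bounds. lra.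
  - now rewrite Hm.
Qed.

(** * Mixed expansions *)

(** Up to the sign [(-1) ^ (k + n)], the part of degree [k] in [v] and [n] in [w]
    of [1 / |D d + v + w|]. *)
Definition mixed_coef (G : frame) (D : R) (k n : nat) (v w : R3) : C :=
  circ (fun t => RtoC (multichoose k n / D ^ (k + n + 1)) * (wave G t v ^ k * wave G t w ^ n))%C.

Lemma mixed_coef_sym G D k n v w : mixed_coef G D k n v w = mixed_coef G D n k w v.
Proof.
  apply cint_ext. intros t. rewrite multichoose_sym.
  replace (k + n + 1)%nat with (n + k + 1)%nat by lia. ring.
Qed.

Lemma ccont_mixed_coef G D k n v w : ccont (T := R_UniformSpace) (fun t =>
  RtoC (multichoose k n / D ^ (k + n + 1)) * (wave G t v ^ k * wave G t w ^ n))%C.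
Proof.
  apply ccont_mult; [apply ccont_const|].
  apply (ccont_mult (fun t => wave G t v ^ k)%C); apply ccont_wave_pow.
Qed.

Lemma mixed_coef_scal_r G D k n v a w :
  mixed_coef G D k n v (scal a w) = (RtoC (a ^ n) * mixed_coef G D k n v w)%C.
Proof.
  unfold mixed_coef. rewrite <- (cint_scal circle) by apply ccont_mixed_coef.
  apply cint_ext. intros t. rewrite wave_scal, Cpow_mult_l, <- RtoC_pow. ring.
Qed.

Lemma mixed_coef_span G D k n v : solid_span n (mixed_coef G D k n v).
Proof.
  destruct (wave_span G (fun t => RtoC (multichoose k n / D ^ (k + n + 1)) * wave G t v ^ k)%C n)
    as [a Ha].
  - apply ccont_mult; [apply ccont_const|apply ccont_wave_pow].
  - exists a. intros y. rewrite <- Ha. apply cint_ext. intros t. ring.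
Qed.

(** Expand the denominator in [taylor_coef] in powers of [wave w] under the
    integral; the error at each point is a negative binomial tail, hence at most
    the tail for the largest modulus. *)
Lemma taylor_coef_series G D w k v rho N : enorm w <= rho -> rho < D ->
  Cmod (taylor_coef G D w k v - sum_n (fun n => RtoC ((-1) ^ n) * mixed_coef G D k n v w)%C N)%C
  <= enorm v ^ k / D ^ S k * Rtail k N (rho / D).
Proof.
  intros Hw Hrho. pose proof (enorm_ge0 w) as Hw0.
  assert (HD : 0 < D) by lra.
  assert (HDC : RtoC D <> 0%C) by (intros K; injection K; lra).
  assert (HwD : enorm w < D) by lra.
  assert (C1 : ccont (T := R_UniformSpace)
     (fun t => wave G t v ^ k * / (D + wave G t w) ^ S k)%C)
    by (apply (ccont_mult (fun t => wave G t v ^ k)%C);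
      [apply ccont_wave_pow|now apply ccont_wave_inv]).
  set (g := fun n t => (RtoC ((-1) ^ n) * (RtoC (multichoose k n / D ^ (k + n + 1)) *
      (wave G t v ^ k * wave G t w ^ n)))%C).
  assert (Cg : forall n, ccont (T := R_UniformSpace) (g n))
    by (intros n; apply ccont_mult; [apply ccont_const|apply ccont_mixed_coef]).
  assert (Es : sum_n (fun n => RtoC ((-1) ^ n) * mixed_coef G D k n v w)%C N
     = circ (fun t => sum_n (fun n => g n t) N)).
  { rewrite (cint_sum circle g) by auto. apply sum_n_ext. intros n. unfold mixed_coef.
    now rewrite <- (cint_scal circle) by apply ccont_mixed_coef. }
  rewrite Es. unfold taylor_coef. rewrite <- (cint_minus circle) by (auto; now apply ccont_sum).
  rewrite <- (Rmult_1_l (_ / _ * _)).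
  apply (cint_bound circle); [apply ccont_minus; auto; now apply ccont_sum|].
  intros t. set (z := (- wave G t w / D)%C).
  destruct (wave_denominator G t w D HwD) as [_ Hd].
  assert (Hz : (D + wave G t w)%C = (D * (1 - z))%C) by (unfold z; field; auto).
  assert (Hzn : (1 - z)%C <> 0%C).
  { intros K. apply Hd. rewrite Hz, K. ring. }
  assert (E : (wave G t v ^ k * / (D + wave G t w) ^ S k - sum_n (fun n => g n t) N)%C
     = (wave G t v ^ k * RtoC (/ D ^ S k) * tail k N z)%C).
  { unfold tail. rewrite Hz, Cpow_mult_l, RtoC_inv, RtoC_pow by (apply pow_nonzero; lra).
    replace (sum_n (fun n => g n t) N) with
      (wave G t v ^ k * / D ^ S k * sum_n (fun n => multichoose k n * z ^ n) N)%C.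
    - Ceq. field. split; now apply Cpow_nz.
    - rewrite <- csum_mult_l. apply sum_n_ext. intros n. unfold g, z.
      replace (- wave G t w / D)%C with (RtoC (-1) * (RtoC (/ D) * wave G t w))%C
        by (rewrite RtoC_inv by lra; unfold Cdiv; ring).
      rewrite !Cpow_mult_l, <- !RtoC_pow.
      replace (multichoose k n / D ^ (k + n + 1)) with (multichoose k n * (/ D ^ S k * (/ D) ^ n)).
      + rewrite !RtoC_mult, (RtoC_inv (D ^ S k)) by (apply pow_nonzero; lra). Ceq. ring.
      + rewrite pow_inv. replace (k + n + 1)%nat with (S k + n)%nat by lia.
        rewrite pow_add. field. split; apply pow_nonzero; lra. }
  rewrite E, !Cmod_mult, Cmod_pow, Cmod_R, Rabs_right.
  2:{ left. apply Rinv_0_lt_compat, pow_lt. lra. }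
  assert (Hx : 0 <= rho / D < 1).
  { apply ratio_bounds. lra. }
  assert (Hzb : Cmod z <= rho / D).
  { unfold z. rewrite Cmod_div, Cmod_opp, Cmod_R, (Rabs_right D) by (auto; lra).
    apply Rmult_le_compat_r; [left; apply Rinv_0_lt_compat; lra|].
    eapply Rle_trans; [apply wave_bound|auto]. }
  apply Rmult_le_compat.
  - apply Rmult_le_pos; [apply pow_le, Cmod_ge_0|]. left. apply Rinv_0_lt_compat, pow_lt. lra.
  - apply Cmod_ge_0.
  - apply Rmult_le_compat_r; [left; apply Rinv_0_lt_compat, pow_lt; lra|].
    apply pow_incr. split; [apply Cmod_ge_0|apply wave_bound].
  - apply tail_bound. lra.
Qed.

Lemma sum_lim_0 (u : nat -> nat -> R) p : (forall n, is_lim_seq (u n) 0) ->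
  is_lim_seq (fun K => sum_n (fun n => u n K) p) 0.
Proof.
  intros H. induction p as [|p IH].
  - apply (is_lim_seq_ext (u 0%nat)); [|auto]. intros K. now rewrite rsum_O.
  - apply (is_lim_seq_ext (fun K => sum_n (fun n => u n K) p + u (S p) K)).
    + intros K. now rewrite rsum_S.
    + replace (Finite 0) with (Finite (0 + 0)) by (f_equal; ring).
      now apply is_lim_seq_plus'.
Qed.

Lemma rsum_minus (a b : nat -> R) n :
  sum_n (fun k => a k - b k) n = sum_n a n - sum_n b n.
Proof.
  induction n as [|n IH]; [now rewrite !rsum_O|]. rewrite !rsum_S, IH. Req. ring.
Qed.

(** The terms being nonnegative, the sum over [k <= q] is at most the sum over all
    [k].  There the two series can be summed in closed form, leaving the tail of a
    geometric series of ratio [S / (D - Y)], which is monotone in [S] and [Y]. *)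
Lemma double_tail (D S Y r R' : R) (p q : nat) :
  0 <= S <= r -> r < R' -> 0 <= Y -> Y <= D - R' ->
  sum_n (fun k => Y ^ k / D ^ (k + 1) * Rtail k p (S / D)) q
  <= 1 / (R' - r) * (r / R') ^ (p + 1).
Proof.
  intros [HS0 HS] Hr HY0 HY. set (E := D - Y).
  assert (HE : R' <= E) by (unfold E; lra).
  assert (HD : 0 < D) by lra.
  assert (HSD : 0 <= S / D < 1).
  { apply ratio_bounds. lra. }
  assert (HYD : 0 <= Y / D < 1).
  { apply ratio_bounds. lra. }
  assert (HYS : 0 <= Y / (D - S) < 1).
  { apply ratio_bounds. lra. }
  set (u := fun Q => sum_n (fun n => S ^ n / D ^ (n + 1) * Rtail n Q (Y / D)) p).
  set (f := fun k => Y ^ k / D ^ (k + 1) * Rtail k p (S / D)).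
  assert (Hf : forall k, 0 <= f k).
  { intros k. unfold f. apply Rmult_le_pos; [|now apply Rtail_ge0].
    apply Rdiv_le_0_compat; [now apply pow_le|now apply pow_lt]. }
  (* [u Q] is the error made by stopping the inner sums over [k] at [Q]. *)
  assert (Hsum : forall Q, sum_n f Q <= Rtail 0 p (S / E) / E + u Q).
  { intros Q.
    assert (E1 : sum_n f Q = / (D - S) * sum_n (fun k => multichoose 0 k * (Y / (D - S)) ^ k) Q
       - sum_n (fun n => S ^ n / D ^ (n + 1) * sum_n (fun k => multichoose n k * (Y / D) ^ k) Q) p).
    { rewrite <- rsum_mult_l.
      rewrite (sum_n_ext (fun n => S ^ n / D ^ (n + 1) * sum_n (fun k => multichoose n k * (Y / D) ^ k) Q)
         (fun n => sum_n (fun k => S ^ n / D ^ (n + 1) * (multichoose n k * (Y / D) ^ k)) Q)).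
      2:{ intros n. now rewrite rsum_mult_l. }
      rewrite sum_n_switch, <- rsum_minus. apply sum_n_ext. intros k. unfold f, Rtail.
      rewrite Rmult_minus_distr_l, <- rsum_mult_l, multichoose_0_l. f_equal.
      - unfold Rdiv. rewrite !Rpow_mult_distr, !pow_inv.
        replace (k + 1)%nat with (Datatypes.S k) by lia.
        replace (1 - S * / D) with ((D - S) * / D) by (field; lra).
        rewrite Rpow_mult_distr, pow_inv. simpl pow. field.
        repeat split; try lra; apply pow_nonzero; lra.
      - f_equal. extensionality n. rewrite (multichoose_sym k n).
        unfold Rdiv. rewrite !Rpow_mult_distr, !pow_inv, !pow_add. Req. field.
        repeat split; try lra; apply pow_nonzero; lra. }
    assert (E2 : sum_n (fun n => S ^ n / D ^ (n + 1) * sum_n (fun k => multichoose n k * (Y / D) ^ k) Q) p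
       = / E * sum_n (fun n => multichoose 0 n * (S / E) ^ n) p - u Q).
    { unfold u. rewrite <- rsum_mult_l, <- rsum_minus. apply sum_n_ext. intros n.
      unfold Rtail. rewrite multichoose_0_l.
      assert (X : S ^ n / D ^ (n + 1) * / (1 - Y / D) ^ Datatypes.S n = / E * (1 * (S / E) ^ n)).
      { unfold Rdiv. replace (1 - Y * / D) with (E * / D) by (unfold E; field; lra).
        replace (n + 1)%nat with (Datatypes.S n) by lia.
        rewrite !Rpow_mult_distr, !pow_inv. simpl pow. field.
        repeat split; try lra; apply pow_nonzero; lra. }
      rewrite <- X. Req. ring. }
    rewrite E1, E2.
    pose proof (Rtail_ge0 0 Q _ HYS) as P. unfold Rtail in P. rewrite pow_1 in P.
    assert (P2 : / (D - S) * sum_n (fun k => multichoose 0 k * (Y / (D - S)) ^ k) Q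
       <= / (D - S) * / (1 - Y / (D - S))).
    { apply Rmult_le_compat_l; [left; apply Rinv_0_lt_compat|]; lra. }
    assert (P3 : / (D - S) * / (1 - Y / (D - S)) = / (E - S))
      by (unfold E; field; lra).
    rewrite P3 in P2.
    assert (P4 : Rtail 0 p (S / E) / E = / (E - S) - / E * sum_n (fun n => multichoose 0 n * (S / E) ^ n) p).
    { unfold Rtail. rewrite pow_1. unfold Rdiv at 1. rewrite Rmult_minus_distr_r.
      f_equal; [field; lra|Req; ring]. }
    rewrite P4. lra. }
  assert (Hu : is_lim_seq u 0).
  { apply (sum_lim_0 (fun n Q => S ^ n / D ^ (n + 1) * Rtail n Q (Y / D))). intros n.
    replace (Finite 0) with (Rbar_mult (S ^ n / D ^ (n + 1)) 0) by (simpl; f_equal; ring).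
    apply is_lim_seq_scal_l. now apply Rtail_lim. }
  assert (Hmon : forall Q, sum_n f q <= sum_n f (q + Q)).
  { induction Q as [|Q IH]; [rewrite Nat.add_0_r; lra|].
    rewrite Nat.add_succ_r, rsum_S. pose proof (Hf (Datatypes.S (q + Q))). lra. }
  assert (Hlim : sum_n f q - Rtail 0 p (S / E) / E <= 0).
  { apply (limit_nonpos _ (fun Q => u (Q + q)%nat)).
    - intros Q. pose proof (Hmon Q). pose proof (Hsum (q + Q)%nat).
      rewrite (Nat.add_comm Q q). lra.
    - now apply (is_lim_seq_incr_n u q). }
  assert (HSE : S / E < 1).
  { apply ratio_bounds. lra. }
  apply Rle_trans with (Rtail 0 p (S / E) / E); [fold f; lra|].
  rewrite Rtail_0 by auto.
  replace ((S / E) ^ Datatypes.S p / (1 - S / E) / E) with (1 / (E - S) * (S / E) ^ (p + 1)).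
  2:{ replace (p + 1)%nat with (Datatypes.S p) by lia. field. lra. }
  apply Rmult_le_compat.
  - apply Rdiv_le_0_compat; lra.
  - apply pow_le, Rdiv_le_0_compat; lra.
  - unfold Rdiv. rewrite !Rmult_1_l. apply Rinv_le_contravar; lra.
  - apply pow_incr. split; [apply Rdiv_le_0_compat; lra|].
    apply Rmult_le_compat; try lra; [left; apply Rinv_0_lt_compat; lra|].
    apply Rinv_le_contravar; lra.
Qed.

(** * The two local expansions *)

Lemma multipole_admissible_radius s f rho :
  multipole_admissible (fun x => x <> s) f zero rho -> 0 < rho /\ enorm s < rho.
Proof.
  intros [Hr [Hdom _]]. split; auto. destruct (Rlt_le_dec (enorm s) rho) as [H|H]; auto.
  exfalso. refine (Hdom s _ eq_refl). unfold oball.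
  assert (E : minus s (zero : R3) = s) by apply (minus_zero_r s).
  rewrite E. lra.
Qed.

Lemma local_admissible_radius s f c rho :
  local_admissible (fun x => x <> s) f c rho -> 0 < rho /\ rho < enorm (minus s c).
Proof.
  intros [Hr [Hdom _]]. split; auto.
  destruct (Rlt_le_dec rho (enorm (minus s c))) as [H|H]; auto.
  exfalso. now refine (Hdom s _ eq_refl).
Qed.

(** The expansion in the displacement from [c] is computed about the axis of
    [c - s], where it converges up to the singularity, and is then carried over to
    the axis of [c], common with the multipole terms. *)
Lemma local_exp_potential G (c s t : R3) q rho :
  c = scal (enorm c) (fd G) -> enorm s < enorm c ->
  0 < rho -> rho < enorm (minus s c) ->
  local_exp q (point_potential s) c rho t
  = sum_n (fun k => RtoC ((-1) ^ k)
                    * taylor_coef G (enorm c) (scal (-1) s) k (minus t c))%C q.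
Proof.
  intros HG Hsc Hr Hrho.
  set (X := minus c s : R3). destruct (frame_exists X) as [H HX].
  assert (HXr : rho < enorm X) by (unfold X; rewrite enorm_minus_sym; auto).
  assert (Hs' : enorm (scal (-1) s) = enorm s).
  { rewrite enorm_scal, Rabs_m1. ring. }
  rewrite (local_exp_sum _ _ _
    (fun k y => RtoC ((-1) ^ k) * taylor_coef H (enorm X) zero k y)%C
    (fun K => / (enorm X - rho) * (rho / enorm X) ^ S K)).
  - apply sum_n_ext. intros k. Ceq. f_equal.
    apply taylor_coef_frame.
    + rewrite enorm_zero. lra.
    + rewrite Hs'. auto.
    + intros a. rewrite <- HX, <- HG. f_equal. unfold X.
      generalize (minus t c : R3). intros y. destruct c as [[? ?] ?], s as [[? ?] ?], y as [[? ?] ?].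
      R3_ring.
  - auto.
  - intros k. apply solid_span_scal, taylor_coef_centre_span. lra.
  - intros K y Hy. pose proof (potential_series H (enorm X) y K) as P.
    rewrite Hy in P. specialize (P HXr).
    eapply Rle_trans; [|eapply Rle_trans; [exact P|unfold Rdiv; lra]].
    right. do 2 f_equal. unfold point_potential. do 3 f_equal.
    rewrite <- HX. unfold X. clear - y. 
    destruct c as [[? ?] ?], s as [[? ?] ?], y as [[? ?] ?]. R3_ring.
  - apply is_lim_seq_geom0, ratio_bounds. lra.
Qed.

(** Each multipole term is a Taylor coefficient of the potential in the direction
    [s] at the point of evaluation [c + y]; written about the axis of [c] it
    expands in powers of [y] for [|y| < |c|]. *)
Lemma local_exp_multipole G (c s t : R3) p q rho1 rho :
  c = scal (enorm c) (fd G) ->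
  enorm s < rho1 -> 0 < rho -> rho < enorm c ->
  local_exp q (multipole_exp p (point_potential s) zero rho1) c rho t
  = sum_n (fun k => sum_n (fun n =>
      RtoC ((-1) ^ k) * mixed_coef G (enorm c) n k s (minus t c))%C p) q.
Proof.
  intros HG Hs Hr Hrho.
  destruct (frame_exists s) as [F HF].
  assert (Hx01 : 0 <= rho / enorm c < 1).
  { apply ratio_bounds. lra. }
  apply (local_exp_sum _ _ _
    (fun k y => sum_n (fun n => RtoC ((-1) ^ k) * mixed_coef G (enorm c) n k s y)%C p)
    (fun K => sum_n (fun n => enorm s ^ n / enorm c ^ S n * Rtail n K (rho / enorm c)) p)).
  - auto.
  - intros k. apply (solid_span_sum k (fun n y => RtoC ((-1) ^ k) * mixed_coef G (enorm c) n k s y)%C).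
    intros n. apply solid_span_scal, mixed_coef_span.
  - intros K y Hy. set (x := plus c y : R3).
    assert (Hx : enorm x <> 0).
    { intros E. pose proof (enorm_triangle x (scal (-1) y)) as T.
      rewrite enorm_scal, Rabs_m1, Hy, E in T.
      assert (Ex : plus x (scal (-1) y) = c).
      { unfold x. clear. destruct c as [[? ?] ?], y as [[? ?] ?]. R3_ring. }
      rewrite Ex in T. lra. }
    rewrite (multipole_potential F) by auto.
    rewrite (sum_n_ext _ (fun n => taylor_coef G (enorm c) y n s)).
    2:{ intros n. apply taylor_coef_frame.
      - rewrite enorm_zero. pose proof (enorm_ge0 x). lra.
      - lra.
      - intros a. rewrite <- HG.
        assert (E1 : plus (zero : R3) (scal a (scal (enorm s) (hat x)))
                     = scal (a * enorm s * / enorm x) x).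
        { unfold hat. generalize (enorm s) (/ enorm x). intros u v. 
          destruct x as [[? ?] ?]. R3_ring. }
        assert (E2 : plus c (plus y (scal a s)) = plus x (scal a s)).
        { unfold x. clear. destruct c as [[? ?] ?], y as [[? ?] ?], s as [[? ?] ?]. R3_ring. }
        transitivity (enorm (plus (scal (enorm x) (fd F))
                                  (scal (a * enorm s * / enorm x) x))).
        { f_equal. exact (f_equal (plus (scal (enorm x) (fd F))) E1). }
        transitivity (enorm (plus x (scal a s))); [|exact (f_equal enorm (eq_sym E2))].
        apply enorm_eq.
        rewrite !dot_plus_l, !dot_plus_r, !dot_scal_l, !dot_scal_r, fd_unit.
        rewrite (dot_sym x (fd F)), (dot_sym s x), <- (enorm_sq x), <- (enorm_sq s).
        replace (dot x s) with (enorm s * dot (fd F) x)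
          by (rewrite HF at 2; rewrite dot_scal_r, dot_sym; reflexivity).
        field. auto. }
    rewrite sum_n_switch, <- csum_minus.
    eapply Rle_trans; [apply csum_Cmod|]. apply rsum_le. intros n _.
    pose proof (taylor_coef_series G (enorm c) y n s rho K) as P.
    apply P; lra.
  - apply (sum_lim_0 (fun n K => enorm s ^ n / enorm c ^ S n * Rtail n K (rho / enorm c))).
    intros n.
    replace (Finite 0) with (Rbar_mult (enorm s ^ n / enorm c ^ S n) 0)
      by (simpl; f_equal; ring).
    apply is_lim_seq_scal_l. now apply Rtail_lim.
Qed.

Theorem theorem3p8 :
  forall (p q : nat) (R' r : R) (s c t : R3),
    R' > r -> r > 0 ->
    enorm s <= r ->
    enorm c >= R' ->
    enorm (minus t c) <= enorm c - R' ->
    forall rho1 rho2 rho3 : R,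
      let phi_s := point_potential s in
      let Mp_phi_s := multipole_exp p phi_s zero rho1 in
      multipole_admissible (fun x => x <> s) phi_s zero rho1 ->
      local_admissible (fun x => x <> s) phi_s c rho2 ->
      local_admissible (fun x => x <> zero) Mp_phi_s c rho3 ->
      Cmod (local_exp q phi_s c rho2 t - local_exp q Mp_phi_s c rho3 t)%C
      <= 1 / (R' - r) * (r / R') ^ (p + 1).
Proof.
  intros p q R' r s c t HR Hr Hs Hc Ht rho1 rho2 rho3 phi_s Mp_phi_s A1 A2 A3.
  apply multipole_admissible_radius in A1. destruct A1 as [R1 S1].
  apply local_admissible_radius in A2. destruct A2 as [R2 S2].
  apply local_admissible_radius in A3. destruct A3 as [R3' S3].
  assert (E0 : enorm (minus (zero : R3) c) = enorm c).
  { rewrite enorm_minus_sym. f_equal. apply (minus_zero_r c). }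
  rewrite E0 in S3.
  pose proof (enorm_ge0 s) as Hs0.
  destruct (frame_exists c) as [G HG].
  unfold Mp_phi_s, phi_s.
  rewrite (local_exp_potential G) by (auto; lra).
  rewrite (local_exp_multipole G) by auto.
  set (y := minus t c : R3) in *. set (D := enorm c) in *.
  rewrite <- csum_minus.
  eapply Rle_trans; [apply csum_Cmod|].
  eapply Rle_trans; [|apply (double_tail D (enorm s) (enorm y) r R' p q);
    try lra; try apply enorm_ge0].
  apply rsum_le. intros k _.
  pose proof (taylor_coef_series G D (scal (-1) s) k y (enorm s) p) as P.
  rewrite enorm_scal, Rabs_m1, Rmult_1_l in P.
  specialize (P (Rle_refl _) ltac:(lra)).
  replace (k + 1)%nat with (S k) by lia.
  eapply Rle_trans; [|exact P]. right.
  rewrite csum_mult_l.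
  replace (sum_n (fun n => mixed_coef G D n k s y) p)
    with (sum_n (fun n => RtoC ((-1) ^ n) * mixed_coef G D k n y (scal (-1) s))%C p).
  - match goal with |- Cmod (?u * ?a - ?u * ?b)%C = _ =>
      replace (u * a - u * b)%C with (u * (a - b))%C by (Ceq; ring) end.
    rewrite Cmod_mult, Cmod_R, <- RPow_abs, Rabs_m1, pow1. ring.
  - apply sum_n_ext. intros n. rewrite mixed_coef_scal_r, Cmult_assoc, <- RtoC_mult, sign_sq.
    rewrite mixed_coef_sym. Ceq. ring.
Qed.
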